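(* Let $\pi_k: Y\to X$ be a finite dominant morphism between quasi-projective varieties defined over a number field $k$. Fix an embedding $k\hookrightarrow\mathbb{C}$ and let $\pi: Y(\mathbb{C})\to X(\mathbb{C})$ be the corresponding map between complex points. For an automorphism $\sigma\in\mathrm{Gal}(\overline{\mathbb{Q}}/\mathbb{Q})$ let $\pi^\sigma: Y^\sigma(\mathbb{C})\to X^\sigma(\mathbb{C})$ be the corresponding map between the complex points of the conjugate varieties. Then $\pi$ is an unramified topological cover if and only if $\pi^\sigma$ is an unramified topological cover.
   Context: Algebraic varieties are allowed to be reducible. Sets of complex points carry the complex (Euclidean) topology. A continuous surjective map $\pi: W\to V$ of topological spaces is an (unramified) topological cover if for every $p\in V$ there exist an open neighbourhood $U\subset V$ of $p$, a discrete set $F$, and a homeomorphism $\pi^{-1}(U)\to U\times F$ commuting with the projections to $U$. The number field $k$ is assumed to be Galois over $\mathbb{Q}$. If $X$ is a variety over $k$, explicitly embedded in a projective space by equations over $k$, and $\sigma\in\mathrm{Gal}(\overline{\mathbb{Q}}/\mathbb{Q})$, the conjugate variety $X^\sigma$ is defined by the equations obtained by applying $\sigma$ to the coefficients of the equations defining $X$; it is defined over $\sigma(k)=k$. The conjugate morphism $\pi^\sigma: Y^\sigma\to X^\sigma$ is obtained similarly by applying $\sigma$ to the coefficients of $\pi_k$. Complex points of $X^\sigma$, $Y^\sigma$ are taken with respect to the same fixed embedding $k\hookrightarrow\mathbb{C}$ (equivalently, one considers the complex points of $X$, $Y$ via the embedding of $k$ in $\mathbb{C}$ obtained by precomposing the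 fixed one with $\sigma$). *)

(* Defs.v *)
From HB Require Import structures.
From mathcomp Require Import all_boot all_order all_algebra all_field.
From mathcomp Require mpoly.
From mathcomp Require Import all_classical all_reals topology normedtype.
Import numFieldNormedType.Exports.
From mathcomp Require Import complex.
(* The notations of mpoly clash with those of mathcomp-analysis: below,
   [mpoly n k] is {mpoly k[n]}, [ishomog1 d mdeg] is d.-homog and
   [ishomog mdeg] is "homogeneous of some degree". *)
Import -(notations) mpoly.

Set Implicit Arguments.
Unset Strict Implicit.
Unset Printing Implicit Defensive.

Import GRing.Theory Num.Theory.
Local Open Scope ring_scope.
Local Open Scope quotient_scope.
Local Open Scope classical_set_scope.

(* Varieties over k are reduced, so they, their morphisms and their regular
   functions are given by what they do on L-points, for all field extensions
   e : k -> L.  A point of P^n(L) is handled through any vector v != 0 of its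
   homogeneous coordinates; u and v are the same point iff (u == v)%MS. *)

Definition mev (k L : fieldType) (e : {rmorphism k -> L}) (n : nat)
    (p : mpoly n k) (v : 'rV[L]_n) : L :=
  mmap e (v 0) p.

(* The locally closed subset V(qp_eqs) \ V(qp_neqs) of P^n. *)
Record qpvar (k : fieldType) (n : nat) := QPVar {
  qp_eqs : seq (mpoly n.+1 k);
  qp_neqs : seq (mpoly n.+1 k);
  qp_eqs_homog : all (fun p => p \is ishomog mdeg) qp_eqs;
  qp_neqs_homog : all (fun p => p \is ishomog mdeg) qp_neqs }.

Definition in_var (k L : fieldType) (e : {rmorphism k -> L}) (n : nat)
    (X : qpvar k n) (v : 'rV[L]_n.+1) : bool :=
  [&& v != 0, all (fun p => mev e p v == 0) (qp_eqs X)
    & has (fun q => mev e q v != 0) (qp_neqs X)].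

Definition mxev (k L : fieldType) (e : {rmorphism k -> L}) (n m : nat)
    (c : 'rV[mpoly n k]_m) (v : 'rV[L]_n) : 'rV[L]_m :=
  \row_j mev e (c 0 j) v.

(* A morphism is given locally by forms of the same degree.  It is no loss of
   generality to ask a chart c to be correct at every point of Y where it does
   not vanish: multiply c by forms vanishing on the closed complement of the
   open subset of Y where c is known to be correct. *)
Record morphism (k : fieldType) (n m : nat) (Y : qpvar k n) (X : qpvar k m) :=
  Morphism {
  mor_charts : seq 'rV[mpoly n.+1 k]_m.+1;
  mor_homog : forall c, c \in mor_charts ->
    exists d, forall j, c 0 j \is ishomog1 d mdeg;
  mor_cover : forall (L : fieldType) (e : {rmorphism k -> L}) v,
    in_var e Y v -> exists2 c, c \in mor_charts & mxev e c v != 0;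
  mor_into : forall (L : fieldType) (e : {rmorphism k -> L}) v c,
    in_var e Y v -> c \in mor_charts -> mxev e c v != 0 ->
    in_var e X (mxev e c v);
  mor_glue : forall (L : fieldType) (e : {rmorphism k -> L}) v c d,
    in_var e Y v -> c \in mor_charts -> d \in mor_charts ->
    mxev e c v != 0 -> mxev e d v != 0 -> (mxev e c v == mxev e d v)%MS }.

Definition mor_app (k L : fieldType) (e : {rmorphism k -> L}) (n m : nat)
    (Y : qpvar k n) (X : qpvar k m) (f : morphism Y X) (v : 'rV[L]_n.+1) :
    'rV[L]_m.+1 :=
  head 0 [seq w <- [seq mxev e c v | c <- mor_charts f] | w != 0].

(* Regular functions: locally quotients F / G of forms of the same degree. *)
Record regfun (k : fieldType) (n : nat) (X : qpvar k n) := RegFun {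
  rf_charts : seq (mpoly n.+1 k * mpoly n.+1 k);
  rf_homog : forall c, c \in rf_charts ->
    exists d, c.1 \is ishomog1 d mdeg /\ c.2 \is ishomog1 d mdeg;
  rf_cover : forall (L : fieldType) (e : {rmorphism k -> L}) v,
    in_var e X v -> exists2 c, c \in rf_charts & mev e c.2 v != 0;
  rf_glue : forall (L : fieldType) (e : {rmorphism k -> L}) v c d,
    in_var e X v -> c \in rf_charts -> d \in rf_charts ->
    mev e c.2 v != 0 -> mev e d.2 v != 0 ->
    mev e c.1 v / mev e c.2 v = mev e d.1 v / mev e d.2 v }.

Definition rf_app (k L : fieldType) (e : {rmorphism k -> L}) (n : nat)
    (X : qpvar k n) (h : regfun X) (v : 'rV[L]_n.+1) : L :=
  head 0 [seq mev e c.1 v / mev e c.2 v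
         | c <- rf_charts h & mev e c.2 v != 0].

Definition isomorphic (k : fieldType) (n m : nat)
    (X : qpvar k n) (Y : qpvar k m) : Prop :=
  exists (f : morphism X Y) (g : morphism Y X),
    (forall (L : fieldType) (e : {rmorphism k -> L}) v,
       in_var e X v -> (mor_app e g (mor_app e f v) == v)%MS) /\
    (forall (L : fieldType) (e : {rmorphism k -> L}) w,
       in_var e Y w -> (mor_app e f (mor_app e g w) == w)%MS).

(* Isomorphic to a closed subvariety of the standard affine chart 'X_0 != 0. *)
Definition affine (k : fieldType) (n : nat) (X : qpvar k n) : Prop :=
  exists (N : nat) (Z : qpvar k N),
    qp_neqs Z = [:: @mpolyX N.+1 k (mnm1 ord0)] /\ isomorphic X Z.

Definition open_subvar (k : fieldType) (n : nat) (V X : qpvar k n) : Prop :=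
  exists2 hs : seq (mpoly n.+1 k), all (fun p => p \is ishomog mdeg) hs &
    forall (L : fieldType) (e : {rmorphism k -> L}) v,
      in_var e V v = in_var e X v && has (fun h => mev e h v != 0) hs.

(* k[U] is finite as a k[V]-module, where f maps U into V. *)
Definition finite_over (k : fieldType) (n m : nat) (Y : qpvar k n)
    (X : qpvar k m) (f : morphism Y X) (U : qpvar k n) (V : qpvar k m) : Prop :=
  exists gs : seq (regfun U), forall h : regfun U,
    exists2 az : seq (regfun V), size az = size gs &
      forall (L : fieldType) (e : {rmorphism k -> L}) u, in_var e U u ->
        rf_app e h u =
          \sum_(ag <- zip az gs) rf_app e ag.1 (mor_app e f u) * rf_app e ag.2 u.

(* Every point of X has an affine open neighbourhood V whose preimage U is
   affine, with k[U] a finite k[V]-module. *)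
Definition finite_morphism (k : fieldType) (n m : nat) (Y : qpvar k n)
    (X : qpvar k m) (f : morphism Y X) : Prop :=
  forall (L : fieldType) (e : {rmorphism k -> L}) x, in_var e X x ->
    exists (V : qpvar k m) (U : qpvar k n),
      [/\ open_subvar V X, in_var e V x,
          (forall (L' : fieldType) (e' : {rmorphism k -> L'}) y,
             in_var e' U y = in_var e' Y y && in_var e' V (mor_app e' f y)),
          affine V /\ affine U & finite_over f U V].

(* The image is Zariski dense: every hypersurface containing it contains X. *)
Definition dominant (k : fieldType) (n m : nat) (Y : qpvar k n)
    (X : qpvar k m) (f : morphism Y X) : Prop :=
  forall h : mpoly m.+1 k, h \is ishomog mdeg ->
    (forall (L : fieldType) (e : {rmorphism k -> L}) y,
       in_var e Y y -> mev e h (mor_app e f y) = 0) ->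
    forall (L : fieldType) (e : {rmorphism k -> L}) x,
      in_var e X x -> mev e h x = 0.

Lemma mev_scale (k L : fieldType) (e : {rmorphism k -> L}) n (p : mpoly n k) d
    (a : L) (v : 'rV[L]_n) :
  p \is ishomog1 d mdeg -> mev e p (a *: v) = a ^+ d * mev e p v.
Proof.
move=> /dhomogP hp; rewrite /mev /mmap mulr_sumr; apply: eq_big_seq => m /hp.
rewrite /= mdegE => <-; rewrite mulrCA; congr (_ * _).
rewrite /mmap1 -prodrXr -big_split /=; apply: eq_bigr => i _.
by rewrite mxE exprMn.
Qed.

Lemma projP (L : fieldType) n (u v : 'rV[L]_n) : u != 0 -> (u == v)%MS ->
  exists2 a : L, a != 0 & u = a *: v.
Proof.
move=> u0 /andP[/sub_rVP[a uv] _]; exists a => //.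
by apply: contraNneq u0 => a0; rewrite uv a0 scale0r.
Qed.

Lemma in_var_proj (k L : fieldType) (e : {rmorphism k -> L}) n (X : qpvar k n)
    (u v : 'rV[L]_n.+1) : u != 0 -> (u == v)%MS -> in_var e X u = in_var e X v.
Proof.
move=> u0 /(projP u0) [a a0 uv]; rewrite /in_var uv.
have ev0 p : p \is ishomog mdeg -> (mev e p (a *: v) == 0) = (mev e p v == 0).
  by move=> /homogP[d /mev_scale ->]; rewrite mulf_eq0 expf_eq0 (negPf a0) andbF.
rewrite scaler_eq0 (negPf a0) /=; congr [&& _, _ & _].
  by apply: eq_in_all => p /(allP (qp_eqs_homog X)) /ev0.
by apply: eq_in_has => p /(allP (qp_neqs_homog X)) /ev0 ->.
Qed.

Lemma mor_appP (k L : fieldType) (e : {rmorphism k -> L}) n m (Y : qpvar k n)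
    (X : qpvar k m) (f : morphism Y X) v : in_var e Y v ->
  exists2 c, c \in mor_charts f & mxev e c v != 0 /\ mor_app e f v = mxev e c v.
Proof.
have head_in (T : eqType) (x0 x : T) r : x \in r -> head x0 r \in r.
  by case: r => //= y r _; rewrite inE eqxx.
move=> Yv; have [c cf cv] := mor_cover f Yv.
have : mor_app e f v \in [seq w <- [seq mxev e c v | c <- mor_charts f] | w != 0].
  by apply: (head_in _ _ (mxev e c v)); rewrite mem_filter cv /=; apply/mapP; exists c.
rewrite mem_filter => /andP[fv0 /mapP[d df fv]].
by exists d => //; rewrite -fv.
Qed.

Lemma mor_app_in (k L : fieldType) (e : {rmorphism k -> L}) n m (Y : qpvar k n)
    (X : qpvar k m) (f : morphism Y X) v :
  in_var e Y v -> in_var e X (mor_app e f v).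
Proof. by move=> Yv; have [c cf [cv ->]] := mor_appP f Yv; exact: mor_into Yv cf cv. Qed.

Lemma in_var_neq0 (k L : fieldType) (e : {rmorphism k -> L}) n (X : qpvar k n) v :
  in_var e X v -> v != 0.
Proof. by case/and3P. Qed.

Lemma mor_app_proj (k L : fieldType) (e : {rmorphism k -> L}) n m (Y : qpvar k n)
    (X : qpvar k m) (f : morphism Y X) u v : in_var e Y u -> (u == v)%MS ->
  (mor_app e f u == mor_app e f v)%MS.
Proof.
move=> Yu uv; have u0 := in_var_neq0 Yu.
have Yv : in_var e Y v by rewrite -(in_var_proj _ _ u0 uv).
have [a a0 Duv] := projP u0 uv.
have [c cf [cu ->]] := mor_appP f Yu; have [d df [dv ->]] := mor_appP f Yv.
have [D hD] := mor_homog cf.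
have cuv : mxev e c u = a ^+ D *: mxev e c v.
  by apply/rowP => j; rewrite !mxE Duv (mev_scale _ _ _ (hD j)).
have cv : mxev e c v != 0 by move: cu; rewrite cuv scaler_eq0 negb_or => /andP[].
have /eqmxP cd := mor_glue Yv cf df cv dv; apply/eqmxP; rewrite cuv.
by apply: eqmx_trans cd; apply: eqmx_scale; rewrite expf_neq0.
Qed.

Section Conjugate.
Context (k : fieldType) (s : {rmorphism k -> k}).

Lemma mev_conj (L : fieldType) (e : {rmorphism k -> L}) n (p : mpoly n k) v :
  mev e (map_mpoly s p) v = mev (e \o s) p v.
Proof.
rewrite /mev /mmap (perm_big _ (msupp_map_mpoly _ (@fmorph_inj _ _ s))) /=.
by apply: eq_bigr => i _; rewrite mcoeff_map_mpoly.
Qed.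

Lemma mxev_conj (L : fieldType) (e : {rmorphism k -> L}) n m
    (c : 'rV[mpoly n k]_m) v :
  mxev e (map_mx (map_mpoly s) c) v = mxev (e \o s) c v.
Proof. by apply/rowP => j; rewrite !mxE mev_conj. Qed.

Lemma ishomog1_conj n d (p : mpoly n k) :
  p \is ishomog1 d mdeg -> map_mpoly s p \is ishomog1 d mdeg.
Proof.
move=> /dhomogP hp; apply/dhomogP => m.
by rewrite (perm_mem (msupp_map_mpoly _ (@fmorph_inj _ _ s))); exact: hp.
Qed.

Lemma ishomog_conj n (ps : seq (mpoly n k)) :
  all (fun p => p \is ishomog mdeg) ps ->
  all (fun p => p \is ishomog mdeg) (map (map_mpoly s) ps).
Proof.
move=> /allP hps; apply/allP => _ /mapP[p /hps /homogP[d hp] ->].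
by apply/homogP; exists d; exact: ishomog1_conj.
Qed.

Definition conj_var n (X : qpvar k n) : qpvar k n :=
  QPVar (ishomog_conj (qp_eqs_homog X)) (ishomog_conj (qp_neqs_homog X)).

Lemma in_var_conj (L : fieldType) (e : {rmorphism k -> L}) n (X : qpvar k n) v :
  in_var e (conj_var X) v = in_var (e \o s) X v.
Proof.
rewrite /in_var /= all_map has_map; congr [&& _, _ & _].
  by apply: eq_all => p /=; rewrite mev_conj.
by apply: eq_has => p /=; rewrite mev_conj.
Qed.

Section ConjugateMorphism.
Context (n m : nat) (Y : qpvar k n) (X : qpvar k m) (f : morphism Y X).

Let charts := [seq map_mx (map_mpoly s) c | c <- mor_charts f].

Fact conj_homog c : c \in charts -> exists d, forall j, c 0 j \is ishomog1 d mdeg.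
Proof.
move=> /mapP[b /mor_homog[d hb] ->]; exists d => j.
by rewrite mxE; exact: ishomog1_conj.
Qed.

Fact conj_cover (L : fieldType) (e : {rmorphism k -> L}) v :
  in_var e (conj_var Y) v -> exists2 c, c \in charts & mxev e c v != 0.
Proof.
rewrite in_var_conj => /(mor_cover f)[c cf cv].
by exists (map_mx (map_mpoly s) c); [apply/mapP; exists c | rewrite mxev_conj].
Qed.

Fact conj_into (L : fieldType) (e : {rmorphism k -> L}) v c :
  in_var e (conj_var Y) v -> c \in charts -> mxev e c v != 0 ->
  in_var e (conj_var X) (mxev e c v).
Proof.
rewrite !in_var_conj => Yv /mapP[b bf ->]; rewrite mxev_conj => bv.
exact: mor_into Yv bf bv.
Qed.

Fact conj_glue (L : fieldType) (e : {rmorphism k -> L}) v c d :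
  in_var e (conj_var Y) v -> c \in charts -> d \in charts ->
  mxev e c v != 0 -> mxev e d v != 0 -> (mxev e c v == mxev e d v)%MS.
Proof.
rewrite in_var_conj => Yv /mapP[b bf ->] /mapP[b' bf' ->]; rewrite !mxev_conj => bv bv'.
exact: mor_glue Yv bf bf' bv bv'.
Qed.

Definition conj_mor : morphism (conj_var Y) (conj_var X) :=
  Morphism conj_homog conj_cover conj_into conj_glue.

End ConjugateMorphism.
End Conjugate.

(* A splittingFieldType rat is the same as a number field Galois over Q. *)
Lemma splitting_rat_galois (k : splittingFieldType rat) : galois 1 {:k}.
Proof.
rewrite /galois sub1v normalFieldf andbT /=.
apply/separableP => y _; apply: pcharf0_separable => p.
by rewrite pchar_lalg pchar_num.
Qed.

(* The restriction of sigma to k, which it preserves since k is normal. *)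
Definition gal_restrict (k : splittingFieldType rat)
    (iota : {rmorphism k -> algC}) (sigma : {rmorphism algC -> algC}) :
    {rmorphism k -> k} :=
  sval (restrict_aut_to_normal_num_field iota sigma).

Lemma gal_restrictE (k : splittingFieldType rat) (iota : {rmorphism k -> algC})
    (sigma : {rmorphism algC -> algC}) x :
  iota (gal_restrict iota sigma x) = sigma (iota x).
Proof. exact: (svalP (restrict_aut_to_normal_num_field iota sigma)). Qed.

Section ProjectiveSpace.
Context (K : numFieldType) (n : nat).

Definition nzvec : set 'rV[K]_n.+1 := [set v | v != 0].

Definition proj_rel (u v : nzvec) : bool := (val u == val v)%MS.

Fact proj_rel_equiv : equiv_class_of proj_rel.
Proof.
split=> [u | u v | v u w]; rewrite /proj_rel.
- by rewrite submx_refl.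
- by rewrite andbC.
- by move=> /eqmxP uv /eqmxP vw; apply/eqmxP; exact: eqmx_trans uv vw.
Qed.

Canonical proj_equiv := EquivRelPack proj_rel_equiv.

(* P^n(K) with the quotient topology from K^(n+1) \ {0}. *)
Definition projspace : topologicalType :=
  quotient_topology {eq_quot proj_equiv}.

Definition proj_class (v : 'rV[K]_n.+1) (v0 : v != 0) : projspace :=
  \pi_{eq_quot proj_equiv} (exist _ v (mem_set v0) : nzvec).

Definition proj_repr (p : projspace) : 'rV[K]_n.+1 :=
  val (repr (p : {eq_quot proj_equiv})).

Lemma proj_repr_neq0 p : proj_repr p != 0.
Proof. exact: (set_mem (valP (repr (p : {eq_quot proj_equiv})))). Qed.

Lemma proj_classK v (v0 : v != 0) : (proj_repr (proj_class v0) == v)%MS.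
Proof.
rewrite /proj_repr /proj_class; case: piP => u /eqmodP /=.
by rewrite /proj_rel /= andbC.
Qed.

End ProjectiveSpace.

Section Points.
Context (k : fieldType) (K : numFieldType) (e : {rmorphism k -> K}).

Definition points n (X : qpvar k n) : set (projspace K n) :=
  [set p | in_var e X (proj_repr p)].

Lemma points_class n (X : qpvar k n) v (Xv : in_var e X v) :
  points X (proj_class (in_var_neq0 Xv)).
Proof.
by rewrite /points /= (in_var_proj _ _ (proj_repr_neq0 _) (proj_classK _)).
Qed.

Definition point n (X : qpvar k n) v (Xv : in_var e X v) : points X :=
  exist (fun p => p \in points X) _ (mem_set (points_class Xv)).

Context (n m : nat) (Y : qpvar k n) (X : qpvar k m) (f : morphism Y X).

Definition points_map (y : points Y) : points X :=
  point (mor_app_in f (set_mem (valP y) : in_var e Y (proj_repr (val y)))).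

Lemma points_mapE v (Yv : in_var e Y v) :
  points_map (point Yv) = point (mor_app_in f Yv).
Proof.
apply: val_inj => /=; apply/eqmodP; rewrite /= /proj_rel /=.
exact: mor_app_proj (points_class Yv) (proj_classK _).
Qed.

End Points.

Arguments points_map {k K} e {n m Y X} f y.

Definition topological_cover (W V : topologicalType) (f : W -> V) : Prop :=
  [/\ continuous f, set_surj setT setT f &
      forall p : V, exists2 U : set V, open_nbhs p U &
        exists (F : discreteTopologicalType)
            (phi : f @^-1` U -> U * F) (psi : U * F -> f @^-1` U),
          [/\ continuous phi, continuous psi, cancel phi psi, cancel psi phi &
              forall w, val (phi w).1 = f (val w)]].

(* Main.v *)
From HB Require Import structures.
Require Import Defs.
From mathcomp Require Import all_boot all_order all_algebra all_field.
From mathcomp Require mpoly.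
From mathcomp Require Import all_classical all_reals topology normedtype.
From mathcomp Require Import complex.
From mathcomp Require Import zify ring.
Import numFieldNormedType.Exports.
Import -(notations) mpoly.
Import Order.TTheory GRing.Theory Num.Theory.
Set Implicit Arguments.
Unset Strict Implicit.
Unset Printing Implicit Defensive.
Local Open Scope ring_scope.
Local Open Scope classical_set_scope.

(** Only the two embeddings [eps] and [eps \o s] of the number field in the
    complex numbers matter.  They differ by a field automorphism [tau] of the
    complex numbers ([extend_automorphism]).  As [tau] is in general
    discontinuous, the task is to describe covers by conditions from which the
    Euclidean topology has disappeared.

    On points, a finite morphism is proper with finite fibres
    ([finite_morphism_points]).  Such a map is a cover as soon as it is
    surjective, locally injective, and has fibres whose cardinality does not
    drop near a point: disjoint neighbourhoods of the points of one fibre then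
    contain exactly one point each of every nearby fibre
    ([finite_proper_cover]).  The failure of either of the last two conditions
    says that some point is in the closure of some set: a diagonal point
    (y, y) is a limit of pairs of distinct points with the same image, or a
    point with d preimages is a limit of points with fewer than d preimages
    ([cover_criterionP]).  Both sets are constructible, by elimination of
    quantifiers ([constructible_ex]), and a constructible set has the same
    closure in the Euclidean and in the Zariski topology
    ([zariski_sub_closure]).  Zariski closures are respected by [tau]
    ([cover_criterion_transport]).

    The comparison of closures goes as follows.  Let p be in the Zariski
    closure of a constructible set S.  An ultrafilter on S, every almost
    everywhere valid polynomial equation of which holds at p, plays the role
    of the generic point of an irreducible subvariety through p
    ([zariski_ultrafilter]).  Noether normalization provides algebraically
    independent coordinates y over which S is bounded ([ultra_noether]), so
    that every polynomial function u satisfies a monic equation over y, almost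
    all solutions of which come from S ([integral_equation]); the coefficients
    of the minimal equation are polynomials in y, and not just rational
    functions, because they are locally bounded ([mpoly_dvd_of_bounded]).  For
    u, take a linear form that separates p from the finitely many other
    candidates above y(p): as the roots of a monic polynomial vary
    continuously, there are points of S near p. *)

(** * Automorphisms of an algebraically closed field *)

Section PartialAutomorphisms.
Context (C : closedFieldType).
Implicit Types (T : set (C * C)) (x y : C) (p q r : {poly C} * {poly C}).

(** The graph of an isomorphism between two subrings of [C].  Graphs are
    subsets of [C * C], so that Zorn's lemma applies to them directly. *)
Record subring_iso T : Prop := SubringIso {
  sri1 : T (1, 1);
  sriB : forall a b, T a -> T b -> T (a.1 - b.1, a.2 - b.2);
  sriM : forall a b, T a -> T b -> T (a.1 * b.1, a.2 * b.2);
  sri_inj : forall a, T a -> (a.1 == 0) = (a.2 == 0) }.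

(** Pairs of corresponding polynomials over the two subrings. *)
Definition polyg T : set ({poly C} * {poly C}) :=
  [set q : {poly C} * {poly C} | forall i, T (q.1`_i, q.2`_i)].

Definition adjoin T x y : set (C * C) :=
  [set a | exists2 q, polyg T q & a = (q.1.[x], q.2.[y])].

Section Theory.
Context (T : set (C * C)) (gT : subring_iso T).

Lemma sri0 : T (0, 0).
Proof. by have := sriB gT (sri1 gT) (sri1 gT); rewrite /= subrr. Qed.

Lemma sriD a b : T a -> T b -> T (a.1 + b.1, a.2 + b.2).
Proof.
move=> Ta Tb; have := sriB gT Ta (sriB gT sri0 Tb).
by rewrite /= !sub0r !opprK.
Qed.

Lemma sri_sum (I : Type) (s : seq I) (F G : I -> C) :
  (forall i, T (F i, G i)) -> T (\sum_(i <- s) F i, \sum_(i <- s) G i).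
Proof.
move=> TF; elim: s => [|i s IHs]; first by rewrite !big_nil; exact: sri0.
by rewrite !big_cons; have := sriD (TF i) IHs.
Qed.

Lemma polyg_size q : polyg T q -> size q.1 = size q.2.
Proof.
move=> Tq; apply/eqP; rewrite eqn_leq; apply/andP; split; apply/leq_sizeP.
  move=> i /leq_sizeP/(_ _ (leqnn _)) q2i.
  by apply/eqP; rewrite (sri_inj gT (Tq i)) /= q2i.
move=> i /leq_sizeP/(_ _ (leqnn _)) q1i.
by apply/eqP; rewrite -(sri_inj gT (Tq i)) /= q1i.
Qed.

Lemma polygB p q : polyg T p -> polyg T q -> polyg T (p.1 - q.1, p.2 - q.2).
Proof. by move=> Tp Tq i; rewrite !coefB; exact: (sriB gT (Tp i) (Tq i)). Qed.

Lemma polygM p q : polyg T p -> polyg T q -> polyg T (p.1 * q.1, p.2 * q.2).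
Proof.
move=> Tp Tq i; rewrite !coefM; apply: sri_sum => j.
exact: (sriM gT (Tp _) (Tq _)).
Qed.

Lemma polygC a : T a -> polyg T (a.1%:P, a.2%:P).
Proof.
by case: a => a b Ta i; rewrite !coefC; case: (i == 0); [|exact: sri0].
Qed.

Lemma polygXn n : polyg T ('X^n, 'X^n).
Proof.
by move=> i; rewrite !coefXn; case: (i == n); [exact: (sri1 gT)|exact: sri0].
Qed.

Lemma polyg_lead q : polyg T q -> T (lead_coef q.1, lead_coef q.2).
Proof. by move=> Tq; rewrite /lead_coef (polyg_size Tq); exact: Tq. Qed.

Lemma polyg_eq0 q : polyg T q -> (q.1 == 0) = (q.2 == 0).
Proof. by move=> Tq; rewrite -!size_poly_eq0 (polyg_size Tq). Qed.

(** Pseudo-division, since leading coefficients need not be invertible in the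
    subrings; it is carried out simultaneously over both of them. *)
Lemma polyg_divp q r : polyg T q -> q.1 != 0 -> polyg T r ->
  exists k h m, [/\ polyg T h, polyg T m, (size m.1 < size q.1)%N,
    lead_coef q.1 ^+ k *: r.1 = h.1 * q.1 + m.1 &
    lead_coef q.2 ^+ k *: r.2 = h.2 * q.2 + m.2].
Proof.
move=> Tq q0; have [n] := ubnP (size r.1); elim: n r => // n IHn r.
rewrite ltnS => rn Tr.
have [rq | qr] := ltnP (size r.1) (size q.1).
  exists 0%N, (0, 0), r; split=> //; last 2 first.
  - by rewrite expr0 scale1r mul0r add0r.
  - by rewrite expr0 scale1r mul0r add0r.
  by move=> i; rewrite coef0; exact: sri0.
pose c := (lead_coef q.1, lead_coef q.2); have Tc : T c by exact: polyg_lead.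
pose b := (lead_coef r.1, lead_coef r.2); have Tb : T b by exact: polyg_lead.
pose d := (size r.1 - size q.1)%N.
pose h := (b.1%:P * 'X^d, b.2%:P * 'X^d).
have Th : polyg T h by exact: (polygM (polygC Tb) (polygXn d)).
pose r' := (c.1%:P * r.1 - h.1 * q.1, c.2%:P * r.2 - h.2 * q.2).
have Tr' : polyg T r'.
  exact: (polygB (polygM (polygC Tc) Tr) (polygM Th Tq)).
have q_gt0 : (0 < size q.1)%N by rewrite size_poly_gt0.
have r'n : (size r'.1 < n)%N.
  have r_gt0 := leq_trans q_gt0 qr.
  apply: leq_trans rn; rewrite -(prednK r_gt0) ltnS.
  apply/leq_sizeP => i ri; rewrite coefB -mulrA !coefCM coefXnM.
  have -> : (i < d)%N = false.
    by apply/negbTE; rewrite -leqNgt /d; move: (size r.1) (size q.1) q_gt0 ri => *; lia.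
  have [Di | {}ri] : i = (size r.1).-1 \/ (size r.1 <= i)%N.
    by move: (size r.1) ri r_gt0 => *; lia.
    have -> : (i - d = (size q.1).-1)%N.
      by rewrite /d Di; move: (size r.1) (size q.1) qr q_gt0 => *; lia.
    by rewrite Di mulrC subrr.
  rewrite !nth_default ?mulr0 ?subrr //.
  by rewrite /d; move: (size r.1) (size q.1) qr q_gt0 ri => *; lia.
have [k [h' [m [Th' Tm mq E1 E2]]]] := IHn _ r'n Tr'.
have Tck : T (c.1 ^+ k, c.2 ^+ k).
  elim: k {E1 E2} => [|k IHk]; first exact: (sri1 gT).
  by rewrite !exprS; exact: (sriM gT Tc IHk).
exists k.+1, (h'.1 + (c.1 ^+ k)%:P * h.1, h'.2 + (c.2 ^+ k)%:P * h.2), m.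
split=> //=.
- by have := polygB Th' (polygB (polygB Th' Th') (polygM (polygC Tck) Th));
     rewrite /= !subrr !sub0r !opprK.
- by rewrite mulrDl addrAC -E1 -!mul_polyC exprSr polyCM /=; ring.
- by rewrite mulrDl addrAC -E2 -!mul_polyC exprSr polyCM /=; ring.
Qed.

Lemma adjoinP x y : (forall q, polyg T q -> (q.1.[x] == 0) = (q.2.[y] == 0)) ->
  [/\ subring_iso (adjoin T x y), T `<=` adjoin T x y & adjoin T x y (x, y)].
Proof.
move=> xy; split; last first.
- exists ('X^1, 'X^1); [exact: polygXn | by rewrite !hornerXn].
- move=> [a b] Tab; exists (a%:P, b%:P); last by rewrite !hornerC.
  exact: (polygC Tab).
split.
- exists (1%:P, 1%:P); first exact: (polygC (sri1 gT)).
  by rewrite /= !hornerC.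
- move=> _ _ [p Tp ->] [q Tq ->]; exists (p.1 - q.1, p.2 - q.2).
    exact: polygB.
  by rewrite /= !hornerE.
- move=> _ _ [p Tp ->] [q Tq ->]; exists (p.1 * q.1, p.2 * q.2).
    exact: polygM.
  by rewrite /= !hornerM.
- by move=> _ [q Tq ->] /=; exact: xy.
Qed.

(** For [y], take a root of the polynomial that corresponds to a minimal
    equation [m] of [x].  Equations of [x] are multiples of [m] up to scalars,
    hence equations of [y].  Conversely, if [y] satisfied the equation [r] and
    [x] did not, the ideal generated by [r] and [m] would contain a nonzero
    constant vanishing at [y]. *)
Lemma adjoin_alg x q : polyg T q -> q.1 != 0 -> q.1.[x] = 0 ->
  exists y, forall r, polyg T r -> (r.1.[x] == 0) = (r.2.[y] == 0).
Proof.
move=> Tq q0 qx.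
have min_polyg (P : set ({poly C} * {poly C})) :
    (exists2 p, polyg T p & p.1 != 0 /\ P p) ->
    exists p, [/\ polyg T p, p.1 != 0, P p & forall r, polyg T r ->
      r.1 != 0 -> P r -> (size p.1 <= size r.1)%N].
  move=> [p Tp [p0 Pp]].
  pose Q n := `[< exists p, [/\ polyg T p, p.1 != 0, P p & size p.1 = n] >].
  have exQ : exists n, Q n by exists (size p.1); apply/asboolP; exists p.
  case: (ex_minnP exQ) => _ /asboolP[m [Tm m0 Pm <-]] min_m.
  by exists m; split=> // r Tr r0 Pr; apply: min_m; apply/asboolP; exists r.
have [{qx}m [Tm m0 mx min_m]] : exists p, [/\ polyg T p, p.1 != 0, p.1.[x] = 0 &
    forall r, polyg T r -> r.1 != 0 -> r.1.[x] = 0 -> (size p.1 <= size r.1)%N].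
  by apply: (min_polyg (fun p => p.1.[x] = 0)); exists q.
have m1 : (size m.2 != 1)%N.
  rewrite -(polyg_size Tm); apply: contra_eq_neq mx => /eqP/size_poly1P[c c0 ->].
  by rewrite hornerC.
have [y my] := closed_rootP m.2 m1; exists y => r Tr.
have lc_neq0 (p : {poly C} * {poly C}) k : polyg T p -> p.1 != 0 ->
    lead_coef p.1 ^+ k != 0 /\ lead_coef p.2 ^+ k != 0.
  by move=> Tp p0; rewrite !expf_neq0 // lead_coef_eq0 -?polyg_eq0.
have vanish (s : {poly C} * {poly C}) : polyg T s -> s.1.[x] = 0 -> s.2.[y] = 0.
  move=> Ts sx; have [k [h [t [Th Tt tm E1 E2]]]] := polyg_divp Tm m0 Ts.
  have tx : t.1.[x] = 0.
    by have := congr1 (horner^~ x) E1; rewrite !hornerE sx mx !mulr0 add0r.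
  have t0 : t.1 == 0.
    by apply: contraTT tm => t0; rewrite -leqNgt min_m.
  have := congr1 (horner^~ y) E2; rewrite !hornerE (rootP my) mulr0 add0r.
  move: t0; rewrite polyg_eq0 // => /eqP-> /eqP.
  by rewrite horner0 mulf_eq0 (negPf (lc_neq0 _ _ Tm m0).2) => /eqP.
apply/eqP/eqP => [|ry]; first exact: vanish.
apply/eqP; apply: contraTT isT => rx /=.
pose I := [set p : {poly C} * {poly C} |
  exists u v : {poly C} * {poly C}, [/\ polyg T u, polyg T v &
  p = (u.1 * r.1 + v.1 * m.1, u.2 * r.2 + v.2 * m.2)]].
have addg p s : polyg T p -> polyg T s -> polyg T (p.1 + s.1, p.2 + s.2).
  by move=> Tp Ts i; rewrite !coefD; exact: (sriD (Tp i) (Ts i)).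
have T0 : polyg T (0, 0) by move=> i; rewrite coef0; exact: sri0.
have T1 : polyg T (1, 1) by have := polygC (sri1 gT); rewrite polyC1.
have Ir : I r by exists (1, 1), (0, 0); split=> //; case: (r) => ? ?;
  rewrite /= !mul1r !mul0r !addr0.
have Im : I m by exists (0, 0), (1, 1); split=> //; case: (m) => ? ?;
  rewrite /= !mul1r !mul0r !add0r.
have TI p : I p -> polyg T p.
  by move=> [u [v [Tu Tv ->]]]; apply: (addg (_, _) (_, _)); apply: polygM.
have [w [Tw w0 Iw min_w]] := min_polyg I (ex_intro2 _ _ m Tm (conj m0 Im)).
have dvd_w p : I p -> exists k h, polyg T h /\ lead_coef w.1 ^+ k *: p.1 = h.1 * w.1.
  move=> Ip; have [k [h [t [Th Tt tm E1 E2]]]] := polyg_divp Tw w0 (TI _ Ip).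
  exists k, h; split=> //; rewrite E1.
  suff : t.1 == 0 by move/eqP->; rewrite addr0.
  apply: contraTT tm => t0; rewrite -leqNgt min_w //.
  move: Ip Iw => [u [v [Tu Tv Dp]]] [u' [v' [Tu' Tv' Dw]]].
  have Tk : T (lead_coef w.1 ^+ k, lead_coef w.2 ^+ k).
    elim: k {E1 E2} => [|k IHk]; first exact: (sri1 gT).
    by rewrite !exprS; exact: (sriM gT (polyg_lead Tw) IHk).
  exists ((lead_coef w.1 ^+ k)%:P * u.1 - h.1 * u'.1,
          (lead_coef w.2 ^+ k)%:P * u.2 - h.2 * u'.2),
         ((lead_coef w.1 ^+ k)%:P * v.1 - h.1 * v'.1,
          (lead_coef w.2 ^+ k)%:P * v.2 - h.2 * v'.2).
  split; [exact: (polygB (polygM (polygC Tk) Tu) (polygM Th Tu')) |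
          exact: (polygB (polygM (polygC Tk) Tv) (polygM Th Tv')) |].
  have -> : t = (t.1, t.2) by case: (t).
  congr (_, _).
    rewrite !mulrBl addrACA -opprD -!mulrA -!mulrDr.
    move: E1; rewrite [p in lead_coef _ ^+ _ *: p.1]Dp /= mul_polyC => ->.
    by rewrite {1}Dw /= addrC addKr.
  rewrite !mulrBl addrACA -opprD -!mulrA -!mulrDr.
  move: E2; rewrite [p in lead_coef _ ^+ _ *: p.2]Dp /= mul_polyC => ->.
  by rewrite {1}Dw /= addrC addKr.
have wx : w.1.[x] != 0.
  have [k [h [_ /(congr1 (horner^~ x))]]] := dvd_w _ Ir; rewrite !hornerE => E.
  have /eqP := mulf_neq0 (lc_neq0 w k Tw w0).1 rx; rewrite E => /eqP.
  by rewrite mulf_eq0 negb_or => /andP[].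
have [k [h [Th E]]] := dvd_w _ Im.
have hx : h.1.[x] = 0.
  have /eqP := congr1 (horner^~ x) E; rewrite !hornerE mx mulr0 eq_sym mulf_eq0.
  by rewrite (negPf wx) orbF => /eqP.
have h0 : h.1 != 0.
  apply: contra_eq_neq E => ->; rewrite mul0r scaler_eq0 negb_or m0 andbT.
  exact: (lc_neq0 w k Tw w0).1.
have sw : (size w.1 <= 1)%N.
  have := min_m _ Th h0 hx; rewrite -(size_scale m.1 (lc_neq0 w k Tw w0).1) E.
  rewrite size_mul // -(ltn_predK (_ : (0 < size h.1)%N)) ?size_poly_gt0 //.
  by rewrite addSn /= -addn1 leq_add2l; case: (size w.1) => [|[|]].
have {}sw : (size w.2 <= 1)%N by rewrite -(polyg_size Tw).
case: Iw => u [v [Tu Tv Dw]].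
have : w.2.[y] = 0 by rewrite Dw /= !hornerE ry (rootP my) !mulr0 addr0.
rewrite (size1_polyC sw) hornerC => w20.
by move: w0; rewrite polyg_eq0 // (size1_polyC sw) w20 eqxx.
Qed.

End Theory.

(** The graph of the inverse isomorphism. *)
Definition transpose T : set (C * C) := [set a | T (a.2, a.1)].

Lemma transpose_iso T : subring_iso T -> subring_iso (transpose T).
Proof.
move=> gT; split; first exact: (sri1 gT).
- by move=> a b Ta Tb; exact: (sriB gT Ta Tb).
- by move=> a b Ta Tb; exact: (sriM gT Ta Tb).
- by move=> a Ta; rewrite (sri_inj gT (Ta : T (a.2, a.1))).
Qed.

Definition chain_closed (Q : set (C * C) -> Prop) := forall F : set (set (C * C)),
  F !=set0 -> F `<=` Q -> total_on F subset -> Q (\bigcup_(X in F) X).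

Lemma subring_iso_chain : chain_closed subring_iso.
Proof.
move=> F [X0 FX0] FQ Ftot.
have both a b : (\bigcup_(X in F) X) a -> (\bigcup_(X in F) X) b ->
    exists2 X, F X & X a /\ X b.
  move=> [A FA Aa] [B FB Bb]; have [AB | BA] := Ftot A B FA FB.
    by exists B => //; split=> //; exact: AB.
  by exists A => //; split=> //; exact: BA.
split.
- by exists X0 => //; exact: sri1 (FQ _ FX0).
- move=> a b /both Fab /Fab[X FX [Xa Xb]].
  by exists X => //; exact: (sriB (FQ _ FX) Xa Xb).
- move=> a b /both Fab /Fab[X FX [Xa Xb]].
  by exists X => //; exact: (sriM (FQ _ FX) Xa Xb).
- by move=> a [X FX Xa]; have gX := FQ _ FX; rewrite (sri_inj gX Xa).
Qed.

(** Zorn's lemma above a given element.  As chains may be empty, the empty set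
    is added to the sets to which the lemma is applied. *)
Lemma max_extension (Q : set (C * C) -> Prop) T0 : chain_closed Q -> Q T0 ->
  exists T, [/\ T0 `<=` T, Q T & forall T', T `<=` T' -> Q T' -> T' `<=` T].
Proof.
move=> chQ QT0; pose P T := Q T /\ T0 `<=` T \/ T = set0.
have [|T [PT maxT]] := @Zorn_bigcup (C * C)%type P.
  move=> F FP Ftot.
  have [[X [FX X0]] | noX] := pselect (exists X, F X /\ X !=set0); last first.
    right; apply/seteqP; split=> // a [X FX Xa].
    by case: noX; exists X; split=> //; exists a.
  have nempty Y : F Y -> Y !=set0 -> Q Y /\ T0 `<=` Y.
    by move=> FY [a Ya]; case: (FP _ FY) => // Y0; move: Ya; rewrite Y0.
  left; split; last first.
    by move=> a /(nempty _ FX X0).2 Xa; exists X.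
  have -> : \bigcup_(Y in F) Y = \bigcup_(Y in F `&` [set Y | Y !=set0]) Y.
    apply/seteqP; split=> a [Y FY Ya]; exists Y => //; last by case: FY.
    by split=> //; exists a.
  apply: chQ; first by exists X.
    by move=> Y [FY /nempty[]].
  by move=> A B [FA _] [FB _]; exact: Ftot.
have [[QT T0T] | T_0] := PT; last first.
  exists T0; split=> // T' T0T' QT' a T'a.
  case: (maxT T'); last by left.
  by rewrite T_0; split=> // /(_ _ T'a).
exists T; split=> // T' TT' QT'.
have [//|nT'T] := pselect (T' `<=` T).
by case: (maxT T'); [split | left; split=> // a /T0T /TT'].
Qed.

(** The two subrings coincide. *)
Definition symmetric_dom T := forall x, (exists y, T (x, y)) <-> (exists y, T (y, x)).

Lemma symmetric_dom_chain : chain_closed symmetric_dom.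
Proof.
move=> F _ FQ _ x; split=> -[y [X FX Xxy]].
  by have [/(_ (ex_intro _ _ Xxy))[z Xzx] _] := FQ _ FX x; exists z, X.
by have [_ /(_ (ex_intro _ _ Xxy))[z Xzx]] := FQ _ FX x; exists z, X.
Qed.

Lemma max_total T : subring_iso T ->
  (forall x, exists2 q, polyg T q & q.1 != 0 /\ q.1.[x] = 0) ->
  (forall T', T `<=` T' -> subring_iso T' -> T' `<=` T) ->
  forall x, exists y, T (x, y).
Proof.
move=> gT algT maxT x; have [q Tq [q0 qx]] := algT x.
have [y /(adjoinP gT)[gT' TT' T'xy]] := adjoin_alg gT Tq q0 qx.
by exists y; exact: maxT TT' gT' _ T'xy.
Qed.

(** Two applications of Zorn's lemma.  A maximal extension [TA] among the
    automorphisms of a subring has a domain over which [C] is algebraic, since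
    a transcendental element could be adjoined as a fixed point.  A maximal
    extension [T] of [TA] among the isomorphisms of subrings is then defined
    everywhere and surjective, since algebraic elements can be adjoined to
    both sides. *)
Lemma extend_automorphism (k : fieldType) (e : {rmorphism k -> C})
    (s : {rmorphism k -> k}) : (forall a, exists b, s b = a) ->
  exists2 tau : {rmorphism C -> C}, bijective tau &
    forall a, tau (e a) = e (s a).
Proof.
move=> s_surj; pose T0 := [set (e a, e (s a)) | a in [set: k]].
have gT0 : subring_iso T0.
  split.
  - by exists 1 => //; rewrite !rmorph1.
  - by move=> _ _ [a _ <-] [b _ <-]; exists (a - b) => //; rewrite !rmorphB.
  - by move=> _ _ [a _ <-] [b _ <-]; exists (a * b) => //; rewrite !rmorphM.
  - by move=> _ [a _ <-]; rewrite !fmorph_eq0.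
have sT0 : symmetric_dom T0.
  move=> x; split=> -[y [a _]]; last by move=> [_ <-]; exists (e (s (s a))), (s a).
  by move=> [<- _]; have [b <-] := s_surj a; exists (e b), b.
pose Q T := subring_iso T /\ symmetric_dom T.
have chQ : chain_closed Q.
  move=> F F0 FQ Ftot; split.
    by apply: subring_iso_chain => // X /FQ[].
  by apply: symmetric_dom_chain => // X /FQ[].
have [TA [T0A [gTA sTA] maxTA]] := max_extension chQ (conj gT0 sT0).
have lift T (p : {poly C}) : subring_iso T ->
    (forall i, exists y, T (p`_i, y)) -> exists p' : {poly C}, polyg T (p, p').
  move=> gT /choice[h hp]; exists (\poly_(i < size p) h i) => i.
  rewrite /= coef_poly; case: ltnP => // pi.
  by rewrite nth_default //; exact: sri0.
have algTA x : exists2 q, polyg TA q & q.1 != 0 /\ q.1.[x] = 0.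
  apply: contrapT => trx.
  have {}trx q : polyg TA q -> q.1.[x] = 0 -> q.1 = 0.
    by move=> Tq qx; apply/eqP; apply: contrapT => /negP q0; apply: trx; exists q.
  have lift1 q : polyg TA q -> exists p : {poly C}, polyg TA (p, q.1).
    move=> Tq; have [|p Tp] := lift (transpose TA) q.1 (transpose_iso gTA).
      by move=> i; rewrite /transpose /=; apply/sTA; exists q.2`_i; exact: Tq.
    by exists p; exact: Tp.
  have lift2 q : polyg TA q -> exists p : {poly C}, polyg TA (q.2, p).
    move=> Tq; apply: lift => // i.
    by apply/sTA; exists q.1`_i; exact: Tq.
  have [|gT' TT' T'x] := adjoinP gTA (x := x) (y := x).
    move=> q Tq; apply/eqP/eqP => [/(trx _ Tq)/eqP|qx].
      by rewrite (polyg_eq0 gTA Tq) => /eqP ->; rewrite horner0.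
    have [p /trx/(_ qx)/= /eqP] := lift2 _ Tq.
    by rewrite -(polyg_eq0 gTA Tq) => /eqP ->; rewrite horner0.
  have sT' : symmetric_dom (adjoin TA x x).
    move=> z; split=> -[w [q Tq]].
      by move=> [-> _]; have [p Tp] := lift1 _ Tq; exists p.[x], (p, q.1).
    by move=> [_ ->]; have [p Tp] := lift2 _ Tq; exists p.[x], (q.2, p).
  have /trx : polyg TA ('X - x%:P, 'X - x%:P).
    have Tx : TA (x, x) by exact: (maxTA _ TT' (conj gT' sT')).
    exact: (polygB gTA (polygXn gTA 1) (polygC gTA Tx)).
  by move=> /= /(_ _)/eqP; rewrite !hornerE subrr polyXsubC_eq0 => /(_ erefl).
have [T [TAT gT maxT]] := max_extension subring_iso_chain gTA.
have domT x : exists y, T (x, y).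
  apply: (max_total gT) => // {}x; have [q Tq qx] := algTA x; exists q => // i.
  exact/TAT/Tq.
have imT y : exists x, T (x, y).
  apply: (max_total (transpose_iso gT)) => [{}y|T' TT' gT' a T'a]; last first.
    apply: (maxT (transpose T')) => //.
    - by move=> b Tb; apply: TT'; case: b Tb.
    - exact: transpose_iso.
    - by case: a T'a.
  have [q Tq qy] := algTA y.
  have [|p Tp] := lift (transpose TA) q.1 (transpose_iso gTA).
    by move=> i; rewrite /transpose /=; apply/sTA; exists q.2`_i; exact: Tq.
  by exists (q.1, p) => // i; exact/TAT/Tp.
have funT x y y' : T (x, y) -> T (x, y') -> y = y'.
  move=> Txy Txy'; have := sri_inj gT (sriB gT Txy Txy').
  by rewrite /= subrr eqxx => /esym; rewrite subr_eq0 => /eqP.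
have injT x x' y : T (x, y) -> T (x', y) -> x = x'.
  move=> Txy Txy'; have := sri_inj gT (sriB gT Txy Txy').
  by rewrite /= subrr eqxx subr_eq0 => /eqP.
have [tau Ttau] := choice domT; have [tau' Ttau'] := choice imT.
have tauB : zmod_morphism tau.
  by move=> x y; apply: (funT (x - y)) => //; exact: (sriB gT (Ttau x) (Ttau y)).
have tauM : monoid_morphism tau.
  split; first by apply: (funT 1) => //; exact: (sri1 gT).
  by move=> x y; apply: (funT (x * y)) => //; exact: (sriM gT (Ttau x) (Ttau y)).
pose tA := GRing.isZmodMorphism.Build C C tau tauB.
pose tM := GRing.isMonoidMorphism.Build C C tau tauM.
pose tauR : {rmorphism C -> C} := HB.pack tau tA tM.
exists tauR.
  by exists tau' => x; [apply: injT (Ttau' _) (Ttau _) | apply: funT (Ttau _) (Ttau' _)].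
by move=> a; apply: funT (Ttau _) _; apply/TAT/T0A; exists a.
Qed.

End PartialAutomorphisms.

(** * Polynomial functions and constructible sets *)

Section PolynomialFunctions.
Context (C : comNzRingType).

Definition polyfun N (f : 'rV[C]_N -> C) :=
  exists F : mpoly N C, forall v, f v = meval (v 0) F.

Definition polymap N M (phi : 'rV[C]_N -> 'rV[C]_M) :=
  forall j, polyfun (fun v => phi v 0 j).

Section Closure.
Context (N : nat).
Implicit Types f g : 'rV[C]_N -> C.

Lemma polyfun_meval (F : mpoly N C) : polyfun (fun v => meval (v 0) F).
Proof. by exists F. Qed.

Lemma polyfun_ext f g : f =1 g -> polyfun f -> polyfun g.
Proof. by move=> fg [F Ff]; exists F => v; rewrite -fg. Qed.

Lemma polyfun_cst c : polyfun (fun _ : 'rV[C]_N => c).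
Proof. by exists (mpolyC N c) => v; rewrite mevalC. Qed.

Lemma polyfun_coord i : polyfun (fun v : 'rV[C]_N => v 0 i).
Proof. by exists (mpolyX C (mnm1 i)) => v; rewrite mevalXU. Qed.

Lemma polyfunD f g : polyfun f -> polyfun g -> polyfun (fun v => f v + g v).
Proof. by move=> [F Ff] [G Gg]; exists (F + G) => v; rewrite mevalD Ff Gg. Qed.

Lemma polyfunM f g : polyfun f -> polyfun g -> polyfun (fun v => f v * g v).
Proof. by move=> [F Ff] [G Gg]; exists (F * G) => v; rewrite mevalM Ff Gg. Qed.

Lemma polyfunB f g : polyfun f -> polyfun g -> polyfun (fun v => f v - g v).
Proof. by move=> [F Ff] [G Gg]; exists (F - G) => v; rewrite mevalB Ff Gg. Qed.

Lemma polyfunX f d : polyfun f -> polyfun (fun v => f v ^+ d).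
Proof. by move=> [F Ff]; exists (F ^+ d) => v; rewrite rmorphXn /= Ff. Qed.

Lemma polyfun_sum (I : Type) (s : seq I) (P : pred I) (F : I -> 'rV[C]_N -> C) :
  (forall i, P i -> polyfun (F i)) -> polyfun (fun v => \sum_(i <- s | P i) F i v).
Proof.
move=> PF; elim: s => [|i s IHs].
  by apply: polyfun_ext (polyfun_cst 0) => v; rewrite big_nil.
case Pi: (P i).
  by apply: polyfun_ext (polyfunD (PF i Pi) IHs) => v; rewrite big_cons Pi.
by apply: polyfun_ext IHs => v; rewrite big_cons Pi.
Qed.

Lemma polyfun_prod (I : Type) (s : seq I) (P : pred I) (F : I -> 'rV[C]_N -> C) :
  (forall i, P i -> polyfun (F i)) -> polyfun (fun v => \prod_(i <- s | P i) F i v).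
Proof.
move=> PF; elim: s => [|i s IHs].
  by apply: polyfun_ext (polyfun_cst 1) => v; rewrite big_nil.
case Pi: (P i).
  by apply: polyfun_ext (polyfunM (PF i Pi) IHs) => v; rewrite big_cons Pi.
by apply: polyfun_ext IHs => v; rewrite big_cons Pi.
Qed.

Lemma polyfun_mmap (k : nzRingType) (e : k -> C) M (p : mpoly M k)
    (h : 'rV[C]_N -> 'I_M -> C) : (forall i, polyfun (h^~ i)) ->
  polyfun (fun v => mmap e (h v) p).
Proof.
move=> ph; apply: polyfun_sum => m _; apply: polyfunM; first exact: polyfun_cst.
by apply: polyfun_prod => i _; apply: polyfunX; exact: ph.
Qed.

Lemma polyfun_comp M (phi : 'rV[C]_N -> 'rV[C]_M) (f : 'rV[C]_M -> C) :
  polymap phi -> polyfun f -> polyfun (f \o phi).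
Proof.
move=> pphi [F Ff]; apply: polyfun_ext (polyfun_mmap id F pphi) => v.
by rewrite /= Ff.
Qed.

Lemma polyfun_ind (Q : ('rV[C]_N -> C) -> Prop) :
  (forall c, Q (fun=> c)) -> (forall i, Q (fun v => v 0 i)) ->
  (forall f g, Q f -> Q g -> Q (fun v => f v + g v)) ->
  (forall f g, Q f -> Q g -> Q (fun v => f v * g v)) ->
  forall f, polyfun f -> Q f.
Proof.
move=> Qc Qx QD QM f [F Ff].
have Qext g h : g =1 h -> Q g -> Q h by move=> /funext->.
have Qbig (op : C -> C -> C) idx : Q (fun=> idx) ->
    (forall f g, Q f -> Q g -> Q (fun v => op (f v) (g v))) ->
    forall (I : Type) (s : seq I) (h : I -> 'rV[C]_N -> C), (forall i, Q (h i)) ->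
    Q (fun v => \big[op/idx]_(i <- s) h i v).
  move=> Q0 Qop I s h Qh; elim: s => [|i s IHs].
    by apply: Qext Q0 => v; rewrite big_nil.
  by apply: Qext (Qop _ _ (Qh i) IHs) => v; rewrite big_cons.
apply: (Qext _ _ (fun v => esym (Ff v))); rewrite /meval /mmap.
apply: (Qbig +%R 0 (Qc 0) QD) => m; apply: (QM (fun=> _)); first exact: Qc.
apply: (Qbig *%R 1 (Qc 1) QM) => i; elim: (m i) => [|d IHd].
  by apply: Qext (Qc 1) => v; rewrite expr0.
by apply: Qext (QM _ _ (Qx i) IHd) => v; rewrite exprS.
Qed.

End Closure.

Lemma polymap_lsubmx N M : polymap (fun u : 'rV[C]_(N + M) => lsubmx u).
Proof. by move=> i; apply: polyfun_ext (polyfun_coord (lshift M i)) => u; rewrite mxE. Qed.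

Lemma polymap_rsubmx N M : polymap (fun u : 'rV[C]_(N + M) => rsubmx u).
Proof. by move=> i; apply: polyfun_ext (polyfun_coord (rshift N i)) => u; rewrite mxE. Qed.

End PolynomialFunctions.

Section Constructible.
Context (C : closedFieldType).

Inductive constructible N : set 'rV[C]_N -> Prop :=
| constructible0 f of polyfun f : constructible [set v | f v = 0]
| constructibleC S of constructible S : constructible (~` S)
| constructibleU S T of constructible S & constructible T : constructible (S `|` T).

Section Closure.
Context (N : nat).
Implicit Types S T : set 'rV[C]_N.

Lemma constructible_ext S T : (forall v, S v <-> T v) -> constructible S -> constructible T.
Proof. by move=> ST; rewrite (_ : S = T) //; apply/seteqP; split=> v /ST. Qed.

Lemma constructibleT : constructible [set: 'rV[C]_N].
Proof.
by apply: constructible_ext (constructible0 (polyfun_cst N 0)) => v; split.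
Qed.

Lemma constructibleP (P : Prop) : constructible [set _ : 'rV[C]_N | P].
Proof.
have [p|np] := pselect P.
  by apply: constructible_ext constructibleT.
by apply: constructible_ext (constructibleC constructibleT); split=> // -[].
Qed.

Lemma constructible_not (P : 'rV[C]_N -> Prop) :
  constructible [set v | P v] -> constructible [set v | ~ P v].
Proof. exact: constructibleC. Qed.

Lemma constructible_or (P Q : 'rV[C]_N -> Prop) :
  constructible [set v | P v] -> constructible [set v | Q v] ->
  constructible [set v | P v \/ Q v].
Proof. exact: constructibleU. Qed.

Lemma constructible_and (P Q : 'rV[C]_N -> Prop) :
  constructible [set v | P v] -> constructible [set v | Q v] ->
  constructible [set v | P v /\ Q v].
Proof.
move=> cP cQ.
apply: constructible_ext (constructibleC (constructibleU (constructibleC cP) (constructibleC cQ))).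
move=> v /=; split; last by move=> [Pv Qv] [].
by move=> PQ; split; apply: contrapT => nP; apply: PQ; [left|right].
Qed.

Lemma constructible_imply (P Q : 'rV[C]_N -> Prop) :
  constructible [set v | P v] -> constructible [set v | Q v] ->
  constructible [set v | P v -> Q v].
Proof.
move=> /constructible_not cP cQ; apply: constructible_ext (constructible_or cP cQ) => v /=.
split; first by case.
by move=> PQ; have [/PQ|] := pselect (P v); [right|left].
Qed.

Lemma constructible_has (I : eqType) (s : seq I) (P : I -> 'rV[C]_N -> Prop) :
  (forall i, i \in s -> constructible [set v | P i v]) ->
  constructible [set v | exists2 i, i \in s & P i v].
Proof.
elim: s => [|i s IHs] cP.
  by apply: constructible_ext (constructibleP False) => v; split=> // -[].
have cs : constructible [set v | exists2 j, j \in s & P j v].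
  by apply: IHs => j js; apply: cP; rewrite inE js orbT.
apply: constructible_ext (constructible_or (cP i (mem_head _ _)) cs) => v /=.
split=> [[Pi|[j js Pj]]|[j]].
- by exists i; rewrite ?mem_head.
- by exists j; rewrite // inE js orbT.
- by rewrite inE => /predU1P[-> | js] Pj; [left|right; exists j].
Qed.

Lemma constructible_all (I : eqType) (s : seq I) (P : I -> 'rV[C]_N -> Prop) :
  (forall i, i \in s -> constructible [set v | P i v]) ->
  constructible [set v | forall i, i \in s -> P i v].
Proof.
move=> cP; have cnP i : i \in s -> constructible [set v | ~ P i v].
  by move=> /cP; exact: constructible_not.
apply: constructible_ext (constructibleC (constructible_has cnP)) => v /=.
split=> [nP i si|Ps [i /Ps //]].
by apply: contrapT => nPi; apply: nP; exists i.
Qed.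

Lemma constructible_allfin (I : finType) (P : I -> 'rV[C]_N -> Prop) :
  (forall i, constructible [set v | P i v]) -> constructible [set v | forall i, P i v].
Proof.
move=> cP; apply: constructible_ext (constructible_all (s := enum I) (fun i _ => cP i)) => v.
by split=> Pi i => [|_]; apply: Pi; rewrite mem_enum.
Qed.

Lemma constructible_eq (f g : 'rV[C]_N -> C) : polyfun f -> polyfun g ->
  constructible [set v | f v = g v].
Proof.
move=> pf pg; apply: constructible_ext (constructible0 (polyfunB pf pg)) => v /=.
by split=> [/eqP|->]; rewrite ?subrr // subr_eq0 => /eqP.
Qed.

End Closure.

Lemma constructible_preimage N M (phi : 'rV[C]_N -> 'rV[C]_M) (S : set 'rV[C]_M) :
  polymap phi -> constructible S -> constructible [set v | S (phi v)].
Proof.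
move=> pphi; elim=> {S} [f pf|S _ IHS|S T _ IHS _ IHT].
- exact: constructible0 (polyfun_comp pphi pf).
- exact: constructibleC.
- exact: constructibleU.
Qed.

Lemma polyfun_term N (F : mpoly N C) : exists2 t : GRing.term C, GRing.rterm t &
  forall e, GRing.eval e t = meval (fun i : 'I_N => e`_i) F.
Proof.
pose D (f : seq C -> C) := exists2 t : GRing.term C, GRing.rterm t &
  forall e, GRing.eval e t = f e.
have Dadd f g : D f -> D g -> D (fun e => f e + g e).
  move=> [t rt tf] [u ru ug]; exists (GRing.Add t u); first by rewrite /= rt.
  by move=> e /=; rewrite tf ug.
have Dmul f g : D f -> D g -> D (fun e => f e * g e).
  move=> [t rt tf] [u ru ug]; exists (GRing.Mul t u); first by rewrite /= rt.
  by move=> e /=; rewrite tf ug.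
have Dcst c : D (fun=> c) by exists (GRing.Const c).
have Dbig op idx (Dop : forall f g, D f -> D g -> D (fun e => op (f e) (g e)))
    (Didx : D (fun=> idx)) (I : Type) (s : seq I) (f : I -> seq C -> C) :
    (forall i, D (f i)) -> D (fun e => \big[op/idx]_(i <- s) f i e).
  move=> Df; elim: s => [|i s [t rt tE]].
    by case: Didx => t rt tE; exists t => // e; rewrite big_nil.
  have [u ru uE] := Dop _ _ (Df i) (ex_intro2 _ _ t rt tE).
  by exists u => // e; rewrite big_cons uE.
change (D (fun e => meval (fun i : 'I_N => e`_i) F)).
apply: (Dbig +%R 0 Dadd (Dcst 0)) => m; apply: (Dmul); first exact: Dcst.
rewrite /mmap1; apply: (Dbig *%R 1 Dmul (Dcst 1)) => i.
exists (GRing.Exp (GRing.Var C i) (m i)) => //.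
Qed.

(** Constructible sets are defined by first-order formulas, to which the
    elimination of quantifiers applies; [formula_constructible] is the way
    back. *)
Lemma constructible_formula N (S : set 'rV[C]_N) : constructible S ->
  exists2 f : GRing.formula C, GRing.rformula f &
    forall e : seq C, GRing.holds e f <-> S (\row_i e`_i).
Proof.
elim=> {S} [f [F Ff]|S _ [f rf fS]|S T _ [f rf fS] _ [g rg gT]].
- have [t rt tF] := polyfun_term F; exists (GRing.Equal t (GRing.Const 0)).
    by rewrite /= rt.
  move=> e /=; rewrite tF Ff.
  by rewrite (meval_eq (v2 := (\row_i e`_i) 0)) // => i; rewrite mxE.
- exists (GRing.Not f) => // e /=.
  by split=> nf /fS.
- exists (GRing.Or f g); first by rewrite /= rf.
  by move=> e /=; split=> -[/fS|/gT]; [left|right|left|right].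
Qed.

Lemma formula_constructible N (f : GRing.formula C) :
  GRing.qf_form f -> GRing.rformula f ->
  constructible [set v : 'rV[C]_N | GRing.holds [seq v 0 i | i <- enum 'I_N] f].
Proof.
pose env (v : 'rV[C]_N) := [seq v 0 i | i <- enum 'I_N].
have poly_term t : GRing.rterm t -> polyfun (fun v => GRing.eval (env v) t).
  elim: t => //=.
  - move=> j _; have [jN | Nj] := ltnP j N.
      apply: polyfun_ext (polyfun_coord _ (Ordinal jN)) => v.
      rewrite (nth_map (Ordinal jN)) ?size_enum_ord //; congr (v 0 _).
      by apply: val_inj; rewrite /= nth_enum_ord.
    apply: polyfun_ext (polyfun_cst _ 0) => v.
    by rewrite nth_default // size_map size_enum_ord.
  - by move=> c _; exact: polyfun_cst.
  - by move=> n _; exact: polyfun_cst.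
  - by move=> t IHt u IHu /andP[/IHt pt /IHu]; exact: polyfunD.
  - move=> t IHt /IHt pt; apply: polyfun_ext (polyfunB (polyfun_cst N 0) pt) => v.
    by rewrite sub0r.
  - move=> t IHt n /IHt pt.
    by apply: polyfun_ext (polyfunM pt (polyfun_cst N n%:R)) => v; rewrite mulr_natr.
  - by move=> t IHt u IHu /andP[/IHt pt /IHu]; exact: polyfunM.
  - by move=> t IHt n /IHt pt; exact: polyfunX.
elim: f => //=.
- by move=> b _ _; exact: constructibleP.
- by move=> t u _ /andP[/poly_term pt /poly_term pu]; exact: constructible_eq.
- move=> f IHf g IHg /andP[qf qg] /andP[rf rg].
  by apply: constructible_and; [exact: IHf | exact: IHg].
- move=> f IHf g IHg /andP[qf qg] /andP[rf rg].
  by apply: constructible_or; [exact: IHf | exact: IHg].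
- move=> f IHf g IHg /andP[qf qg] /andP[rf rg].
  by apply: constructible_imply; [exact: IHf | exact: IHg].
- by move=> f IHf qf rf; apply: constructible_not; exact: IHf.
Qed.

(** Chevalley's theorem for a projection.  The coordinates of [w] are the
    variables [N], ..., [N + M - 1] of the formula. *)
Theorem constructible_ex N M (S : set 'rV[C]_(N + M)) : constructible S ->
  constructible [set v : 'rV[C]_N | exists w, S (row_mx v w)].
Proof.
move=> /constructible_formula[f rf fS].
pose g := foldr (GRing.Exists (R := C)) f (iota N M).
have rg : GRing.rformula g by rewrite /g; elim: (iota N M).
have wf := @ClosedFieldQE.wf_ex_elim C.
have ok := @ClosedFieldQE.holds_ex_elim C (@solve_monicpoly C).
have /andP[qh rh] := GRing.quantifier_elim_wf wf rg.
have gP e := GRing.quantifier_elim_rformP wf ok e rg.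
apply: constructible_ext (formula_constructible N qh rh) => v /=.
set env := map _ _.
have envE (i : 'I_N) : env`_i = v 0 i.
  rewrite (nth_map i) ?size_enum_ord //; congr (v 0 _).
  by apply: val_inj; rewrite /= nth_enum_ord.
have senv : size env = N by rewrite size_map size_enum_ord.
split=> [/(GRing.qf_evalP _ qh)/gP|[w Svw]].
  move=> /GRing.foldExistsP[e' ee' /fS Se'].
  exists (\row_i e'`_(N + i)); congr (S _): Se'.
  apply/rowP => i; rewrite !mxE; case: splitP => j Dj; rewrite ?mxE Dj //.
  by rewrite -envE ee' // !inE mem_iota /= leqNgt ltn_ord.
apply/(GRing.qf_evalP _ qh)/gP/GRing.foldExistsP.
exists (env ++ [seq w 0 i | i <- enum 'I_M]).
  move=> j; rewrite !inE mem_iota negb_and -ltnNge -leqNgt => /orP[jN | Mj].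
    by rewrite nth_cat senv jN.
  rewrite [LHS]nth_default ?senv ?(leq_trans (leq_addr _ _) Mj) //.
  rewrite nth_default; last by rewrite size_cat senv size_map size_enum_ord.
  by [].
apply/fS; congr (S _): Svw; apply/rowP => i; rewrite !mxE nth_cat senv.
case: splitP => j Dj; rewrite Dj ?envE ?addKn //.
rewrite (nth_map j) ?size_enum_ord //; congr (w 0 _).
by apply: val_inj; rewrite /= nth_enum_ord.
Qed.

Lemma constructible_image N M (phi : 'rV[C]_N -> 'rV[C]_M) (S : set 'rV[C]_N) :
  polymap phi -> constructible S -> constructible (phi @` S).
Proof.
move=> pphi cS.
have pl := @polymap_lsubmx C M N; have pr := @polymap_rsubmx C M N.
have cG : constructible [set u : 'rV[C]_(M + N) |
    S (rsubmx u) /\ forall i, phi (rsubmx u) 0 i = lsubmx u 0 i].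
  apply: constructible_and; first exact: constructible_preimage cS.
  apply: constructible_allfin => i; apply: constructible_eq (pl i).
  exact: polyfun_comp pr (pphi i).
apply: constructible_ext (constructible_ex cG) => x /=; split.
  move=> [w]; rewrite row_mxKr row_mxKl => -[Sw wx]; exists w => //.
  exact/rowP.
move=> [w Sw <-]; exists w; rewrite row_mxKr row_mxKl; split=> //.
Qed.

End Constructible.

(** * Polynomials and the Euclidean topology *)

Section EuclideanNeighbourhoods.
Context (C : numFieldType).

Lemma nbhs_rowP n (v : 'rV[C]_n) (A : set 'rV[C]_n) : nbhs v A <->
  exists2 e : C, 0 < e & forall u : 'rV[C]_n, (forall i, `|v 0 i - u 0 i| < e) -> A u.
Proof.
split=> [/nbhs_ballP[e e0 eA]|[e e0 eA]].
  exists e => // u uv; apply: eA; split=> // i j; rewrite ord1 -ball_normE.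
  exact: uv.
apply/nbhs_ballP; exists e => // u [_ vu]; apply: eA => i.
by have := vu 0 i; rewrite -ball_normE.
Qed.

Lemma nbhs_numP (x : C) (A : set C) : nbhs x A <->
  exists2 e : C, 0 < e & forall y, `|x - y| < e -> A y.
Proof.
split=> [/nbhs_ballP[e e0 eA]|[e e0 eA]].
  by exists e => // u uv; apply: eA; rewrite -ball_normE.
by apply/nbhs_ballP; exists e => // u; rewrite -ball_normE; exact: eA.
Qed.

Lemma near_small (T : topologicalType) (f : T -> C) x e : continuous_at x f -> 0 < e ->
  \forall y \near x, `|f x - f y| < e.
Proof.
move=> cf e0; apply: (cf [set z | `|f x - z| < e]).
by apply/nbhs_numP; exists e.
Qed.

Lemma polyfun_continuous n (f : 'rV[C]_n -> C) : polyfun f -> continuous f.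
Proof.
move=> pf v; elim/polyfun_ind: pf => {f}.
- by move=> c; exact: cst_continuous.
- by move=> i; exact: coord_continuous.
- by move=> f g cf cg; exact: (cvgD cf cg).
- by move=> f g cf cg; exact: (cvgM cf cg).
Qed.

Lemma near_nonroot (p : {poly C}) (A : set C) (x : C) : p != 0 -> nbhs x A ->
  exists2 y, A y & ~~ root p y.
Proof.
move=> p0 /nbhs_numP[e e0 eA].
pose z (i : nat) := x + e / (i.+2)%:R.
have zA i : A (z i).
  apply: eA; rewrite /z opprD addrA subrr sub0r normrN gtr0_norm ?divr_gt0 ?ltr0n //.
  by rewrite ltr_pdivrMr ?ltr0n // ltr_pMr // ltr1n.
pose s := [seq z i | i <- iota 0 (size p)].
have us : uniq s.
  rewrite map_inj_uniq ?iota_uniq // => i j /addrI/(mulfI (lt0r_neq0 e0))/invr_inj/eqP.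
  by rewrite eqr_nat => /eqP[].
have [/(max_poly_roots p0)/(_ us)|/allPn[_ /mapP[i _ ->] nz]] := boolP (all (root p) s).
  by rewrite size_map size_iota ltnn.
by exists (z i).
Qed.

(** The restriction of [F] to the parametrized line [x + t *: v]. *)
Definition line_poly n (F : mpoly n C) (x v : 'rV[C]_n) : {poly C} :=
  mmap (@polyC C) (fun i => (x 0 i)%:P + (v 0 i) *: 'X) F.

Lemma horner_line_poly n (F : mpoly n C) (x v : 'rV[C]_n) t :
  (line_poly F x v).[t] = meval ((x + t *: v) 0) F.
Proof.
rewrite /line_poly /meval /mmap horner_sum; apply: eq_bigr => m _.
rewrite hornerM hornerC; congr (_ * _); rewrite /mmap1 horner_prod.
by apply: eq_bigr => i _; rewrite horner_exp !hornerE !mxE mulrC.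
Qed.

End EuclideanNeighbourhoods.

Section InfiniteField.
Context (C : numFieldType).

(** The coefficient of [F] at a monomial [m] is the coefficient of [muni F] at
    the exponent of the last variable in [m], then at the rest [w m]. *)
Lemma muni_eq0 n (F : mpoly n.+1 C) : muni F = 0 -> F = 0.
Proof.
move=> F0; apply/eqP; rewrite -msupp_eq0; case E: (msupp F) => [|m s] //.
have mF : m \in msupp F by rewrite E mem_head.
pose w (m : multinom n.+1) := Multinom [tuple m (widen_ord (leqnSn n) i) | i < n].
have : mcoeff (w m) (muni F)`_(m ord_max) = 0 by rewrite F0 coef0 mcoeff0.
rewrite muniE coef_sum raddf_sum (bigD1_seq m) ?msupp_uniq //= big1 ?addr0.
  rewrite coefZ coefXn eqxx mulr1 mcoeffZ mcoeffX eqxx mulr1 => /eqP.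
  by rewrite mcoeff_eq0 mF.
move=> m' m'm; rewrite coefZ coefXn; case: eqP => [mm'|_]; last by rewrite mulr0 mcoeff0.
rewrite mulr1 mcoeffZ mcoeffX; case: eqP => [/mnmP wE|_]; last by rewrite mulr0.
case/eqP: m'm; apply/mnmP => i; case: (unliftP ord_max i) => [j ->|->] //.
have -> : lift ord_max j = widen_ord (leqnSn n) j.
  by apply: val_inj; rewrite /= /bump leqNgt ltn_ord.
by have := wE j; rewrite !mnmE.
Qed.

Lemma meval_muni n (F : mpoly n.+1 C) (v : 'I_n.+1 -> C) :
  meval v F = (map_poly (meval (fun i => v (widen_ord (leqnSn n) i))) (muni F)).[v ord_max].
Proof.
rewrite muniE rmorph_sum horner_sum /meval /mmap /=; apply: eq_bigr => m _.
rewrite map_polyZ map_polyXn hornerZ hornerXn /= mevalZ mevalX -mulrA; congr (_ * _).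
rewrite /mmap1 big_ord_recr /=; congr (_ * _).
by apply: eq_bigr => i _; rewrite mnmE.
Qed.

Lemma mpoly_fun_eq0 n (F : mpoly n C) : (forall v : 'rV[C]_n, meval (v 0) F = 0) -> F = 0.
Proof.
elim: n F => [|n IHn] F F0.
  apply/mpolyP => m; rewrite mcoeff0; have := F0 0; rewrite /meval /mmap.
  have m0 (m' : multinom 0) : m' = m by apply/mnmP => -[].
  have [mF|] := boolP (m \in msupp F); last by move/memN_msupp_eq0.
  rewrite (bigD1_seq m) ?msupp_uniq //= big1 => [|m']; last by rewrite (m0 m') eqxx.
  by rewrite /mmap1 big_ord0 mulr1 addr0.
apply: muni_eq0; apply/polyP => j; rewrite coef0; apply: IHn => v.
pose p := map_poly (meval (v 0)) (muni F).
suff p0 : p = 0 by have := coef_map (meval (v 0)) (muni F) j; rewrite -/p p0 coef0 => <-.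
apply/eqP; apply: contrapT => /negP/near_nonroot nz.
have [t _ /negP[]] := nz setT 0 filterT.
rewrite rootE -[X in _ == X](F0 (\row_i oapp (v 0) t (unlift ord_max i))).
rewrite meval_muni mxE unlift_none /=; apply/eqP; congr (_.[_]).
apply: eq_map_poly => G; apply: meval_eq => i; rewrite mxE.
have -> : widen_ord (leqnSn n) i = lift ord_max i.
  by apply: val_inj; rewrite /= /bump leqNgt ltn_ord.
by rewrite liftK.
Qed.

Lemma mpoly_neq0P n (F : mpoly n C) : F != 0 -> exists v : 'rV[C]_n, meval (v 0) F != 0.
Proof.
move=> F0; apply: contrapT => nz; case/eqP: F0; apply: mpoly_fun_eq0 => v.
by apply/eqP; apply: contrapT => /negP vF; apply: nz; exists v.
Qed.

(** On the line from [x] to a point where [F] does not vanish, [F] has finitely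
    many zeros. *)
Lemma near_mpoly_neq0 n (F : mpoly n C) (x : 'rV[C]_n) (A : set 'rV[C]_n) :
  F != 0 -> nbhs x A -> exists2 y, A y & meval (y 0) F != 0.
Proof.
move=> /mpoly_neq0P[v Fv] xA; pose p := line_poly F x (v - x).
have p0 : p != 0.
  apply: contraNneq Fv => p0; have := horner_line_poly F x (v - x) 1.
  by rewrite -/p p0 horner0 scale1r addrC subrK => <-.
have [t At pt] : exists2 t, A (x + t *: (v - x)) & ~~ root p t.
  apply: (near_nonroot (x := 0) (A := [set t | A (x + t *: (v - x))]) p0).
  have /nbhs_rowP[e e0 eA] := xA.
  pose M := \sum_i `|(v - x) 0 i|.
  have M0 : 0 <= M by apply: sumr_ge0.
  apply/nbhs_numP; exists (e / (1 + M)); first by rewrite divr_gt0 // ltr_wpDr.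
  move=> t; rewrite sub0r normrN ltr_pdivlMr ?ltr_wpDr // => te.
  apply: eA => i; rewrite !mxE opprD addrA subrr sub0r normrN normrM.
  apply: le_lt_trans te; rewrite ler_wpM2l // ler_wpDl // /M (bigD1 i) //= !mxE lerDl.
  exact: sumr_ge0.
by exists (x + t *: (v - x)) => //; rewrite -horner_line_poly.
Qed.

End InfiniteField.

(** * Continuity of roots *)

Section Roots.
Context (C : numClosedFieldType).
Implicit Types p q : {poly C}.

Lemma monic_prod_roots p : p \is monic ->
  exists2 s, p = \prod_(z <- s) ('X - z%:P) & size p = (size s).+1.
Proof.
move=> /monicP p1; have [s] := closed_field_poly_normal p.
rewrite p1 scale1r => Dp; exists s => //.
by rewrite Dp size_prod_XsubC.
Qed.

(** The value at [t0] is the product of the differences with the roots, so one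
    of them is small. *)
Lemma monic_root_near p (t0 e : C) : p \is monic -> 0 < e ->
  `|p.[t0]| < e ^+ (size p).-1 -> exists2 t, root p t & `|t0 - t| < e.
Proof.
move=> /monic_prod_roots[s Dp ->] e0 /= pe; apply: contrapT => far.
have {}far : {in s, forall z, e <= `|t0 - z|}.
  move=> z zs; rewrite real_leNgt ?normr_real ?gtr0_real //; apply/negP => tz.
  by apply: far; exists z => //; rewrite Dp root_prod_XsubC.
move: pe; apply/negP; rewrite le_gtF //; move: far; rewrite {}Dp.
elim: s => [|z s IHs] far; first by rewrite big_nil hornerC normr1.
rewrite big_cons hornerM normrM exprS ler_pM ?exprn_ge0 ?(ltW e0) //.
  by rewrite hornerXsubC far ?mem_head.
by apply: IHs => x xs; apply: far; rewrite inE xs orbT.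
Qed.

Lemma monic_root_bound p (K t : C) : p \is monic -> 0 <= K ->
  (forall i, (i < (size p).-1)%N -> `|p`_i| <= K) -> root p t ->
  `|t| <= 1 + (size p).-1%:R * K.
Proof.
move=> p1 K0 pK /rootP; set m := (size p).-1.
have sp : size p = m.+1 by rewrite prednK // size_poly_gt0 monic_neq0.
rewrite horner_coef sp big_ord_recr /= -[m in p`_m]/((size p).-1).
rewrite -lead_coefE (monicP p1) mul1r => /eqP; rewrite addrC addr_eq0 => /eqP tm.
have [t1 | t1] := real_leP (normr_real t) (@real1 C).
  by apply: le_trans t1 _; rewrite lerDl mulr_ge0 ?ler0n.
have t0 : 0 < `|t| by apply: lt_trans t1.
have : `|t| ^+ m <= (m%:R * K) * `|t| ^+ m.-1.
  rewrite -normrX tm normrN; apply: le_trans (ler_norm_sum _ _ _) _.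
  rewrite -mulrA mulr_natl -[X in _ *+ X]card_ord -sumr_const.
  apply: ler_sum => i _; rewrite normrM normrX ler_pM ?exprn_ge0 //.
    exact: pK.
  by rewrite ler_eXn2l ?ltn_predRL //; case: (m) i => [[]|m' i] //; rewrite -ltnS.
case: (posnP m) => [->|m0].
  by rewrite expr0 mul0r mul0r ler10.
rewrite -{1}(prednK m0) exprS ler_pM2r ?exprn_gt0 // => tK.
by apply: le_trans tK _; rewrite lerDr.
Qed.

Lemma coef_prod_XsubC_le (M : C) (s : seq C) i : 0 <= M -> all (fun z => `|z| <= M) s ->
  `|(\prod_(z <- s) ('X - z%:P))`_i| <= (1 + M) ^+ size s.
Proof.
move=> M0; elim: s i => [|z s IHs] i /= => [_|/andP[zM sM]].
  by rewrite big_nil coef1 expr0; case: (i == _); rewrite ?normr1 ?normr0.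
rewrite big_cons mulrBl coefB coefXM coefCM exprS mulrDl mul1r.
apply: le_trans (ler_normB _ _) _; apply: lerD.
  by case: eqP => _; [rewrite normr0 exprn_ge0 ?addr_ge0 | exact: IHs].
by rewrite normrM ler_pM // IHs.
Qed.

(** Coefficients are the leading coefficient times elementary symmetric
    functions of the roots. *)
Lemma coef_le_roots p (M : C) i : 0 <= M -> (forall z, root p z -> `|z| <= M) ->
  `|p`_i| <= `|lead_coef p| * (1 + M) ^+ (size p).-1.
Proof.
move=> M0 rM; have [p0 | p0] := eqVneq p 0.
  by rewrite p0 coef0 lead_coef0 normr0 mul0r.
have [s Dp] := closed_field_poly_normal p.
have a0 : lead_coef p != 0 by rewrite lead_coef_eq0.
have ss : (size p).-1 = size s.
  by rewrite Dp size_scale // size_prod_XsubC.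
rewrite {1}Dp coefZ normrM ler_wpM2l // ss coef_prod_XsubC_le //.
apply/allP => z zs; apply: rM.
by rewrite Dp rootZ // root_prod_XsubC.
Qed.

(** A root [t] of [q] is bounded in terms of [p], so [p.[t] = (p - q).[t]] is
    small, and [monic_root_near] applies. *)
Lemma monic_roots_continuous p (e : C) : p \is monic -> 0 < e ->
  exists2 d : C, 0 < d & forall q, q \is monic -> size q = size p ->
    (forall i, `|p`_i - q`_i| < d) -> forall t, root q t ->
    exists2 t0, root p t0 & `|t0 - t| < e.
Proof.
move=> p1 e0; set m := (size p).-1.
have sp : size p = m.+1 by rewrite prednK // size_poly_gt0 monic_neq0.
(* As d <= 1 below, K bounds the coefficients of q and B bounds its roots;
   D bounds the sum of the powers of a root that are multiplied by d. *)
pose K := 1 + \sum_(i < m.+1) `|p`_i|.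
have K0 : 0 <= K by rewrite addr_ge0 // sumr_ge0.
pose B := 1 + m%:R * K.
have B0 : 0 <= B by rewrite addr_ge0 // mulr_ge0.
pose D := 1 + \sum_(i < m.+1) B ^+ i.
have D0 : 0 < D by rewrite ltr_wpDr // sumr_ge0 // => i _; rewrite exprn_ge0.
have em0 : 0 < e ^+ m by rewrite exprn_gt0.
have eD0 : 0 < e ^+ m + D by rewrite addr_gt0.
exists (e ^+ m / (e ^+ m + D)); first by rewrite divr_gt0.
move=> q q1 sq pq t qt.
have d1 : e ^+ m / (e ^+ m + D) <= 1 by rewrite ler_pdivrMr // mul1r lerDl ltW.
have qK i : (i < (size q).-1)%N -> `|q`_i| <= K.
  rewrite sq sp /= => im; rewrite -[q`_i](subKr p`_i).
  apply: le_trans (ler_normB _ _) _; rewrite addrC lerD //.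
    by apply: ltW; apply: lt_le_trans (pq i) _.
  rewrite (bigD1 (Ordinal (leqW im))) //= lerDl sumr_ge0 //.
have tB : `|t| <= B by have := monic_root_bound q1 K0 qK qt; rewrite sq.
have [] := @monic_root_near p t e p1 e0; last first.
  by move=> t0 pt0 tt0; exists t0 => //; rewrite distrC.
have -> : p.[t] = (p - q).[t] by rewrite hornerD hornerN (rootP qt) subr0.
rewrite (@horner_coef_wide _ m.+1); last first.
  by rewrite (leq_trans (size_polyD _ _)) // size_polyN sq sp maxnn.
apply: le_lt_trans (ler_norm_sum _ _ _) _.
apply: (@le_lt_trans _ _ (\sum_(i < m.+1) (e ^+ m / (e ^+ m + D)) * B ^+ i)).
  apply: ler_sum => i _; rewrite normrM normrX coefB ler_pM ?exprn_ge0 //.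
    exact: ltW.
  by rewrite lerXn2r // nnegrE.
rewrite -mulr_sumr mulrAC ltr_pdivrMr // ltr_pM2l //.
by rewrite /D addrA ltrDr addr_gt0.
Qed.

End Roots.

(** * Locally bounded quotients of polynomials are polynomials *)

Section BoundedQuotient.
Context (C : numClosedFieldType).

Lemma horner_continuous (p : {poly C}) : continuous (fun t => p.[t]).
Proof.
move=> t; pose F := \sum_(i < size p) mpolyC 1 p`_i * mpolyX C (mnm1 ord0) ^+ i.
have pF (u : C) : p.[u] = meval ((\row_(i < 1) u) 0) F.
  rewrite horner_coef rmorph_sum; apply: eq_bigr => i _ /=.
  by rewrite rmorphM rmorphXn /= mevalC mevalXU mxE.
rewrite (funext pF); have cF := polyfun_continuous (polyfun_meval F).
have c1 : continuous_at t (fun u : C => (\row_(i < 1) u : 'rV[C]_1)).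
  move=> A /nbhs_rowP[e e0 eA]; apply/nbhs_numP; exists e => // u tu.
  by apply: eA => i; rewrite !mxE.
exact: (continuous_comp c1 (cF _)).
Qed.

(** After division by the greatest common divisor, [q] does not vanish at a root
    of [p], near which the quotient is then unbounded. *)
Lemma dvdp_of_bounded (p q : {poly C}) : p != 0 ->
  (forall t0 : C, exists2 M : C, 0 <= M & \forall t \near t0, `|q.[t]| <= M * `|p.[t]|) ->
  p %| q.
Proof.
move=> p0 bnd; set g := gcdp p q.
have g0 : g != 0 by rewrite gcdp_eq0 (negPf p0).
have Dp : p = p %/ g * g by rewrite divpK ?dvdp_gcdl.
have Dq : q = q %/ g * g by rewrite divpK ?dvdp_gcdr.
have cop : coprimep (p %/ g) (q %/ g) by rewrite coprimep_div_gcd ?p0.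
move: Dp Dq cop; set p' := p %/ g; set q' := q %/ g => Dp Dq cop.
have [/eqP sp | sp] := boolP (size p' == 1%N).
  have /size_poly1P[c c0 Dp'] : size p' == 1%N by rewrite sp.
  by rewrite Dq Dp Dp' mul_polyC dvdpZl // dvdp_mull.
have [t0 pt0] := closed_rootP p' sp.
have qt0 : q'.[t0] != 0 by exact: coprimep_root cop pt0.
have [M M0 nearM] := bnd t0.
pose e := `|q'.[t0]| / 2.
have e0 : 0 < e by rewrite divr_gt0 ?normr_gt0.
have nearq : \forall t \near t0, `|q'.[t0] - q'.[t]| < e.
  by apply: near_small e0; exact: horner_continuous.
have eM0 : 0 < e / (1 + M) by rewrite divr_gt0 // ltr_wpDr.
have nearp : \forall t \near t0, `|p'.[t0] - p'.[t]| < e / (1 + M).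
  by apply: near_small eM0; exact: horner_continuous.
have [t [pqt [ptt qtt]] gt] := near_nonroot g0 (filterI nearM (filterI nearp nearq)).
have {}gt : 0 < `|g.[t]| by rewrite normr_gt0.
move: pqt; rewrite /= Dp Dq !hornerM !normrM mulrA ler_pM2r // => pqt.
move: ptt; rewrite /= (rootP pt0) sub0r normrN ltr_pdivlMr ?ltr_wpDr // mulrDr mulr1 => ptt.
have : `|q'.[t]| < e.
  apply: le_lt_trans pqt _; apply: le_lt_trans ptt.
  by rewrite mulrC lerDr.
move=> qte; have : `|q'.[t0]| < e + e.
  rewrite -[q'.[t0]](subrK q'.[t]); apply: le_lt_trans (ler_normD _ _) _.
  exact: ltrD.
by rewrite /e -splitr ltxx.
Qed.

Lemma near_le_dense n (r a c : mpoly n C) (M : C) (x0 : 'rV[C]_n) : r != 0 -> 0 <= M ->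
  (\forall x \near x0, meval ((x : 'rV[C]_n) 0) r != 0 ->
     `|meval (x 0) c| <= M * `|meval (x 0) a|) ->
  \forall x \near x0, `|meval ((x : 'rV[C]_n) 0) c| <= M * `|meval (x 0) a|.
Proof.
move=> r0 M0 /near_join; apply: filterS => x nx.
rewrite real_leNgt ?normr_real ?realM ?normr_real ?ger0_real //; apply/negP => ac.
have e0 : 0 < (`|meval (x 0) c| - M * `|meval (x 0) a|) / (1 + M).
  by rewrite divr_gt0 ?subr_gt0 // ltr_wpDr.
have na := near_small (polyfun_continuous (polyfun_meval a) (x := x)) e0.
have nc := near_small (polyfun_continuous (polyfun_meval c) (x := x)) e0.
have [y [ry [ay cy]] yr] := near_mpoly_neq0 r0 (filterI nx (filterI na nc)).
have {}ry := ry yr.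
move: ay cy => /=; set d := _ / _ => ay cy.
have dE : d + M * d = `|meval (x 0) c| - M * `|meval (x 0) a|.
  by rewrite -{1}[d]mul1r -mulrDl mulrC divfK // gt_eqF // ltr_wpDr.
have : `|meval (x 0) c| < d + M * (d + `|meval (x 0) a|).
  rewrite -[meval (x 0) c](subrK (meval (y 0) c)).
  apply: le_lt_trans (ler_normD _ _) _; apply: ltr_leD => //.
  apply: le_trans ry _; apply: ler_wpM2l => //.
  rewrite -[meval (y 0) a](subrK (meval (x 0) a)).
  apply: le_trans (ler_normD _ _) _; rewrite lerD2r distrC.
  exact: ltW.
by rewrite mulrDr addrA dE subrK ltxx.
Qed.

(** Division with increasing powers of ['X]: the constant coefficient of [a] is
    invertible, so [a] is a divisor up to any given order. *)
Lemma power_series_div (A : comNzRingType) (a c : {poly A}) (b : A) n : b * a`_0 = 1 ->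
  exists q r : {poly A}, (size q <= n)%N /\ c = a * q + 'X^n * r.
Proof.
move=> ba; elim: n => [|n [q [r [sq Dc]]]].
  by exists 0, c; rewrite size_poly0 mulr0 add0r expr0 mul1r.
pose s := (b * r`_0)%:P; exists (q + 'X^n * s), (drop_poly 1 (r - a * s)); split.
  rewrite (leq_trans (size_polyD _ _)) // geq_max (leq_trans sq) //=.
  rewrite mulrC (leq_trans (size_polyMleq _ _)) // size_polyXn addnS /=.
  by rewrite -[n.+1]add1n leq_add2r size_polyC leq_b1.
have rs : r - a * s = 'X * drop_poly 1 (r - a * s).
  have t0 : take_poly 1 (r - a * s) = 0.
    apply/polyP => i; rewrite coef_take_poly coef0; case: i => [|i] //=.
    by rewrite coefB coefMC mulrA [_ * b]mulrC ba mul1r subrr.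
  have := poly_take_drop 1 (r - a * s); rewrite t0 add0r expr1 => E.
  by rewrite -[LHS]E mulrC.
by rewrite exprSr -mulrA -rs Dc; ring.
Qed.

Lemma line_poly_generic n (F : mpoly n C) (o : 'rV[C]_n) :
  exists S : {poly (mpoly n C)}, forall v : 'rV[C]_n,
    map_poly (meval (v 0)) S = line_poly F o v.
Proof.
exists (mmap (polyC \o @mpolyC n C)
  (fun i => (mpolyC n (o 0 i))%:P + (mpolyX C (mnm1 i))%:P * 'X) F) => v.
rewrite /line_poly /mmap rmorph_sum; apply: eq_bigr => m _.
rewrite rmorphM /= map_polyC /= mevalC; congr (_ * _).
rewrite /mmap1 rmorph_prod; apply: eq_bigr => i _.
by rewrite rmorphXn rmorphD rmorphM /= !map_polyC /= mevalC mevalXU map_polyX mul_polyC.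
Qed.

(** This is the normality of polynomial rings.  Choose [o] where [a] does not
    vanish and expand along the lines through [o], with generic direction:
    [Sa] and [Sc] are polynomials in one variable over the ring of polynomials
    in the direction [v].  The division with increasing powers gives [Sc] as
    [Sa * q] plus a remainder of high order.  For each value of [v] the
    division is exact, by the case of one variable, so the remainder is zero. *)
Lemma mpoly_dvd_of_bounded n (a c : mpoly n C) : a != 0 ->
  (forall x0 : 'rV[C]_n, exists2 M : C, 0 <= M &
    \forall x \near x0, `|meval ((x : 'rV[C]_n) 0) c| <= M * `|meval (x 0) a|) ->
  exists q, c = a * q.
Proof.
move=> /mpoly_neq0P[o ao] bnd.
pose al := (meval (o 0) a)^-1.
have [Sa mapSa] := line_poly_generic a o; have [Sc mapSc] := line_poly_generic c o.
have unit0 : mpolyC n al * Sa`_0 = 1.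
  apply/eqP; rewrite -subr_eq0; apply/eqP; apply: mpoly_fun_eq0 => v.
  rewrite mevalB mevalM mevalC meval1.
  have -> : meval (v 0) Sa`_0 = meval (o 0) a.
    rewrite -[LHS]coef_map mapSa -horner_coef0 horner_line_poly.
    by rewrite scale0r addr0.
  by rewrite mulVf // subrr.
set N := size Sc.
have [q [r [sq Dc]]] := power_series_div Sc N unit0.
have r0 : r = 0.
  apply/polyP => i; rewrite coef0; apply: mpoly_fun_eq0 => v.
  rewrite -[LHS]coef_map.
  have := congr1 (map_poly (meval (v 0))) Dc.
  rewrite rmorphD !rmorphM rmorphXn /= map_polyX mapSa mapSc.
  set A := line_poly a o v; set B := line_poly c o v.
  set Q := map_poly _ q; set R := map_poly _ r => DB.
  have A0 : A != 0.
    apply: contraNneq ao => A0; have := horner_line_poly a o v 0.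
    by rewrite -/A A0 horner0 scale0r addr0 => <-.
  have /dvdpP[S DS] : A %| B.
    apply: dvdp_of_bounded => // t0.
    have [M M0 nearM] := bnd (o + t0 *: v); exists M => //.
    have ct : continuous_at t0 (fun t : C => o + t *: v : 'rV[C]_n).
      move=> D /nbhs_rowP[e e0 eD]; apply/nbhs_numP.
      pose K := \sum_i `|v 0 i|; have K0 : 0 <= K by rewrite sumr_ge0.
      exists (e / (1 + K)); first by rewrite divr_gt0 // ltr_wpDr.
      move=> t; rewrite ltr_pdivlMr ?ltr_wpDr // => te; apply: eD => j.
      rewrite !mxE opprD addrACA subrr add0r -mulrBl normrM.
      apply: le_lt_trans te; rewrite ler_wpM2l // ler_wpDl // /K (bigD1 j) //= lerDl.
      exact: sumr_ge0.
    apply: (@filterS _ (nbhs t0) _ _ _ _ (ct _ nearM)) => t.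
    by rewrite /= !horner_line_poly.
  have sB : (size B <= N)%N by rewrite /B -mapSc size_poly.
  have sS : (size S <= N)%N.
    have [->|S0] := eqVneq S 0; first by rewrite size_poly0.
    apply: leq_trans sB; rewrite DS size_mul //.
    by move: A0; rewrite -size_poly_gt0; case: (size A) => // l _; rewrite addnS leq_addr.
  have sQ : (size Q <= N)%N by apply: leq_trans sq; rewrite size_poly.
  have DSQ : A * (S - Q) = 'X^N * R.
    by rewrite mulrBr [A * S]mulrC -DS DB addrC addKr.
  have cop : coprimep 'X^N A.
    apply: coprimep_expl; rewrite -['X]subr0 -polyC0 coprimep_sym coprimep_XsubC.
    by rewrite rootE horner_line_poly scale0r addr0.
  have : 'X^N %| S - Q by rewrite -(Gauss_dvdpr _ cop) DSQ dvdp_mulr.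
  have [SQ _|SQ /(dvdp_leq SQ)] := eqVneq (S - Q) 0.
    move: DSQ; rewrite SQ mulr0 => /esym/eqP.
    by rewrite mulf_eq0 expf_eq0 polyX_eq0 andbF /= => /eqP ->; rewrite coef0.
  rewrite size_polyXn leqNgt ltnS (leq_trans (size_polyD _ _)) //.
  by rewrite geq_max sS size_polyN.
have [G DG] : polyfun (fun x : 'rV[C]_n => (map_poly (meval ((x - o) 0)) q).[1]).
  have pq : polyfun (fun v : 'rV[C]_n => (map_poly (meval (v 0)) q).[1]).
    apply: polyfun_ext (polyfun_meval q.[1]) => v.
    by rewrite -(rmorph1 (meval (v 0))) horner_map.
  apply: polyfun_comp pq => j.
  apply: polyfun_ext (polyfunB (polyfun_coord _ j) (polyfun_cst _ (o 0 j))) => v.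
  by rewrite !mxE.
exists G; apply/eqP; rewrite -subr_eq0; apply/eqP; apply: mpoly_fun_eq0 => x.
have := congr1 (fun p => (map_poly (meval ((x - o) 0)) p).[1]) Dc.
rewrite r0 mulr0 addr0 rmorphM /= mapSa mapSc hornerM !horner_line_poly.
rewrite scale1r addrC subrK => xc.
by rewrite mevalB mevalM -DG xc subrr.
Qed.

End BoundedQuotient.

(** * Noether normalization *)

Section Growth.
Context (C : numClosedFieldType).

Lemma polyfun_bounded n (f : 'rV[C]_n -> C) (R : C) : polyfun f ->
  exists2 M : C, 0 <= M & forall v : 'rV[C]_n, (forall i, `|v 0 i| <= R) -> `|f v| <= M.
Proof.
move=> pf; elim/polyfun_ind: pf => {f}.
- by move=> c; exists `|c|.
- move=> i; exists `|R| => // v vR; apply: le_trans (vR i) _.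
  exact: real_ler_norm (ger0_real (le_trans (normr_ge0 _) (vR i))).
- move=> f g [M M0 fM] [L L0 gL]; exists (M + L); first exact: addr_ge0.
  by move=> v vR; apply: le_trans (ler_normD _ _) _; rewrite lerD ?fM ?gL.
- move=> f g [M M0 fM] [L L0 gL]; exists (M * L); first exact: mulr_ge0.
  by move=> v vR; rewrite normrM ler_pM ?fM ?gL.
Qed.

Definition top_form n (F : mpoly n C) : mpoly n C :=
  \sum_(m <- msupp F | mdeg m == (msize F).-1) mcoeff m F *: mpolyX C m.

Lemma top_form_neq0 n (F : mpoly n C) : F != 0 -> top_form F != 0.
Proof.
move=> F0; have mF := mlead_supp F0; have Dm := mlead_deg F0.
apply: contraNneq F0 => T0; have : mcoeff (mlead F) (top_form F) = 0 by rewrite T0 mcoeff0.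
rewrite /top_form big_mkcond raddf_sum (bigD1_seq (mlead F)) ?msupp_uniq //=.
rewrite -Dm eqxx mcoeffZ mcoeffX eqxx mulr1 big1 => [|m mm]; last first.
  by case: ifP => _; rewrite ?mcoeff0 // mcoeffZ mcoeffX (negPf mm) mulr0.
by rewrite addr0 => /eqP; rewrite mcoeff_eq0 mF.
Qed.

(** Along the line in direction [v], the polynomial [F] behaves at infinity like
    [s ^+ D] times the value at [v] of its form of top degree [D], uniformly
    for bounded [z].  The property [G f d c] below, of a function [f] with
    leading term [s ^+ d * c], is stable under the operations that build [F]. *)
Lemma root_line_bounded n (F : mpoly n C) (v : 'rV[C]_n) (R : C) :
  (1 < msize F)%N -> meval (v 0) (top_form F) != 0 -> 0 <= R ->
  exists2 K : C, 0 <= K & forall (z : 'rV[C]_n) s, (forall i, `|z 0 i| <= R) ->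
    meval ((z + s *: v) 0) F = 0 -> `|s| <= K.
Proof.
move=> F1 Tv R0.
pose G (f : 'rV[C]_n -> C -> C) d c := exists2 K : C, 0 <= K &
  forall (z : 'rV[C]_n) s, (forall i, `|z 0 i| <= R) -> 1 <= `|s| ->
    `|f z s - s ^+ d * c| * `|s| <= K * `|s| ^+ d.
have GM f d c g d' c' : G f d c -> G g d' c' -> G (fun z s => f z s * g z s) (d + d')%N (c * c').
  move=> [K K0 fK] [L L0 gL]; exists (K * (L + `|c'|) + `|c| * L).
    by rewrite addr_ge0 ?mulr_ge0 ?addr_ge0.
  move=> z s zR s1; have s0 : 0 < `|s| by apply: lt_le_trans s1.
  have gs : `|g z s| <= (L + `|c'|) * `|s| ^+ d'.
    rewrite -[g z s](subrK (s ^+ d' * c')); apply: le_trans (ler_normD _ _) _.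
    rewrite mulrDl normrM normrX [`|c'| * _]mulrC lerD // -(ler_pM2r s0).
    apply: le_trans (gL z s zR s1) _; rewrite -mulrA ler_wpM2l //.
    by rewrite ler_peMr // exprn_ge0.
  have -> : f z s * g z s - s ^+ (d + d') * (c * c') =
      (f z s - s ^+ d * c) * g z s + s ^+ d * c * (g z s - s ^+ d' * c').
    by rewrite exprD; ring.
  apply: le_trans (ler_wpM2r (normr_ge0 _) (ler_normD _ _)) _.
  rewrite mulrDl [X in _ <= X]mulrDl lerD //.
    rewrite normrM mulrAC exprD [X in _ <= X](_ : _ =
      (K * `|s| ^+ d) * ((L + `|c'|) * `|s| ^+ d')); last by ring.
    by apply: ler_pM => //; [rewrite mulr_ge0 | exact: fK].
  rewrite !normrM -mulrA exprD normrX [X in _ <= X](_ : _ =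
    `|s| ^+ d * `|c| * (L * `|s| ^+ d')); last by ring.
  by rewrite ler_wpM2l ?mulr_ge0 ?exprn_ge0 // gL.
have GD f g d c c' : G f d c -> G g d c' -> G (fun z s => f z s + g z s) d (c + c').
  move=> [K K0 fK] [L L0 gL]; exists (K + L); first exact: addr_ge0.
  move=> z s zR s1; rewrite mulrDr opprD addrACA mulrDl.
  apply: le_trans (ler_wpM2r (normr_ge0 _) (ler_normD _ _)) _.
  by rewrite mulrDl lerD ?fK ?gL.
have Gc c : G (fun _ _ => c) 0%N c.
  by exists 0 => // z s _ _; rewrite expr0 mul1r subrr normr0 !mul0r.
have Glift f d c d' : (d < d')%N -> G f d c -> G f d' 0.
  move=> dd' [K K0 fK]; exists (K + `|c|); first by rewrite addr_ge0.
  move=> z s zR s1; have s0 : 0 < `|s| by apply: lt_le_trans s1.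
  rewrite mulr0 subr0 -[f z s](subrK (s ^+ d * c)).
  apply: le_trans (ler_wpM2r (normr_ge0 _) (ler_normD _ _)) _.
  rewrite !mulrDl lerD //.
    apply: le_trans (fK z s zR s1) _; rewrite ler_wpM2l //.
    by rewrite ler_weXn2l // ltnW.
  rewrite normrM normrX mulrAC -exprSr mulrC ler_wpM2l //.
  by rewrite ler_weXn2l.
have Gx i : G (fun z s => (z + s *: v) 0 i) 1%N (v 0 i).
  exists R => // z s zR s1; rewrite !mxE expr1 addrK ler_wpM2r //.
pose D := (msize F).-1.
have Gm (m : multinom n) :
    G (fun z s => \prod_i (z + s *: v) 0 i ^+ m i) (mdeg m) (\prod_i v 0 i ^+ m i).
  rewrite mdegE -[index_enum _]/(index_enum 'I_n).
  elim: (index_enum 'I_n) => [|i r [K K0 IHr]].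
    rewrite !big_nil; case: (Gc 1) => K K0 cK; exists K => // z s zR s1.
    by rewrite big_nil; exact: cK.
  have [L L0 cL] : G (fun z s => (z + s *: v) 0 i ^+ m i * \prod_(i <- r) (z + s *: v) 0 i ^+ m i)
      (m i + \sum_(i <- r) m i)%N (v 0 i ^+ m i * \prod_(i <- r) v 0 i ^+ m i).
    apply: (GM (fun z s => (z + s *: v) 0 i ^+ m i)); last by exists K.
    elim: (m i) => [|e IHe].
      by case: (Gc 1) => L L0 cL; exists L.
    have [L L0 cL] := GM _ _ _ _ _ _ (Gx i) IHe.
    exists L => // z s zR s1.
    by rewrite (exprS ((z + s *: v) 0 i)) (exprS (v 0 i)); exact: cL.
  exists L => // z s zR s1; rewrite !big_cons; exact: cL.
have [K K0 FK] : G (fun z s => meval ((z + s *: v) 0) F) D (meval (v 0) (top_form F)).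
  have mD : {in msupp F, forall m, (mdeg m <= D)%N}.
    by move=> m /msize_mdeg_lt; rewrite /D; case: (msize F).
  have [K K0 cK] : G (fun z s => \sum_(m <- msupp F) mcoeff m F * \prod_i (z + s *: v) 0 i ^+ m i) D
      (\sum_(m <- msupp F | mdeg m == D) mcoeff m F * \prod_i v 0 i ^+ m i).
    elim: (msupp F) mD => [_|m r IHr mD].
      exists 0 => // z s _ _; rewrite !big_nil mulr0 subr0 normr0 !mul0r //.
    have {IHr}[||K K0 cK] := GD (fun z s => mcoeff m F * \prod_i (z + s *: v) 0 i ^+ m i) _ D
        (if mdeg m == D then mcoeff m F * \prod_i v 0 i ^+ m i else 0) _ _ (IHr _).
    - have := GM _ _ _ _ _ _ (Gc (mcoeff m F)) (Gm m); rewrite add0n.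
      case: eqP => [-> //|/eqP mDn]; apply: Glift.
      by rewrite ltn_neqAle mDn mD ?mem_head.
    - by move=> m' m'r; apply: mD; rewrite inE m'r orbT.
    exists K => // z s zR s1; rewrite !big_cons.
    have := cK z s zR s1; case: ifP => _ //; rewrite add0r //.
  have -> : meval (v 0) (top_form F) =
      \sum_(m <- msupp F | mdeg m == D) mcoeff m F * \prod_i v 0 i ^+ m i.
    by rewrite /top_form raddf_sum; apply: eq_bigr => m _; rewrite /= mevalZ mevalX.
  by exists K => // z s zR s1; rewrite mevalE; exact: cK.
pose T := `|meval (v 0) (top_form F)|.
have T0 : 0 < T by rewrite normr_gt0.
exists (1 + K / T); first by rewrite addr_ge0 // divr_ge0 // ltW.
move=> z s zR Fs; have [s1|s1] := real_leP (@real1 C) (normr_real s); last first.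
  by apply: le_trans (ltW s1) _; rewrite lerDl divr_ge0 // ltW.
have sD0 : 0 < `|s| ^+ D by rewrite exprn_gt0 // (lt_le_trans _ s1).
have := FK z s zR s1; rewrite Fs sub0r normrN normrM normrX -mulrA mulrC ler_pM2r //.
rewrite mulrC -ler_pdivlMr // => sK; apply: le_trans sK _.
by rewrite lerDr.
Qed.

End Growth.

Section Generic.
Context (C : numClosedFieldType) (N : nat) (U : set_system 'rV[C]_N) (UU : UltraFilter U).

Lemma ultra_or (A B : set 'rV[C]_N) : U (A `|` B) -> U A \/ U B.
Proof.
move=> UAB; have [UA|nA] := in_ultra_setVsetC A UU; first by left.
by right; apply: filterS (filterI UAB nA) => q [[//|//] ?].
Qed.

Lemma ultra_disjoint (A : set 'rV[C]_N) : U A -> U (~` A) -> False.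
Proof. by move=> UA /(filterI UA)/filter_ex[q []]. Qed.

Lemma ultra_false (A : set 'rV[C]_N) : U A -> (forall q, A q -> False) -> False.
Proof. by move=> /filter_ex[q Aq] /(_ q Aq). Qed.

(** The substitute for integrality over the coordinates [y]. *)
Definition bounded_over d (y : 'rV[C]_N -> 'rV[C]_d) (S : set 'rV[C]_N) :=
  forall R : C, exists2 M : C, 0 <= M & forall q, S q ->
    (forall j, `|y q 0 j| <= R) -> forall i, `|q 0 i| <= M.

(** Almost everywhere with respect to [U], the coordinates [y] are algebraically
    independent. *)
Definition generic_over d (y : 'rV[C]_N -> 'rV[C]_d) :=
  forall F : mpoly d C, U [set q | meval (y q 0) F = 0] -> F = 0.

(** As long as the coordinates [y] satisfy an equation [F = 0], project them
    along a direction [v] at which the top form of [F] is nonzero: by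
    [root_line_bounded] the projected coordinates still bound the points. *)
Lemma ultra_noether S : constructible S -> U S ->
  exists d (y : 'rV[C]_N -> 'rV[C]_d) T,
    [/\ polymap y, generic_over y, constructible T, U T & T `<=` S /\ bounded_over y T].
Proof.
move=> cS US.
suff IH d (y : 'rV[C]_N -> 'rV[C]_d) T : polymap y -> constructible T -> U T ->
    T `<=` S -> bounded_over y T -> exists d (y : 'rV[C]_N -> 'rV[C]_d) T,
    [/\ polymap y, generic_over y, constructible T, U T & T `<=` S /\ bounded_over y T].
  apply: (IH N id S) => //; first exact: polyfun_coord.
  move=> R; exists `|R| => // q _ qR i; apply: le_trans (qR i) _.
  exact: real_ler_norm (ger0_real (le_trans (normr_ge0 _) (qR i))).
elim: d y T => [|d IHd] y T py cT UT TS bT.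
  exists 0%N, y, T; split=> // F UF; apply/eqP; apply: contrapT => /negP/mpoly_neq0P[v /eqP Fv].
  by apply: (ultra_false UF) => q Fq; apply: Fv; rewrite -Fq; congr meval; apply/funext => -[].
have [gy | ngy] := pselect (generic_over y); first by exists d.+1, y, T.
have {ngy} [F F0 UF] : exists2 F : mpoly d.+1 C, F != 0 & U [set q | meval (y q 0) F = 0].
  apply: contrapT => nF; apply: ngy => F UF; apply/eqP; apply: contrapT => /negP F0.
  by apply: nF; exists F.
have F1 : (1 < msize F)%N.
  rewrite ltnNge; apply/negP => /msize1_polyC DF; case/eqP: F0.
  have [q] := filter_ex UF; rewrite /= {1}DF mevalC => c0.
  by rewrite DF c0 mpolyC0.
have [v Tv] := mpoly_neq0P (top_form_neq0 F0).
have [j vj] : exists j, v 0 j != 0.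
  apply: contrapT => nv; have v0 : v = 0.
    apply/rowP => j; rewrite mxE; apply/eqP; apply: contrapT => /negP vj.
    by apply: nv; exists j.
  have [q Fq] := filter_ex UF; pose R := \sum_i `|y q 0 i|.
  have R0 : 0 <= R by apply: sumr_ge0.
  have [K K0 /(_ (y q) (K + 1))] := root_line_bounded F1 Tv R0.
  rewrite v0 scaler0 addr0 => /(_ _ Fq); rewrite ger0_norm ?addr_ge0 // gerDl.
  rewrite ler10 => KF; have : false by apply: KF => i; rewrite /R (bigD1 i) //= lerDl sumr_ge0.
  by [].
(* The coordinates y' are those of the projection along v to the hyperplane
   where the j-th coordinate is zero. *)
pose w i := v 0 (lift j i) / v 0 j.
pose y' q : 'rV[C]_d := \row_i (y q 0 (lift j i) - y q 0 j * w i).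
pose T' := T `&` [set q | meval (y q 0) F = 0].
apply: (IHd y' T').
- move=> i; apply: polyfun_ext (polyfunB (py _) (polyfunM (py j) (polyfun_cst _ (w i)))) => q.
  by rewrite mxE.
- apply: constructible_and => //; apply: constructible0.
  exact: polyfun_comp py (polyfun_meval F).
- exact: filterI.
- by move=> q [/TS].
move=> R; have R0 : 0 <= `|R| by [].
have [K K0 rK] := root_line_bounded F1 Tv R0.
have [M M0 bM] := bT (`|R| + K * \sum_i `|v 0 i|); exists M => // q [Tq Fq] qR.
apply: bM => // i; pose s := y q 0 j / v 0 j; pose z := y q - s *: v.
have zR i' : `|z 0 i'| <= `|R|.
  case: (unliftP j i') => [l ->|->]; last first.
    by rewrite !mxE divfK // subrr normr0.
  have := qR l; rewrite !mxE /w => zR.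
  have -> : y q 0 (lift j l) - s * v 0 (lift j l) =
      y q 0 (lift j l) - y q 0 j * (v 0 (lift j l) / v 0 j) by rewrite /s; ring.
  exact: le_trans zR (real_ler_norm (ger0_real (le_trans (normr_ge0 _) zR))).
have yz : y q = z + s *: v by rewrite subrK.
have sK : `|s| <= K by apply: rK zR _; rewrite -yz.
rewrite yz !mxE; apply: le_trans (ler_normD _ _) _.
apply: lerD; first by have := zR i; rewrite !mxE.
rewrite normrM ler_pM // (bigD1 i) //= lerDl; exact: sumr_ge0.
Qed.
End Generic.

(** * Integral equations over generic coordinates *)

Section Specialization.
Context (C : numClosedFieldType) (d : nat).
Implicit Types (P Q F : {poly (mpoly d C)}) (x : 'rV[C]_d) (t : C).

Definition spec x P : {poly C} := map_poly (meval (x 0)) P.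

Lemma specD x P Q : spec x (P + Q) = spec x P + spec x Q.
Proof. exact: rmorphD. Qed.

Lemma specM x P Q : spec x (P * Q) = spec x P * spec x Q.
Proof. exact: rmorphM. Qed.

Lemma specC x a : spec x a%:P = (meval (x 0) a)%:P.
Proof. exact: map_polyC. Qed.

Lemma specX x : spec x 'X = 'X.
Proof. exact: map_polyX. Qed.

Lemma specZ x a P : spec x (a *: P) = meval (x 0) a *: spec x P.
Proof. exact: map_polyZ. Qed.

Lemma coef_spec x P i : (spec x P)`_i = meval (x 0) P`_i.
Proof. exact: coef_map. Qed.

Lemma size_spec x P : (size (spec x P) <= size P)%N.
Proof. by rewrite size_poly. Qed.

Lemma spec_monic x P : P \is monic -> spec x P \is monic.
Proof. exact: monic_map. Qed.

Lemma size_spec_monic x P : P \is monic -> size (spec x P) = size P.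
Proof.
by move=> /monicP P1; rewrite size_map_poly_id0 // P1 meval1 oner_neq0.
Qed.

Lemma polyfun_spec N (y : 'rV[C]_N -> 'rV[C]_d) (u : 'rV[C]_N -> C) P :
  polymap y -> polyfun u -> polyfun (fun q => (spec (y q) P).[u q]).
Proof.
move=> py pu.
apply: (@polyfun_ext _ _ (fun q => \sum_(i < size P) meval (y q 0) P`_i * u q ^+ i)).
  move=> q; rewrite (horner_coef_wide _ (size_spec _ _)).
  by apply: eq_bigr => i _; rewrite coef_spec.
apply: polyfun_sum => i _; apply: polyfunM; last exact: polyfunX.
exact: polyfun_comp py (polyfun_meval _).
Qed.

(** The point ([x], [t]), as a row vector. *)
Definition pt x t : 'rV[C]_(d + 1) := row_mx x (const_mx t).

Lemma polyfun_pt N (y : 'rV[C]_N -> 'rV[C]_d) (u : 'rV[C]_N -> C) :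
  polymap y -> polyfun u -> polymap (fun q => pt (y q) (u q)).
Proof.
move=> py pu j; case: (splitP j) => i Di.
  have -> : j = lshift 1 i by apply: val_inj.
  by apply: polyfun_ext (py i) => q; rewrite row_mxEl.
have -> : j = rshift d i by apply: val_inj.
by apply: polyfun_ext pu => q; rewrite row_mxEr mxE.
Qed.

Lemma polyfun_lift (f : 'rV[C]_(d + 1) -> C) : polyfun f ->
  exists P, forall x t, f (pt x t) = (spec x P).[t].
Proof.
move=> pf; elim/polyfun_ind: pf => {f}.
- by move=> c; exists (mpolyC d c)%:P => x t; rewrite specC mevalC hornerC.
- move=> j; case: (splitP j) => i Di.
    have -> : j = lshift 1 i by apply: val_inj.
    by exists (mpolyX C (mnm1 i))%:P => x t; rewrite row_mxEl specC mevalXU hornerC.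
  have -> : j = rshift d i by apply: val_inj.
  by exists 'X => x t; rewrite row_mxEr mxE specX hornerX.
- move=> f g [P Pf] [Q Qg]; exists (P + Q) => x t.
  by rewrite specD hornerD Pf Qg.
- move=> f g [P Pf] [Q Qg]; exists (P * Q) => x t.
  by rewrite specM hornerM Pf Qg.
Qed.

Lemma constructible_generic (T : set 'rV[C]_(d + 1)) : constructible T ->
  exists2 P, P != 0 & (forall x t, (spec x P).[t] != 0 -> T (pt x t)) \/
    (forall x t, (spec x P).[t] != 0 -> ~ T (pt x t)).
Proof.
elim=> {T} [f /polyfun_lift[P fP]|T _ [P P0 TP]|S T _ [P P0 SP] _ [Q Q0 TQ]].
- have [P0 | P0] := eqVneq P 0.
    exists 1; [exact: oner_neq0 | left=> x t _].
    by rewrite /= fP P0 /spec map_poly0 horner0.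
  by exists P => //; right=> x t; rewrite /= fP => /eqP.
- exists P => //; case: TP => TP; [right|left => //] => x t /TP Tx nTx.
  exact: nTx.
- exists (P * Q); first exact: mulf_neq0.
  have PQ x t : (spec x (P * Q)).[t] != 0 -> (spec x P).[t] != 0 /\ (spec x Q).[t] != 0.
    by rewrite specM hornerM mulf_eq0 negb_or => /andP.
  case: SP => SP; first by left=> x t /PQ[/SP Sx _]; left.
  case: TQ => TQ; first by left=> x t /PQ[_ /TQ Tx]; right.
  by right=> x t /PQ[/SP Sx /TQ Tx] [].
Qed.

End Specialization.

Section MinimalPolynomial.
Context (C : numClosedFieldType) (N : nat) (U : set_system 'rV[C]_N) (UU : UltraFilter U).
Context (d : nat) (y : 'rV[C]_N -> 'rV[C]_d) (T : set 'rV[C]_N).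
Context (py : polymap y) (gy : generic_over U y) (cT : constructible T).
Context (UT : U T) (bT : bounded_over y T).
Context (u : 'rV[C]_N -> C) (pu : polyfun u).

Let V (P : {poly (mpoly d C)}) := U [set q | (spec (y q) P).[u q] = 0].

Lemma vanishM P Q : V (P * Q) -> V P \/ V Q.
Proof.
move=> VPQ; apply: ultra_or; apply: filterS VPQ => q /=.
rewrite specM hornerM => /eqP; rewrite mulf_eq0 => /orP[] /eqP; [left|right]; done.
Qed.

Lemma vanishC a : V a%:P -> a = 0.
Proof. by move=> Va; apply: gy; apply: filterS Va => q; rewrite /= specC hornerC. Qed.

Lemma vanishZ a P : a != 0 -> V (a *: P) -> V P.
Proof.
by move=> a0; rewrite -mul_polyC => /vanishM[/vanishC/eqP|//]; rewrite (negPf a0).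
Qed.

Lemma vanish_mull P Q : V Q -> V (P * Q).
Proof. by apply: filterS => q /=; rewrite specM hornerM => ->; rewrite mulr0. Qed.

Lemma vanishB P Q : V P -> V Q -> V (P - Q).
Proof.
move=> VP VQ; apply: filterS (filterI VP VQ) => q /= [Pq Qq].
by rewrite /spec rmorphB /= hornerD hornerN -!/(spec _ _) Pq Qq subrr.
Qed.

Lemma image_bounded (R : C) : exists2 M : C, 0 <= M &
  forall q, T q -> (forall j, `|y q 0 j| <= R) -> `|u q| <= M.
Proof.
have [M M0 bM] := bT R; have [L L0 uL] := polyfun_bounded M pu; exists L => // q Tq yR.
exact: uL _ (bM q Tq yR).
Qed.

Let W := [set pt (y q) (u q) | q in T].

Let cW : constructible W.
Proof. by apply: constructible_image cT; exact: polyfun_pt. Qed.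

Let WE x t : W (pt x t) -> exists q, [/\ T q, y q = x & u q = t].
Proof.
move=> [q Tq /eq_row_mx[yx ut]]; exists q; split=> //.
by move/rowP/(_ 0): ut; rewrite !mxE.
Qed.

(** If [u] were transcendental over the coordinates [y], the image [W] of [T]
    would contain a nonempty Zariski open set, hence points with [x] fixed and
    [t] arbitrarily large, against [image_bounded]. *)
Lemma exists_vanishing : exists2 P, P != 0 & V P.
Proof.
have [P P0 [WP|nWP]] := constructible_generic cW; last first.
  exists P => //; apply: filterS UT => q Tq /=; apply/eqP; apply: contrapT => /negP.
  by move/nWP; apply; exists q.
have /mpoly_neq0P[x Px] : lead_coef P != 0 by rewrite lead_coef_eq0.
have [M M0 uM] := image_bounded (\sum_j `|x 0 j|).
have P0x : spec x P != 0.
  by apply: contraNneq Px => Px0; rewrite lead_coefE -coef_spec Px0 coef0.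
(* There are more values of t beyond the bound M than roots of spec x P. *)
pose s := [seq M + i.+1%:R | i <- iota 0 (size (spec x P))].
have us : uniq s.
  rewrite map_inj_uniq ?iota_uniq // => i j /addrI/eqP.
  by rewrite eqr_nat => /eqP[].
have [/(max_poly_roots P0x)/(_ us)|/allPn[_ /mapP[i _ ->] nz]] := boolP (all (root (spec x P)) s).
  by rewrite size_map size_iota ltnn.
have [q [Tq yq uq]] := WE (WP x _ nz).
have : `|u q| <= M.
  apply: uM => // j; rewrite yq (bigD1 j) //= lerDl; exact: sumr_ge0.
by rewrite uq ger0_norm ?addr_ge0 // gerDl lern0.
Qed.

Lemma minimal_vanishing : exists P, [/\ P != 0, V P &
  forall Q, Q != 0 -> V Q -> (size P <= size Q)%N].
Proof.
have [P0 nz VP0] := exists_vanishing.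
pose A n := `[< exists P, [/\ P != 0, V P & size P = n] >].
have exA : exists n, A n by exists (size P0); apply/asboolP; exists P0.
case: (ex_minnP exA) => _ /asboolP[P [nzP VP <-]] minP; exists P; split=> // Q Q0 VQ.
by apply: minP; apply/asboolP; exists Q.
Qed.

(** The equation [P] defines an irreducible hypersurface, of which ([y], [u]) is
    a generic point: membership in a constructible set does not depend on the
    point of the hypersurface, outside a proper closed subset [r = 0] of the
    base.  A polynomial [F] that vanishes at the generic point is a multiple of
    [P] up to scalars, and another one is prime to [P], so that a Bezout
    identity gives [r]. *)
Lemma minimal_generic P (S : set 'rV[C]_(d + 1)) : P != 0 -> V P ->
  (forall Q, Q != 0 -> V Q -> (size P <= size Q)%N) -> constructible S ->
  exists2 r : mpoly d C, r != 0 & forall (x : 'rV[C]_d) t, meval (x 0) r != 0 -> (spec x P).[t] = 0 ->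
    (U [set q | S (pt (y q) (u q))] <-> S (pt x t)).
Proof.
move=> P0 VP minP; elim=> {S} [f /polyfun_lift[F fF]|S _ [r r0 rS]|S S' _ [r r0 rS] _ [r' r'0 rS']].
- have UF : U [set q | f (pt (y q) (u q)) = 0] <-> V F.
    by split; apply: filterS => q /=; rewrite fF.
  have [VF | nVF] := pselect (V F).
    have lc0 : lead_coef P ^+ Pdiv.Idomain.scalp F P != 0 by rewrite expf_neq0 // lead_coef_eq0.
    exists (lead_coef P ^+ Pdiv.Idomain.scalp F P) => // x t rx Pxt.
    split=> _; last exact/UF; rewrite /= fF.
    have DF := Pdiv.Idomain.divp_eq F P.
    have R0 : Pdiv.Idomain.modp F P = 0.
      apply/eqP; apply: contrapT => /negP R0; have := Pdiv.Idomain.ltn_modp F P.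
      rewrite P0 ltnNge minP //; have -> : Pdiv.Idomain.modp F P =
        (lead_coef P ^+ Pdiv.Idomain.scalp F P)%:P * F - Pdiv.Idomain.divp F P * P.
        by rewrite mul_polyC DF addrC addKr.
      by apply: vanishB; apply: vanish_mull.
    have := congr1 (fun G => (spec x G).[t]) DF.
    rewrite R0 addr0 specZ specM hornerM hornerZ Pxt mulr0 => /eqP.
    by rewrite mulf_eq0 (negPf rx) => /eqP.
  pose g := Pdiv.Idomain.gcdp P F.
  have /Pdiv.Idomain.dvdpP[[c h] /= c0 Dh] := Pdiv.Idomain.dvdp_gcdl P F.
  have /Pdiv.Idomain.dvdpP[[c' h'] /= c'0 Dh'] := Pdiv.Idomain.dvdp_gcdr P F.
  have h0 : h != 0.
    apply: contraNneq P0 => h0; move: Dh; rewrite h0 mul0r => /eqP.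
    by rewrite -mul_polyC mulf_eq0 polyC_eq0 (negPf c0).
  have Vh : V h.
    have : V (h * g) by rewrite -Dh -mul_polyC; exact: vanish_mull.
    case/vanishM=> // Vg; case: nVF; apply: (vanishZ c'0).
    by rewrite Dh'; exact: vanish_mull.
  have g0 : g != 0.
    by apply: contraNneq P0 => g0; move: Dh; rewrite -/g g0 mulr0 => /eqP;
      rewrite -mul_polyC mulf_eq0 polyC_eq0 (negPf c0).
  have /size_poly1P[rho rho0 Dg] : size g == 1%N.
    have := minP h h0 Vh; rewrite -(size_scale P c0) Dh size_mul // -/g.
    move: g0 h0; rewrite -!size_poly_gt0; case: (size g) (size h) => [|m] [|l] // _ _.
    by rewrite addSn /= addnS -ltnS -addnS; lia.
  have [[a b] /= /Pdiv.Idomain.eqpP[[e1 e2] /= /andP[e10 e20] E]] := Pdiv.Idomain.Bezoutp P F.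
  exists (e2 * rho) => [|x t]; first exact: mulf_neq0.
  rewrite mevalM mulf_eq0 negb_or => /andP[e2x rx] Pxt; split=> [/UF //|].
  rewrite /= fF => Fxt; have := congr1 (fun G => (spec x G).[t]) E.
  rewrite -/g Dg !specZ !specD !specM specC !hornerE Pxt Fxt !mulr0 addr0 mulr0 => /esym/eqP.
  by rewrite mulf_eq0 (negPf e2x) (negPf rx).
- exists r => // x t rx /(rS x t rx) Sxt.
  split=> [UnS /Sxt|nS]; first by move=> US; exact: ultra_disjoint US UnS.
  have [/Sxt //|] := in_ultra_setVsetC [set q | S (pt (y q) (u q))] UU.
  by apply: filterS.
- exists (r * r') => [|x t]; first exact: mulf_neq0.
  rewrite mevalM mulf_eq0 negb_or => /andP[rx r'x] Pxt.
  have Sxt := rS x t rx Pxt; have S'xt := rS' x t r'x Pxt; split.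
    by move=> /ultra_or[/Sxt|/S'xt]; [left|right].
  by move=> [/Sxt|/S'xt]; apply: filterS => q; [left|right].
Qed.

(** The minimal equation [P] can be made monic: outside of a hypersurface in the
    base, all its roots come from [T], hence are bounded, and so are the
    quotients of its coefficients by the leading one; by
    [mpoly_dvd_of_bounded] these quotients are polynomials. *)
Theorem integral_equation : exists P, [/\ P \is monic, V P &
  forall S : set 'rV[C]_(d + 1), constructible S -> U [set q | S (pt (y q) (u q))] ->
    exists2 r : mpoly d C, r != 0 & forall (x : 'rV[C]_d) t, meval (x 0) r != 0 ->
      (spec x P).[t] = 0 -> S (pt x t)].
Proof.
have [P [P0 VP minP]] := minimal_vanishing.
have a0 : lead_coef P != 0 by rewrite lead_coef_eq0.
have [r r0 rW] := minimal_generic P0 VP minP cW.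
have UW : U [set q | W (pt (y q) (u q))] by apply: filterS UT => q Tq; exists q.
have /choice[q Dq] : forall i, exists q, P`_i = lead_coef P * q.
  move=> i; apply: mpoly_dvd_of_bounded => // x0.
  have [M M0 uM] := image_bounded (1 + \sum_j `|x0 0 j|).
  exists ((1 + M) ^+ (size P).-1); first by rewrite exprn_ge0 // addr_ge0.
  apply: (near_le_dense (r := r * lead_coef P)); [exact: mulf_neq0 | by rewrite exprn_ge0 ?addr_ge0|].
  apply/nbhs_rowP; exists 1 => // x xx0; rewrite mevalM mulf_eq0 negb_or => /andP[rx ax].
  have sP : size (spec x P) = size P by rewrite size_map_poly_id0.
  rewrite -coef_spec mulrC -lead_coef_map_id0 ?meval0 // -/(spec x P) -sP.
  apply: coef_le_roots => // t /rootP/(rW x t rx)[/(_ UW)/WE[p [Tp yp <-]] _].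
  apply: uM => // j; rewrite yp -[x 0 j](subrK (x0 0 j)); apply: le_trans (ler_normD _ _) _.
  apply: lerD; first by rewrite distrC ltW.
  by rewrite (bigD1 j) //= lerDl; exact: sumr_ge0.
pose P' := \poly_(i < size P) q i.
have DP : P = lead_coef P *: P'.
  apply/polyP => i; rewrite coefZ coef_poly; case: ltnP => [_|Pi]; first exact: Dq.
  by rewrite mulr0 nth_default.
have P'1 : P' \is monic.
  apply/monicP; apply: (mulfI a0); rewrite mulr1 -[RHS]/(lead_coef P) [in RHS]DP.
  by rewrite lead_coefZ.
exists P'; split=> // [|S cS US]; first by apply: (vanishZ a0); rewrite -DP.
have [r' r'0 rS] := minimal_generic P0 VP minP cS; exists r' => // x t rx P'xt.
by apply/(rS x t rx) => //; rewrite DP specZ hornerZ P'xt mulr0.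
Qed.

End MinimalPolynomial.

(** * Euclidean and Zariski closures of constructible sets *)

Section Closures.
Context (C : numClosedFieldType).

Definition zariski_closure N (S : set 'rV[C]_N) : set 'rV[C]_N :=
  [set p | forall F : mpoly N C, (forall q : 'rV[C]_N, S q -> meval (q 0) F = 0) ->
     meval (p 0) F = 0].

Lemma closure_sub_zariski N (S : set 'rV[C]_N) : closure S `<=` zariski_closure S.
Proof.
move=> p Sp F FS; apply/eqP; apply: contrapT => /negP Fp.
have Fp0 : 0 < `|meval (p 0) F| by rewrite normr_gt0.
have [q [Sq]] := Sp _ (near_small (polyfun_continuous (polyfun_meval F) (x := p)) Fp0).
by rewrite /= (FS q Sq) subr0 ltxx.
Qed.

(** The sets of points of [S] at which a given polynomial is nonzero, for the
    polynomials that are nonzero at [p], form a filter basis: none of them is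
    empty as [p] is in the Zariski closure. *)
Lemma zariski_ultrafilter N (S : set 'rV[C]_N) p : zariski_closure S p ->
  exists U : set_system 'rV[C]_N, [/\ UltraFilter U, U S &
    forall f, polyfun f -> U [set q | f q = 0] -> f p = 0].
Proof.
move=> Sp; pose B (F : mpoly N C) := [set q : 'rV[C]_N | S q /\ meval (q 0) F != 0].
pose D := [set F : mpoly N C | meval (p 0) F != 0].
have PF : ProperFilter (filter_from D B).
  apply: filter_from_proper; last first.
    move=> F /eqP DF; apply: contrapT => B0; apply: DF; apply: Sp => q Sq.
    by apply/eqP; apply: contrapT => /negP Fq; apply: B0; exists q.
  apply: filter_from_filter; first by exists 1; rewrite /D /= meval1 oner_neq0.
  move=> F G DF DG; exists (F * G); first by rewrite /D /= mevalM mulf_neq0.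
  by move=> q [Sq]; rewrite mevalM mulf_eq0 negb_or => /andP[Fq Gq].
have [U [UU FU]] := ultraFilterLemma PF; exists U; split=> //.
  by apply: FU; exists 1; [rewrite /D /= meval1 oner_neq0 | move=> q []].
move=> f [F fF] Uf; apply/eqP; apply: contrapT => /negP fp.
have : U (B F) by apply: FU; exists F => //; rewrite /D /= -fF.
by move=> /(filterI Uf)/filter_ex[q [fq [_]]]; rewrite -fF fq eqxx.
Qed.

Lemma min_pos (a b : C) : 0 < a -> 0 < b -> exists c, [/\ 0 < c, c <= a & c <= b].
Proof.
move=> a0 b0; have ab : 0 < a + b by rewrite addr_gt0.
exists (a * b / (a + b)); split; first by rewrite divr_gt0 ?mulr_gt0.
  by rewrite ler_pdivrMr // ler_wpM2l ?(ltW a0) // lerDr ltW.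
by rewrite ler_pdivrMr // mulrC ler_wpM2l ?(ltW b0) // lerDl ltW.
Qed.

Lemma finite_min_pos (I : finType) (r : I -> C) : (forall i, 0 < r i) ->
  exists2 c, 0 < c & forall i, c <= r i.
Proof.
move=> r0; pose s := 1 + \sum_i (r i)^-1.
have s0 : 0 < s by rewrite ltr_wpDr // sumr_ge0 // => i _; rewrite invr_ge0 ltW.
exists s^-1 => [|i]; first by rewrite invr_gt0.
rewrite -[r i]invrK lef_pV2 ?posrE ?invr_gt0 //.
rewrite /s (bigD1 i) //= addrCA lerDl addr_ge0 // sumr_ge0 // => j _.
by rewrite invr_ge0 ltW.
Qed.

Lemma finite_box N (rt : 'I_N -> seq C) : exists (I : finType) (E : I -> 'rV[C]_N),
  forall q : 'rV[C]_N, (forall i, q 0 i \in rt i) -> exists i, E i = q.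
Proof.
pose K := \max_i size (rt i).
exists {ffun 'I_N -> 'I_K}, (fun phi : {ffun 'I_N -> 'I_K} => \row_i (rt i)`_(phi i)) => q qrt.
have qK (i : 'I_N) : (index (q 0%R i) (rt i) < K)%N.
  by apply: leq_trans (leq_bigmax i); rewrite index_mem.
by exists [ffun i => Ordinal (qK i)]; apply/rowP => i; rewrite mxE ffunE /= nth_index.
Qed.

(** The product of the nonzero linear forms [l |-> l (E i - p)] is a nonzero
    polynomial. *)
Lemma separating_form N (I : finType) (E : I -> 'rV[C]_N) (p : 'rV[C]_N) :
  exists (l : 'rV[C]_N) (eta : C), 0 < eta /\ forall i, E i != p ->
    eta <= `|\sum_j l 0 j * E i 0 j - \sum_j l 0 j * p 0 j|.
Proof.
pose F : mpoly N C := \prod_(i | E i != p) \sum_j mpolyX C (mnm1 j) * mpolyC N (E i 0 j - p 0 j).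
have F0 : F != 0.
  apply/prodf_neq0 => i; apply: contraNneq => Fi0.
  apply/eqP/rowP => j; apply/eqP; rewrite -subr_eq0.
  have := congr1 (meval (fun j' => (j' == j)%:R)) Fi0.
  rewrite rmorph_sum meval0 (bigD1 j) //= big1 => [|j' j'j]; last first.
    by rewrite mevalM mevalXU (negPf j'j) mul0r.
  by rewrite addr0 mevalM mevalXU eqxx mul1r mevalC => ->.
have [l Fl] := mpoly_neq0P F0; exists l.
pose a i := `|\sum_j l 0 j * E i 0 j - \sum_j l 0 j * p 0 j|.
have a0 i : E i != p -> 0 < a i.
  move=> Ei; rewrite normr_gt0 -sumrB; move: Fl; rewrite /F rmorph_prod.
  move=> /prodf_neq0/(_ i Ei); rewrite rmorph_sum /=.
  by under eq_bigr do rewrite mevalM mevalXU mevalC mulrBr.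
have [|eta eta0 etaP] := finite_min_pos (r := fun i => if E i == p then 1 else a i).
  by move=> i; case: eqVneq => // /a0.
by exists eta; split=> // i Ei; have := etaP i; rewrite (negPf Ei).
Qed.

(** Above [x0 = y p] there are finitely many candidates [E i], the points whose
    coordinates satisfy the integral equations at [x0]; the linear form [g]
    separates [p] from the others.  For [x] near [x0] and outside of a
    hypersurface, the integral equation of [g] has a root near [g p], which is
    the value of [g] at a point [q] of [S] above [x].  By the equations of its
    coordinates [q] is near some candidate, which can only be [p]. *)
Theorem zariski_sub_closure N (S : set 'rV[C]_N) : constructible S ->
  zariski_closure S `<=` closure S.
Proof.
move=> cS p /zariski_ultrafilter[U [UU US Up]].
have [d [y [T [py gy cT UT [TS bT]]]]] := ultra_noether UU cS US.
have IE u (pu : polyfun u) := integral_equation UU py gy cT UT bT pu.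
have /choice[Pi HPi] : forall i : 'I_N, exists P, _ := fun i => IE _ (polyfun_coord C i).
set x0 := y p.
have Pi1 i : Pi i \is monic by case: (HPi i).
have spec_root u P (pu : polyfun u) : U [set q | (spec (y q) P).[u q] = 0] ->
    (spec x0 P).[u p] = 0 by move=> UP; exact: (Up _ (polyfun_spec P py pu) UP).
have /choice[rt Hrt] : forall i, exists s : seq C, forall t, root (spec x0 (Pi i)) t -> t \in s.
  move=> i; have [s Ds _] := monic_prod_roots (spec_monic x0 (Pi1 i)); exists s => t.
  by rewrite Ds root_prod_XsubC.
have [I [E EP]] := finite_box rt.
have [l [eta [eta0 El]]] := separating_form E p.
pose g (q : 'rV[C]_N) := \sum_j l 0 j * q 0 j.
have pg : polyfun g.
  by apply: polyfun_sum => j _; apply: polyfunM (polyfun_cst _ _) (polyfun_coord _ j).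
have [Pg [Pg1 VPg genPg]] := IE g pg.
have gp := spec_root g Pg pg VPg.
pose T' := T `&` [set q | forall i, (spec (y q) (Pi i)).[q 0 i] = 0].
have cT' : constructible T'.
  apply: constructible_and => //; apply: constructible_allfin => i.
  by apply: constructible0; apply: polyfun_spec => //; exact: polyfun_coord.
have UT' : U T'.
  by apply: filterI => //; apply: filter_forall => i; case: (HPi i).
pose W := [set pt (y q) (g q) | q in T'].
have cW : constructible W by apply: constructible_image cT'; exact: polyfun_pt.
have UW : U [set q | W (pt (y q) (g q))] by apply: filterS UT' => q Tq; exists q.
have [r r0 rW] := genPg W cW UW.
move=> B /nbhs_rowP[e e0 eB].
pose L := \sum_j `|l 0 j|; have L0 : 0 <= L by rewrite sumr_ge0.
(* If q is within e' of E i and g q within e' of g p, then g takes values at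
   E i and p that differ by less than eta. *)
have [e' [e'0 e'e e'eta]] : exists c, [/\ 0 < c, c <= e & c <= eta / (1 + L)].
  by apply: min_pos => //; rewrite divr_gt0 // ltr_wpDr.
have near_roots i : \forall x \near x0, forall t, root (spec x (Pi i)) t ->
    exists2 t0, root (spec x0 (Pi i)) t0 & `|t0 - t| < e'.
  have [dl dl0 Hd] := monic_roots_continuous (spec_monic x0 (Pi1 i)) e'0.
  have : \forall x \near x0, forall j : 'I_(size (Pi i)),
      `|meval (x0 0) (Pi i)`_j - meval ((x : 'rV[C]_d) 0) (Pi i)`_j| < dl.
    apply: (@filter_forall _ _ (fun (j : 'I_(size (Pi i))) (x : 'rV[C]_d) =>
        `|meval (x0 0) (Pi i)`_j - meval (x 0) (Pi i)`_j| < dl) (nbhs x0) _) => j.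
    exact: (near_small (polyfun_continuous (polyfun_meval (Pi i)`_j) (x := x0)) dl0).
  apply: filterS => x Hx t xt; apply: Hd xt; first exact: spec_monic.
    by rewrite !size_spec_monic.
  move=> j; have [jP|Pj] := ltnP j (size (Pi i)).
    by rewrite !coef_spec; exact: (Hx (Ordinal jP)).
  by rewrite !nth_default ?(leq_trans (size_spec _ _)) // subrr normr0.
have near_g : \forall x \near x0, exists2 t, root (spec x Pg) t & `|g p - t| < e'.
  have em0 : 0 < e' ^+ (size Pg).-1 by rewrite exprn_gt0.
  have pPg : polyfun (fun x : 'rV[C]_d => (spec x Pg).[g p]).
    by apply: polyfun_spec; [exact: polyfun_coord | exact: polyfun_cst].
  have := near_small (polyfun_continuous pPg (x := x0)) em0.
  apply: filterS => x /=; rewrite gp sub0r normrN => xg.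
  by apply: monic_root_near => //; [exact: spec_monic | rewrite size_spec_monic].
have [x [xr [t /rootP xt gt]] rx] :=
  near_mpoly_neq0 r0 (filterI (filter_forall _ near_roots) near_g).
have [q [Tq Hq] /eq_row_mx[yq gq]] := rW x t rx xt.
have {}gq : g q = t by move/rowP/(_ 0): gq; rewrite !mxE.
exists q; split; first exact: TS.
have /choice[q' Hq'] : forall i, exists t0, root (spec x0 (Pi i)) t0 /\ `|t0 - q 0 i| < e'.
  move=> i; have [|t0 t0r t0q] := xr i (q 0 i); last by exists t0.
  by apply/rootP; rewrite -yq; exact: Hq.
have [phi Ephi] : exists phi, E phi = \row_i q' i.
  by apply: EP => i; rewrite mxE; apply: Hrt; case: (Hq' i).
have Eq i : `|E phi 0 i - q 0 i| < e' by rewrite Ephi mxE; case: (Hq' i).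
apply: eB => i; apply: lt_le_trans e'e.
suff <- : E phi = p by [].
apply/eqP; apply: contrapT => /negP/El; apply/negP; rewrite -/(g _) -/(g p).
rewrite -real_ltNge ?normr_real ?gtr0_real //.
apply: (@lt_le_trans _ _ (e' + L * e')); last first.
  by rewrite -{1}[e']mul1r -mulrDl mulrC -ler_pdivlMr // ltr_wpDr.
rewrite -(subrK (g q) (g (E phi))) -addrA; apply: le_lt_trans (ler_normD _ _) _.
rewrite [e' + _]addrC; apply: ler_ltD; last by rewrite distrC gq.
rewrite /g -sumrB; apply: le_trans (ler_norm_sum _ _ _) _.
rewrite /L mulr_suml; apply: ler_sum => j _; rewrite -mulrBr normrM.
by apply: ler_wpM2l => //; exact: ltW.
Qed.

End Closures.

(** * An algebraic criterion for covers *)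

Section Proportional.
Context (L : fieldType) (n : nat).
Implicit Types u v w : 'rV[L]_n.

Lemma proportional_refl u : (u == u)%MS.
Proof. by rewrite submx_refl. Qed.

Lemma proportional_sym u v : (u == v)%MS = (v == u)%MS.
Proof. by rewrite andbC. Qed.

Lemma proportional_trans u v w : (u == v)%MS -> (v == w)%MS -> (u == w)%MS.
Proof. by move=> /eqmxP uv /eqmxP vw; apply/eqmxP; exact: eqmx_trans uv vw. Qed.

Lemma proportional_neq0 u v : (u == v)%MS -> u != 0 -> v != 0.
Proof. by move=> /eqmxP uv; rewrite -!mxrank_eq0 uv. Qed.

Lemma scale_proportional (a : L) u : a != 0 -> (a *: u == u)%MS.
Proof. by move=> a0; apply/eqmxP; exact: eqmx_scale. Qed.

Lemma proportionalP u v : u != 0 -> v != 0 ->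
  (u == v)%MS <-> (forall i j, u 0 i * v 0 j = u 0 j * v 0 i).
Proof.
move=> u0 v0; split=> [/(projP u0)[a a0 ->] i j|uv]; first by rewrite !mxE; ring.
have [j vj] : exists j, v 0 j != 0 by apply/rV0Pn.
have uE : u = (u 0 j / v 0 j) *: v.
  by apply/rowP => i; rewrite !mxE mulrAC -uv mulfK.
rewrite uE; apply: scale_proportional; apply: contraNneq u0 => a0.
by rewrite uE a0 scale0r.
Qed.

End Proportional.

Section CriterionSets.
Context (k : fieldType) (C : numClosedFieldType) (e : {rmorphism k -> C}).
Context (n m : nat) (Y : qpvar k n) (X : qpvar k m) (f : morphism Y X).

Definition lies_over (y : 'rV[C]_n.+1) (x : 'rV[C]_m.+1) : Prop :=
  in_var e Y y /\ (mor_app e f y == x)%MS.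

(** Points are row vectors of homogeneous coordinates, so this is a set of pairs
    of vectors; its closure meets the diagonal where the map on points is not
    locally injective. *)
Definition collisions : set 'rV[C]_(n.+1 + n.+1) := [set u |
  [/\ in_var e Y (lsubmx u), lies_over (rsubmx u) (mor_app e f (lsubmx u)) &
      ~ (lsubmx u == rsubmx u)%MS]].

(** The rows of [Z] are [d] distinct points of the fibre. *)
Definition fibre_ge d (x : 'rV[C]_m.+1) : Prop := exists Z : 'M[C]_(d, n.+1),
  (forall i, lies_over (row i Z) x) /\ forall i j, i != j -> ~ (row i Z == row j Z)%MS.

Definition small_fibres d : set 'rV[C]_m.+1 := [set x | in_var e X x /\ ~ fibre_ge d x].

Lemma over_chartP y x : lies_over y x <-> in_var e Y y /\
  exists2 c, c \in mor_charts f & mxev e c y != 0 /\ (mxev e c y == x)%MS.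
Proof.
split=> [[Yy yx]|[Yy [c cf [cy0 cyx]]]].
  by split=> //; have [c cf [cy cE]] := mor_appP f Yy; exists c => //; split=> //; rewrite -cE.
split=> //; have [c' c'f [c'y ->]] := mor_appP f Yy.
exact: proportional_trans (mor_glue Yy c'f cf c'y cy0) cyx.
Qed.

Section Constructibility.
Context (N : nat).

Lemma polyfun_mev l (p : mpoly l k) (phi : 'rV[C]_N -> 'rV[C]_l) :
  polymap phi -> polyfun (fun u => mev e p (phi u)).
Proof. by move=> pphi; apply: polyfun_mmap. Qed.

Lemma constructible_eq0 l (phi : 'rV[C]_N -> 'rV[C]_l) : polymap phi ->
  constructible [set u | phi u = 0].
Proof.
move=> pphi.
apply: (@constructible_ext _ _ [set u | forall i, phi u 0 i = 0]).
  by move=> u /=; split=> [u0|-> i]; [apply/rowP => i; rewrite u0 mxE|rewrite mxE].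
by apply: constructible_allfin => i; exact: constructible0 (pphi i).
Qed.

Lemma constructible_neq0 l (phi : 'rV[C]_N -> 'rV[C]_l) : polymap phi ->
  constructible [set u | phi u != 0].
Proof.
move=> pphi; apply: constructible_ext (constructible_not (constructible_eq0 pphi)) => u /=.
by split=> [/eqP|/eqP].
Qed.

Lemma constructible_in_var l (Z : qpvar k l) (phi : 'rV[C]_N -> 'rV[C]_l.+1) : polymap phi ->
  constructible [set u | in_var e Z (phi u)].
Proof.
move=> pphi; apply: (@constructible_ext _ _ [set u | phi u != 0 /\
    ((forall p, p \in qp_eqs Z -> mev e p (phi u) = 0) /\
     exists2 q, q \in qp_neqs Z & ~ (mev e q (phi u) = 0))]).
  move=> u /=; split=> [[u0 [up [q qZ uq]]]|/and3P[u0 /allP up /hasP[q qZ uq]]].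
    apply/and3P; split=> //; first by apply/allP => p pZ; apply/eqP/up.
    by apply/hasP; exists q => //; apply/eqP.
  split=> //; split=> [p /up/eqP //|]; exists q => //; exact/eqP.
apply: constructible_and; first exact: constructible_neq0.
apply: constructible_and.
  by apply: constructible_all => p _; apply: constructible0; exact: polyfun_mev.
apply: constructible_has => q _; apply: constructible_not; apply: constructible0.
exact: polyfun_mev.
Qed.

Lemma constructible_proportional l (phi psi : 'rV[C]_N -> 'rV[C]_l) :
  polymap phi -> polymap psi -> constructible [set u | phi u != 0 /\ (phi u == psi u)%MS].
Proof.
move=> pphi ppsi; apply: (@constructible_ext _ _ [set u | phi u != 0 /\ (psi u != 0 /\
    forall i j, phi u 0 i * psi u 0 j = phi u 0 j * psi u 0 i)]).
  move=> u /=; split=> [[u0 [v0 uv]]|[u0 uv]]; first by split=> //; apply/proportionalP.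
  have v0 := proportional_neq0 uv u0; split=> //; split=> //; exact/proportionalP.
apply: constructible_and; first exact: constructible_neq0.
apply: constructible_and; first exact: constructible_neq0.
by apply: constructible_allfin => i; apply: constructible_allfin => j;
  apply: constructible_eq; apply: polyfunM.
Qed.

Lemma polymap_mxev l l' (c : 'rV[mpoly l k]_l') (phi : 'rV[C]_N -> 'rV[C]_l) :
  polymap phi -> polymap (fun u => mxev e c (phi u)).
Proof.
by move=> pphi j; apply: polyfun_ext (polyfun_mev (c 0 j) pphi) => u; rewrite mxE.
Qed.

Lemma constructible_over (phi : 'rV[C]_N -> 'rV[C]_n.+1) (psi : 'rV[C]_N -> 'rV[C]_m.+1) :
  polymap phi -> polymap psi -> constructible [set u | lies_over (phi u) (psi u)].
Proof.
move=> pphi ppsi.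
apply: constructible_ext (fun u => iff_sym (over_chartP (phi u) (psi u))) _.
apply: constructible_and; first exact: constructible_in_var.
apply: constructible_has => c _; apply: constructible_proportional => //.
exact: polymap_mxev.
Qed.

End Constructibility.

Lemma constructible_collisions : constructible collisions.
Proof.
have pl := @polymap_lsubmx C n.+1 n.+1; have pr := @polymap_rsubmx C n.+1 n.+1.
apply: (@constructible_ext _ _ [set u | (exists2 c, c \in mor_charts f &
    in_var e Y (lsubmx u) /\ (mxev e c (lsubmx u) != 0 /\ lies_over (rsubmx u) (mxev e c (lsubmx u)))) /\
    ~ (lsubmx u != 0 /\ (lsubmx u == rsubmx u)%MS)]).
  move=> u /=; split=> [[[c cf [Yl [cl0 [Yr rl]]]] lr]|[Yl [Yr rl] lr]].
    split=> //; last by move=> lr'; apply: lr; split=> //; exact: in_var_neq0 Yl.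
    split=> //; apply: proportional_trans rl _.
    have [c' c'f [c'l ->]] := mor_appP f Yl; exact: mor_glue Yl cf c'f cl0 c'l.
  split; last by case.
  by have [c cf [cl cE]] := mor_appP f Yl; exists c => //; split=> //; split=> //; rewrite -cE.
apply: constructible_and; last first.
  by apply: constructible_not; exact: constructible_proportional.
apply: constructible_has => c _; apply: constructible_and; first exact: constructible_in_var.
apply: constructible_and; first by apply: constructible_neq0; exact: polymap_mxev.
by apply: constructible_over => //; exact: polymap_mxev.
Qed.

Lemma constructible_small_fibres d : constructible (small_fibres d).
Proof.
apply: constructible_and; first by apply: constructible_in_var => i; exact: polyfun_coord.
apply: constructible_not.
have pl := @polymap_lsubmx C m.+1 (d * n.+1).
have prow i :
    polymap (fun u : 'rV[C]_(m.+1 + d * n.+1) => row i (vec_mx (rsubmx u) : 'M_(d, n.+1))).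
  move=> j; apply: polyfun_ext (polyfun_coord _ (rshift m.+1 (mxvec_index i j))) => u.
  by rewrite !mxE.
pose S := [set u : 'rV[C]_(m.+1 + d * n.+1) |
  (forall i, lies_over (row i (vec_mx (rsubmx u) : 'M_(d, n.+1))) (lsubmx u)) /\
  (forall i j, i != j -> ~ (row i (vec_mx (rsubmx u) : 'M_(d, n.+1)) != 0 /\
     (row i (vec_mx (rsubmx u) : 'M_(d, n.+1)) == row j (vec_mx (rsubmx u)))%MS))].
have cS : constructible S.
  apply: constructible_and; apply: constructible_allfin => i.
    exact: constructible_over.
  apply: constructible_allfin => j; apply: constructible_imply; first exact: constructibleP.
  by apply: constructible_not; exact: constructible_proportional.
apply: constructible_ext (constructible_ex cS) => x; rewrite /S /=; split.
  move=> [w]; rewrite row_mxKr row_mxKl => -[wx ww]; exists (vec_mx w); split=> // i j ij wij.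
  by apply: (ww i j ij); split=> //; have [/in_var_neq0] := wx i.
move=> [Z [Zx ZZ]]; exists (mxvec Z); rewrite row_mxKr row_mxKl mxvecK.
by split=> // i j /ZZ ij [_].
Qed.

(** The Euclidean closures are closures of constructible sets, so they could as
    well be Zariski closures; see [cover_criterion_transport]. *)
Definition cover_criterion : Prop :=
  [/\ forall x, in_var e X x -> exists y, lies_over y x,
      forall y, in_var e Y y -> ~ closure collisions (row_mx y y) &
      forall d x, in_var e X x -> fibre_ge d x -> ~ closure (small_fibres d) x].

End CriterionSets.

Section Transport.
Context (k : fieldType) (C : numClosedFieldType) (e1 e2 : {rmorphism k -> C}).
Context (tau : {rmorphism C -> C}) (tau_bij : bijective tau).
Context (tauE : forall a, e2 a = tau (e1 a)).
Context (n m : nat) (Y : qpvar k n) (X : qpvar k m) (f : morphism Y X).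

Lemma mev_transport l (p : mpoly l k) v : mev e2 p (map_mx tau v) = tau (mev e1 p v).
Proof.
rewrite /mev /mmap rmorph_sum; apply: eq_bigr => i _; rewrite rmorphM tauE; congr (_ * _).
by rewrite /mmap1 rmorph_prod; apply: eq_bigr => j _; rewrite rmorphXn mxE.
Qed.

Lemma mxev_transport l l' (c : 'rV[mpoly l k]_l') v :
  mxev e2 c (map_mx tau v) = map_mx tau (mxev e1 c v).
Proof. by apply/rowP => j; rewrite !mxE mev_transport. Qed.

Lemma in_var_transport l (Z : qpvar k l) v : in_var e2 Z (map_mx tau v) = in_var e1 Z v.
Proof.
rewrite /in_var map_mx_eq0; congr [&& _, _ & _].
  by apply: eq_all => p; rewrite mev_transport fmorph_eq0.
by apply: eq_has => p; rewrite mev_transport fmorph_eq0.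
Qed.

Lemma mor_app_transport v : mor_app e2 f (map_mx tau v) = map_mx tau (mor_app e1 f v).
Proof.
rewrite /mor_app; elim: (mor_charts f) => [|c s IHs] /=; first by rewrite map_mx0.
by rewrite mxev_transport map_mx_eq0; case: ifP.
Qed.

Lemma proportional_transport l (u v : 'rV[C]_l) :
  (map_mx tau u == map_mx tau v)%MS = (u == v)%MS.
Proof. by rewrite !map_submx. Qed.

Lemma over_transport y x : lies_over e2 f (map_mx tau y) (map_mx tau x) <-> lies_over e1 f y x.
Proof. by rewrite /lies_over in_var_transport mor_app_transport proportional_transport. Qed.

Lemma map_mx_surj l l' (w : 'M[C]_(l, l')) : exists v, w = map_mx tau v.
Proof.
have [tau' _ tauK] := tau_bij; exists (map_mx tau' w).
by apply/matrixP => i j; rewrite !mxE tauK.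
Qed.

Lemma fibre_ge_transport d x : fibre_ge e2 f d (map_mx tau x) <-> fibre_ge e1 f d x.
Proof.
split=> [[Z]|[Z [Zx ZZ]]].
  have [Z' ->] := map_mx_surj Z => -[Zx ZZ]; exists Z'; split=> [i|i j /ZZ].
    by have := Zx i; rewrite -map_row over_transport.
  by rewrite -!map_row proportional_transport.
exists (map_mx tau Z); split=> [i|i j /ZZ]; first by rewrite -map_row over_transport.
by rewrite -!map_row proportional_transport.
Qed.

(** A polynomial vanishing on [S1] is carried by [tau] to one vanishing on
    [S2]. *)
Lemma zariski_closure_transport l (S1 S2 : set 'rV[C]_l) p :
  (forall v, S2 (map_mx tau v) <-> S1 v) ->
  zariski_closure S2 (map_mx tau p) -> zariski_closure S1 p.
Proof.
move=> S12 S2p F FS; apply: (fmorph_inj tau); rewrite rmorph0.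
have mapF (v : 'rV[C]_l) : meval ((map_mx tau v) 0) (map_mpoly tau F) = tau (meval (v 0) F).
  rewrite /meval /mmap (perm_big _ (msupp_map_mpoly _ (@fmorph_inj _ _ tau))) /= rmorph_sum.
  apply: eq_bigr => i _; rewrite mcoeff_map_mpoly rmorphM; congr (_ * _).
  by rewrite /mmap1 rmorph_prod; apply: eq_bigr => j _; rewrite rmorphXn mxE.
rewrite -mapF; apply: S2p => q; have [v ->] := map_mx_surj q => /S12 /FS Fv.
by rewrite mapF Fv rmorph0.
Qed.

Lemma cover_criterion_transport : cover_criterion e1 f -> cover_criterion e2 f.
Proof.
move=> [surj noncoll noncard]; split.
- move=> x; have [x' ->] := map_mx_surj x; rewrite in_var_transport => /surj[y yx].
  by exists (map_mx tau y); apply/over_transport.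
- move=> y; have [y' ->] := map_mx_surj y; rewrite in_var_transport => Yy'.
  move=> /closure_sub_zariski; rewrite -map_row_mx => cl; apply: (noncoll _ Yy').
  apply: zariski_sub_closure; first exact: constructible_collisions.
  apply: zariski_closure_transport cl => v; rewrite /collisions /=.
  rewrite -map_lsubmx -map_rsubmx in_var_transport mor_app_transport proportional_transport.
  by split=> -[Yl /over_transport lr nlr].
- move=> d x; have [x' ->] := map_mx_surj x.
  rewrite in_var_transport fibre_ge_transport => Xx' dx'.
  move=> /closure_sub_zariski cl; apply: (noncard _ _ Xx' dx').
  apply: zariski_sub_closure; first exact: constructible_small_fibres.
  apply: zariski_closure_transport cl => v; rewrite /small_fibres /=.
  by rewrite in_var_transport fibre_ge_transport.
Qed.

End Transport.

(** * Covers among the proper maps with finite fibres *)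

Section Covers.

Lemma nbhs_subtypeP (T : topologicalType) (A : set T) (x : A) (O : set A) :
  nbhs x O <-> exists2 V, nbhs (val x) V & forall z : A, V (val z) -> O z.
Proof.
split=> [|[V]].
  move=> [B [[V oV VB] Bx] BO]; exists V.
    by apply: open_nbhs_nbhs; split=> //; move: Bx; rewrite -VB.
  by move=> z Vz; apply: BO; rewrite -VB.
rewrite nbhsE => -[V' [oV' V'x] V'V] VO; exists (val @^-1` V'); split=> //.
  by exists V'.
by move=> z /V'V /VO.
Qed.

Context (W V : topologicalType) (f : W -> V).

Definition locally_injective := forall w : W, exists2 A, nbhs w A &
  forall a b, A a -> A b -> f a = f b -> a = b.

Definition fibre_card_ge d (v : V) :=
  exists2 g : 'I_d -> W, injective g & forall i, f (g i) = v.

Definition fibre_card_lsc := forall d (v : V), fibre_card_ge d v ->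
  \forall v' \near v, fibre_card_ge d v'.

Definition separated_points (T : topologicalType) := forall a b : T, a <> b ->
  exists A B, [/\ nbhs a A, nbhs b B & forall x, A x -> B x -> False].

(** For a map with finite fibres to be proper means that points over [v'] near
    [v] are near the fibre of [v]. *)
Definition finite_proper := forall v : V, exists d (g : 'I_d -> W),
  [/\ injective g, forall w, f w = v <-> exists i, g i = w &
      forall B : 'I_d -> set W, (forall i, nbhs (g i) (B i)) ->
        \forall v' \near v, forall w, f w = v' -> exists i, B i w].

Lemma cover_locally_injective : topological_cover f -> locally_injective.
Proof.
move=> [cf _ trivf] w; have [U [oU Uw] [F [phi [psi [cphi _ phiK _ phiE]]]]] := trivf (f w).
have fUw : w \in f @^-1` U by rewrite inE.
pose w' : f @^-1` U := exist _ w fUw.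
have : nbhs w' [set z | (phi z).2 = (phi w').2].
  apply: (cphi w' [set z | z.2 = (phi w').2]); exists (setT, [set (phi w').2]).
    by split; [exact: filterT | exact: discrete_set1].
  by move=> z [_].
move=> /nbhs_subtypeP[A wA AO]; exists (A `&` f @^-1` U).
  by apply: filterI => //; apply: cf; exact: open_nbhs_nbhs.
move=> a b [Aa Ua] [Ab Ub] fab.
have Ua' : a \in f @^-1` U by rewrite inE.
have Ub' : b \in f @^-1` U by rewrite inE.
pose a' : f @^-1` U := exist _ a Ua'; pose b' : f @^-1` U := exist _ b Ub'.
suff : a' = b' by move=> /(congr1 val).
rewrite -(phiK a') -(phiK b'); congr psi.
rewrite [LHS]surjective_pairing [RHS]surjective_pairing; congr (_, _).
  by apply: val_inj; rewrite !phiE.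
by rewrite (AO a' Aa) (AO b' Ab).
Qed.

Lemma cover_fibre_card_lsc : topological_cover f -> fibre_card_lsc.
Proof.
move=> [cf _ trivf] d v [g ginj gv].
have [U [oU Uv] [F [phi [psi [_ _ phiK psiK phiE]]]]] := trivf v.
apply: filterS (open_nbhs_nbhs (conj oU Uv)) => v' Uv'.
have Ug i : g i \in f @^-1` U by rewrite inE /= gv.
pose g' i : f @^-1` U := exist _ (g i) (Ug i).
have Uv'' : v' \in U by rewrite inE.
pose h i := psi (exist _ v' Uv'', (phi (g' i)).2).
exists (fun i => val (h i)) => [i j /val_inj/(congr1 phi)|i].
  rewrite !psiK => -[E]; apply: ginj.
  suff : g' i = g' j by move=> /(congr1 val).
  rewrite -(phiK (g' i)) -(phiK (g' j)); congr psi.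
  rewrite [LHS]surjective_pairing [RHS]surjective_pairing; congr (_, _) => //.
  by apply: val_inj; rewrite !phiE /= !gv.
by rewrite -phiE psiK.
Qed.

(** The points [g i] of the fibre of [v] have disjoint open neighbourhoods [N i]
    on which [f] is injective.  For [v'] in a suitable neighbourhood [U], the
    fibre is covered by the [N i], with at most one point in each of the [d]
    sets, and it has at least [d] points: thus it has exactly one in each.  A
    section [psi] over [U] is continuous because, again by properness, points
    over [v''] near [v'] are near the fibre of [v']. *)
Lemma finite_proper_cover : continuous f -> set_surj setT setT f ->
  separated_points W -> finite_proper -> locally_injective -> fibre_card_lsc ->
  topological_cover f.
Proof.
move=> cf sf sepW propf injf lscf; split=> // v.
have [d [g [ginj gP gB]]] := propf v.
have /choice[AB HAB] : forall ij : 'I_d * 'I_d, exists AB : set W * set W,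
    [/\ nbhs (g ij.1) AB.1, nbhs (g ij.2) AB.2 &
        ij.1 != ij.2 -> forall x, AB.1 x -> AB.2 x -> False].
  move=> [i j] /=; have [-> | ij] := eqVneq i j.
    by exists (setT, setT); split=> //; exact: filterT.
  have [|A [B [iA jB dAB]]] := sepW (g i) (g j); last by exists (A, B).
  by move=> /ginj/eqP; rewrite (negPf ij).
have /choice[I HI] : forall i, exists A, nbhs (g i) A /\
    forall a b, A a -> A b -> f a = f b -> a = b.
  by move=> i; have [A iA injA] := injf (g i); exists A.
pose M i : set W := [set w | I i w /\ forall j, (AB (i, j)).1 w /\ (AB (j, i)).2 w].
pose N i : set W := interior (M i).
have oN i : open (N i) by exact: open_interior.
have NM i w : N i w -> M i w by exact: nbhs_singleton.
have Ng i : nbhs (g i) (N i).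
  apply: open_nbhs_nbhs; split=> //; rewrite /N /interior /=.
  apply: filterI; first by case: (HI i).
  apply: filter_forall => j; apply: filterI.
    by case: (HAB (i, j)).
  by case: (HAB (j, i)).
have disjN i j w : N i w -> N j w -> i = j.
  move=> /NM[_ /(_ j)[Aw _]] /NM[_ /(_ i)[_ Bw]].
  apply/eqP; apply: contrapT => /negP ij.
  by have [_ _ /(_ ij w Aw Bw)] := HAB (i, j).
have injN i a b : N i a -> N i b -> f a = f b -> a = b.
  by move=> /NM[Ia _] /NM[Ib _]; case: (HI i) => _; apply.
pose U : set V := interior [set v' | (forall w, f w = v' -> exists i, N i w) /\ fibre_card_ge d v'].
have oU : open U by exact: open_interior.
have UP v' : U v' -> (forall w, f w = v' -> exists i, N i w) /\ fibre_card_ge d v'.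
  exact: nbhs_singleton.
have Uv : U v.
  apply: filterI; first exact: gB.
  by apply: lscf; exists g => // i; apply/gP; exists i.
have onto v' i : U v' -> exists w, N i w /\ f w = v'.
  move=> /UP[Nv' [h hinj hv']].
  have /choice[s hs] : forall j, exists l, N l (h j) by move=> j; exact: Nv'.
  have sinj : injective s.
    move=> j l sjl; apply: hinj; apply: (injN (s j)) => //; first by rewrite sjl.
    by rewrite !hv'.
  by exists (h (invF sinj i)); split=> //; have := hs (invF sinj i); rewrite f_invF.
exists U => //; exists (discrete_topology 'I_d).
have /choice[idx Hidx] : forall w : f @^-1` U, exists i, N i (val w).
  by case=> w /= /set_mem Uw; have [/(_ w erefl)] := UP _ Uw.
have /choice[psi0 Hpsi] : forall x : U * discrete_topology 'I_d, exists w,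
    N x.2 w /\ f w = val x.1.
  by case=> -[v' /= /set_mem Uv'] i; exact: onto.
have fU (w : f @^-1` U) : f (val w) \in U by case: w => w.
have psiU x : psi0 x \in f @^-1` U.
  by rewrite inE /=; have [_ ->] := Hpsi x; case: x => -[v' /= /set_mem].
pose phi (w : f @^-1` U) : U * discrete_topology 'I_d := (exist _ (f (val w)) (fU w), idx w).
pose psi x : f @^-1` U := exist _ (psi0 x) (psiU x).
exists phi, psi; split=> //.
- move=> w O [[A B] [/= /nbhs_subtypeP[V' V'w V'A] Bi] ABO].
  apply/nbhs_subtypeP; exists (f @^-1` V' `&` N (idx w)).
    apply: filterI; first exact: cf.
    by apply: open_nbhs_nbhs; split=> //; exact: Hidx.
  move=> z [V'z Nz]; apply: ABO; split=> /=; first exact: V'A.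
  by rewrite (disjN (idx z) (idx w) (val z)) //; exact: nbhs_singleton Bi.
- move=> x O /nbhs_subtypeP[O' O'x O'O].
  have [d' [g' [_ g'P g'B]]] := propf (val x.1).
  (* Over a nearby point, the point of N x.2 is in no other N l, so it is near
     psi0 x. *)
  pose B (j : 'I_d') : set W := if `[< g' j = psi0 x >] then O' else
    [set w | exists2 l, l <> x.2 & N l w].
  have [Npsi fpsi] := Hpsi x.
  have : \forall v' \near val x.1, forall w, f w = v' -> exists i, B i w.
    apply: g'B => j; rewrite /B; case: asboolP => [-> //|gjx].
    have fgj : f (g' j) = val x.1 by apply/g'P; exists j.
    have Ux : U (val x.1) by exact: (set_mem (valP x.1)).
    have [/(_ _ fgj)[l Nl] _] := UP _ Ux.
    have lx : l <> x.2.
      by move=> lx; apply: gjx; apply: (injN l) => //; [rewrite lx | rewrite fgj fpsi].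
    apply: (@filterS _ (nbhs (g' j)) _ (N l)); first by move=> w Nw; exists l.
    exact: open_nbhs_nbhs.
  move=> nearB.
  exists ([set z : U | forall w, f w = val z -> exists i, B i w], [set x.2]).
    split; last exact: discrete_set1.
    by apply/nbhs_subtypeP; exists [set v' | forall w, f w = v' -> exists i, B i w].
  move=> z [/= zB zi]; apply: O'O; have [Nz fz] := Hpsi z.
  have [j] := zB _ fz; rewrite /B; case: asboolP => // _ [l lx Nl].
  by case: lx; rewrite -zi; apply: disjN Nl Nz.
- move=> w; apply: val_inj => /=; have [Nw fw] := Hpsi (phi w).
  exact: (injN (idx w)).
- move=> x; have [Nx fx] := Hpsi x; rewrite [RHS]surjective_pairing; congr (_, _).
    exact: val_inj.
  by apply: disjN Nx; exact: (Hidx (psi x)).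
Qed.

End Covers.

(** * The topology of the set of points of a variety *)

Section RowTopology.
Context (C : numFieldType).

Lemma polymap_continuous N M (phi : 'rV[C]_N -> 'rV[C]_M) : polymap phi -> continuous phi.
Proof.
move=> pphi v A /nbhs_rowP[e e0 eA].
have : \forall u \near v, forall j : 'I_M, `|phi v 0 j - phi u 0 j| < e.
  apply: (@filter_forall _ _ (fun (j : 'I_M) (u : 'rV[C]_N) =>
    `|phi v 0 j - phi u 0 j| < e) (nbhs v) _) => j.
  exact: (near_small (polyfun_continuous (pphi j) (x := v)) e0).
by apply: filterS => u /eA.
Qed.

Lemma nbhs_polymap N M (phi : 'rV[C]_N -> 'rV[C]_M) v A : polymap phi ->
  nbhs (phi v) A -> nbhs v (phi @^-1` A).
Proof. by move=> /polymap_continuous; exact. Qed.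

Lemma polymap_id N : polymap (@id 'rV[C]_N).
Proof. by move=> i; exact: polyfun_coord. Qed.

Lemma polymap_scale N (a : C) : polymap (fun v : 'rV[C]_N => a *: v).
Proof.
move=> i; apply: polyfun_ext (polyfunM (polyfun_cst _ a) (polyfun_coord _ i)) => v.
by rewrite mxE.
Qed.

Lemma nbhs_row_mx N M (v : 'rV[C]_N) (w : 'rV[C]_M) (B : set 'rV[C]_(N + M)) :
  nbhs (row_mx v w) B -> exists2 A, nbhs v A & exists2 A', nbhs w A' &
    forall u u', A u -> A' u' -> B (row_mx u u').
Proof.
move=> /nbhs_rowP[e e0 eB].
exists [set u | forall i, `|v 0 i - u 0 i| < e]; first by apply/nbhs_rowP; exists e.
exists [set u | forall i, `|w 0 i - u 0 i| < e]; first by apply/nbhs_rowP; exists e.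
move=> u u' vu wu'; apply: eB => i; case: (splitP i) => j Dj.
  have -> : i = lshift M j by apply: val_inj.
  by rewrite !row_mxEl.
have -> : i = rshift N j by apply: val_inj.
by rewrite !row_mxEr.
Qed.

Lemma near_neq0 N (v : 'rV[C]_N) : v != 0 -> \forall u \near v, u != 0.
Proof.
move=> /rV0Pn[i vi]; have := near_small (polyfun_continuous (polyfun_coord C i) (x := v)).
move=> /(_ `|v 0 i|); rewrite normr_gt0 => /(_ vi); apply: filterS => u.
by apply: contraTneq => ->; rewrite mxE subr0 ltxx.
Qed.

Lemma near_not_proportional N (u v : 'rV[C]_N) : u != 0 -> v != 0 -> ~ (u == v)%MS ->
  exists2 A, nbhs u A & exists2 A', nbhs v A' &
    forall u' v', A u' -> A' v' -> ~ (u' == v')%MS.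
Proof.
move=> u0 v0 uv.
have [i [j ij]] : exists i j, u 0 i * v 0 j - u 0 j * v 0 i != 0.
  apply: contrapT => nij; apply: uv; apply/proportionalP => // i j.
  apply/eqP; rewrite -subr_eq0; apply/eqP; apply: contrapT => /eqP ij.
  by apply: nij; exists i, j.
pose h (w : 'rV[C]_(N + N)) := lsubmx w 0 i * rsubmx w 0 j - lsubmx w 0 j * rsubmx w 0 i.
have pl := @polymap_lsubmx C N N; have pr := @polymap_rsubmx C N N.
have ph : polyfun h.
  exact: polyfunB (polyfunM (pl i) (pr j)) (polyfunM (pl j) (pr i)).
have huv : h (row_mx u v) != 0 by rewrite /h row_mxKl row_mxKr.
have := near_small (polyfun_continuous ph (x := row_mx u v)).
move=> /(_ `|h (row_mx u v)|); rewrite normr_gt0 => /(_ huv)/nbhs_row_mx[A uA [A' vA' AA']].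
exists (A `&` [set u' | u' != 0]); first by apply: filterI => //; exact: near_neq0.
exists (A' `&` [set v' | v' != 0]); first by apply: filterI => //; exact: near_neq0.
move=> u' v' [Au' u'0] [Av' v'0] uv'; have := AA' u' v' Au' Av'.
rewrite /= /h !row_mxKl !row_mxKr.
by move/(proportionalP u'0 v'0): uv' => /(_ i j) ->; rewrite subrr subr0 ltxx.
Qed.

End RowTopology.

Section PointsTopology.
Local Open Scope quotient_scope.
Context (k : fieldType) (C : numFieldType) (e : {rmorphism k -> C}).
Context (l : nat) (Z : qpvar k l).

Lemma point_eqP u v (Zu : in_var e Z u) (Zv : in_var e Z v) :
  Defs.point Zu = Defs.point Zv <-> (u == v)%MS.
Proof.
split=> [/(congr1 val)/= /eqmodP//|uv].
by apply: val_inj; apply/eqmodP.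
Qed.

Lemma pointP (z : points e Z) : exists v (Zv : in_var e Z v), z = Defs.point Zv.
Proof.
have Zv : in_var e Z (proj_repr (val z)) by exact: (set_mem (valP z)).
exists (proj_repr (val z)), Zv; apply: val_inj => /=.
rewrite -[LHS]reprK; congr (\pi _); exact: val_inj.
Qed.

(** The projection from nonzero vectors to the projective space is open, since
    scalings are homeomorphisms; so neighbourhoods of a point can be read on
    any vector of homogeneous coordinates. *)
Lemma nbhs_pointP v (Zv : in_var e Z v) (O : set (points e Z)) :
  nbhs (Defs.point Zv) O <-> \forall u \near v, forall Zu : in_var e Z u, O (Defs.point Zu).
Proof.
pose nz (u : 'rV[C]_l.+1) (u0 : u != 0) : @nzvec C l := exist _ u (mem_set u0).
split.
  move=> /nbhs_subtypeP[V vV VO].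
  have /nbhs_subtypeP[A vA AV] :=
    @pi_continuous _ {eq_quot (@proj_equiv C l)} (nz v (in_var_neq0 Zv)) _ vV.
  apply: filterS vA => u Au Zu; apply: VO.
  exact: (AV (nz u (in_var_neq0 Zu))).
rewrite /prop_near1 nbhsE => -[A [oA Av] AO]; apply/nbhs_subtypeP.
exists [set q | exists u (u0 : u != 0), A u /\ q = proj_class u0]; last first.
  move=> z [u [u0 [Au zu]]].
  have Zu : in_var e Z u.
    have : in_var e Z (proj_repr (val z)) by exact: (set_mem (valP z)).
    by rewrite zu (in_var_proj _ _ (proj_repr_neq0 _) (proj_classK _)).
  have -> : z = Defs.point Zu by apply: val_inj; rewrite zu; apply/eqmodP; exact: proportional_refl.
  exact: AO.
apply: open_nbhs_nbhs; split; last by exists v, (in_var_neq0 Zv).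
rewrite /open /= /quotient_open openE => z [u [u0 [Au zu]]].
have zu' : (u == val z)%MS.
  by rewrite proportional_sym; move/eqmodP: zu.
have [a a0 ua] := projP u0 zu'.
apply/nbhs_subtypeP; exists [set x | A (a *: x)].
  apply: (nbhs_polymap (polymap_scale a)).
  by apply: open_nbhs_nbhs; split=> //; rewrite -ua.
move=> x Ax; have x0 : val x != 0 by exact: (set_mem (valP x)).
have ax0 : a *: val x != 0 by rewrite scaler_eq0 negb_or a0.
exists (a *: val x), ax0; split=> //; apply/eqmodP; rewrite /= /proj_rel /=.
by rewrite proportional_sym; exact: scale_proportional.
Qed.

Lemma separated_points_var : separated_points (points e Z).
Proof.
move=> a b; have [u [Zu ->]] := pointP a; have [v [Zv ->]] := pointP b => /point_eqP uv.
have [A uA [A' vA' AA']] := near_not_proportional (in_var_neq0 Zu) (in_var_neq0 Zv) uv.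
exists [set z | exists w (Zw : in_var e Z w), A w /\ z = Defs.point Zw],
       [set z | exists w (Zw : in_var e Z w), A' w /\ z = Defs.point Zw].
split; [apply/nbhs_pointP | apply/nbhs_pointP |].
- by apply: filterS uA => w Aw Zw; exists w, Zw.
- by apply: filterS vA' => w Aw Zw; exists w, Zw.
move=> z [w [Zw [Aw ->]]] [w' [Zw' [Aw' /point_eqP ww']]].
exact: AA' Aw Aw' ww'.
Qed.

End PointsTopology.

Section CoverCriterion.
Context (k : fieldType) (C : numClosedFieldType) (e : {rmorphism k -> C}).
Context (n m : nat) (Y : qpvar k n) (X : qpvar k m) (f : morphism Y X).

Lemma points_map_continuous : continuous (points_map e f).
Proof.
move=> z; have [v [Yv ->]] := pointP z; move=> O.
rewrite /= points_mapE => /nbhs_pointP nearO; apply/nbhs_pointP.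
have [c cf [cv cE]] := mor_appP f Yv.
have pc : polymap (fun u : 'rV[C]_n.+1 => mxev e c u).
  by apply: polymap_mxev; exact: polymap_id.
rewrite cE in nearO; have nearcO := nbhs_polymap pc nearO.
have nearc := nbhs_polymap pc (near_neq0 cv).
apply: filterS (filterI nearcO nearc) => u [/= cO cu] Yu.
rewrite points_mapE; have Xcu := mor_into Yu cf cu.
suff -> : Defs.point (mor_app_in f Yu) = Defs.point Xcu by exact: cO.
apply/point_eqP; have [c' c'f [c'u ->]] := mor_appP f Yu.
exact: mor_glue Yu c'f cf c'u cu.
Qed.

Lemma over_pointP y x (Yy : in_var e Y y) (Xx : in_var e X x) :
  lies_over e f y x <-> points_map e f (Defs.point Yy) = Defs.point Xx.
Proof.
rewrite points_mapE; split=> [[_ yx]|/point_eqP yx]; last by split.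
exact/point_eqP.
Qed.

Lemma fibre_ge_pointP d x (Xx : in_var e X x) :
  fibre_ge e f d x <-> fibre_card_ge (points_map e f) d (Defs.point Xx).
Proof.
split=> [[Z [Zx ZZ]]|[g ginj gx]].
  have Yi i : in_var e Y (row i Z) by case: (Zx i).
  exists (fun i => Defs.point (Yi i)) => [i j /point_eqP ij|i]; last exact/over_pointP.
  by apply/eqP; apply: contrapT => /negP/ZZ.
have /choice[h Dh] : forall i, exists v, exists Yv : in_var e Y v, g i = Defs.point Yv.
  by move=> i; have [v [Yv Dg]] := pointP (g i); exists v, Yv.
exists (\matrix_i h i); split=> [i|i j ij]; rewrite !rowK.
  by have [Yv Dg] := Dh i; apply/(over_pointP Yv Xx); rewrite -Dg.
have [Yi Di] := Dh i; have [Yj Dj] := Dh j => /(point_eqP Yi Yj).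
by rewrite -Di -Dj => /ginj/eqP; rewrite (negPf ij).
Qed.

(** [finite_proper] for the map on points, in homogeneous coordinates. *)
Definition finite_over_points : Prop := forall x, in_var e X x ->
  exists d (g : 'I_d -> 'rV[C]_n.+1),
    [/\ forall i, lies_over e f (g i) x,
        forall i j, i != j -> ~ (g i == g j)%MS,
        forall y, lies_over e f y x -> exists i, (g i == y)%MS &
        forall B : 'I_d -> set 'rV[C]_n.+1, (forall i, nbhs (g i) (B i)) ->
          \forall x' \near x, forall y, lies_over e f y x' ->
            exists i, exists2 y', (y == y')%MS & B i y'].

Lemma finite_over_points_proper : finite_over_points -> finite_proper (points_map e f).
Proof.
move=> fin p; have [x [Xx ->]] := pointP p.
have [d [g [gx gg gall gB]]] := fin x Xx; exists d.
have Yg i : in_var e Y (g i) by case: (gx i).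
exists (fun i => Defs.point (Yg i)); split.
- move=> i j /point_eqP ij; apply/eqP; apply: contrapT => /negP/gg; exact.
- move=> w; split=> [|[i <-]]; last exact/over_pointP.
  have [y [Yy ->]] := pointP w => /over_pointP/gall[i iy]; exists i.
  exact/point_eqP.
move=> B nearB; apply/nbhs_pointP.
have nB i : nbhs (g i) [set u | forall Yu : in_var e Y u, B i (Defs.point Yu)].
  exact/nbhs_pointP/nearB.
apply: filterS (gB _ nB) => x' Hx' Xx' w.
have [y [Yy ->]] := pointP w => /over_pointP/Hx'[i [y' yy' By']]; exists i.
have y0 := in_var_neq0 Yy.
have Yy' : in_var e Y y' by rewrite -(in_var_proj _ _ y0 yy').
have -> : Defs.point Yy = Defs.point Yy' by apply/point_eqP.
exact: By'.
Qed.

(** Not being in the closure of [collisions] is local injectivity, and not being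
    in the closure of [small_fibres] is the semicontinuity of the cardinality
    of fibres; both hold for covers. *)
Theorem cover_criterionP : finite_over_points ->
  topological_cover (points_map e f) <-> cover_criterion e f.
Proof.
move=> fin; split=> [cov|[surj noncoll noncard]].
  split.
  - move=> x Xx; have [_ /(_ (Defs.point Xx) I)[w _ wx] _] := cov.
    have [y [Yy Dw]] := pointP w; exists y.
    by apply/(over_pointP Yy Xx); rewrite -Dw.
  - move=> y Yy; have [A] := cover_locally_injective cov (Defs.point Yy).
    move=> /nbhs_pointP nearA injA clA.
    have pl := @polymap_lsubmx C n.+1 n.+1; have pr := @polymap_rsubmx C n.+1 n.+1.
    pose D : set 'rV[C]_n.+1 := [set u | forall Yu : in_var e Y u, A (Defs.point Yu)].
    have nl : nbhs (row_mx y y) [set u | D (lsubmx u)].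
      by apply: (nbhs_polymap pl); rewrite row_mxKl.
    have nr : nbhs (row_mx y y) [set u | D (rsubmx u)].
      by apply: (nbhs_polymap pr); rewrite row_mxKr.
    have [u [[Yl lr nlr] [/= Dl Dr]]] := clA _ (filterI nl nr).
    have Yr : in_var e Y (rsubmx u) by case: lr.
    apply: nlr; apply/(point_eqP Yl Yr); apply: injA; [exact: Dl | exact: Dr |].
    by rewrite [LHS]points_mapE; apply/esym/(over_pointP Yr (mor_app_in f Yl)).
  - move=> d x Xx /(fibre_ge_pointP _ Xx)/(cover_fibre_card_lsc cov)/nbhs_pointP nearx.
    by move=> /(_ _ nearx)[x' [[Xx' nx'] Hx']]; apply: nx'; apply/fibre_ge_pointP/Hx'.
apply: finite_proper_cover.
- exact: points_map_continuous.
- move=> p _; have [x [Xx ->]] := pointP p; have [y yx] := surj x Xx.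
  have Yy : in_var e Y y by case: yx.
  by exists (Defs.point Yy) => //; apply/over_pointP.
- exact: separated_points_var.
- exact: finite_over_points_proper.
- move=> w; have [y [Yy ->]] := pointP w.
  have [B nB Bcoll] : exists2 B, nbhs (row_mx y y) B & forall u, B u -> ~ collisions e f u.
    apply: contrapT => nB; apply: (noncoll y Yy) => B yB.
    apply: contrapT => BS; apply: nB; exists B => // u Bu Su; apply: BS; by exists u.
  have [A yA [A' yA' AA']] := nbhs_row_mx nB.
  exists [set z | exists u (Yu : in_var e Y u), (A `&` A') u /\ z = Defs.point Yu].
    by apply/nbhs_pointP; apply: filterS (filterI yA yA') => u Au Yu; exists u, Yu.
  move=> a b [u [Yu [[Au _] ->]]] [v [Yv [[_ Av] ->]]] uv.
  apply/point_eqP; apply: contrapT => nuv; apply: (Bcoll _ (AA' u v Au Av)).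
  rewrite /collisions /= row_mxKl row_mxKr; split=> //.
  by apply/(over_pointP Yv (mor_app_in f Yu)); rewrite -uv points_mapE.
- move=> d p; have [x [Xx ->]] := pointP p => /fibre_ge_pointP xd.
  have [B nB Bsmall] : exists2 B, nbhs x B & forall x', B x' -> ~ small_fibres e f d x'.
    apply: contrapT => nB; apply: (noncard d x Xx xd) => B xB.
    apply: contrapT => BS; apply: nB; exists B => // u Bu Su; apply: BS; by exists u.
  apply/nbhs_pointP; apply: filterS nB => x' /Bsmall nx' Xx'; apply/fibre_ge_pointP.
  by apply: contrapT => nd; apply: nx'.
Qed.

End CoverCriterion.

(** * Finite morphisms on points *)

Section RegularFunctions.
Context (k : fieldType).

Lemma mevM (L : fieldType) (e : {rmorphism k -> L}) n (p q : mpoly n k) v :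
  mev e (p * q) v = mev e p v * mev e q v.
Proof. exact: rmorphM. Qed.

Lemma mev1 (L : fieldType) (e : {rmorphism k -> L}) n v : mev e (1 : mpoly n k) v = 1.
Proof. exact: rmorph1. Qed.

Lemma mev_coord (L : fieldType) (e : {rmorphism k -> L}) n i (v : 'rV[L]_n) :
  mev e (mpolyX k (mnm1 i)) v = v 0 i.
Proof. by rewrite /mev mmapX mmap1U. Qed.

Section Operations.
Context (n : nat) (X : qpvar k n).

Lemma rf_appP (L : fieldType) (e : {rmorphism k -> L}) (h : regfun X) v c :
  in_var e X v -> c \in rf_charts h -> mev e c.2 v != 0 ->
  rf_app e h v = mev e c.1 v / mev e c.2 v.
Proof.
move=> Xv ch cv; rewrite /rf_app.
have : c \in [seq c <- rf_charts h | mev e c.2 v != 0] by rewrite mem_filter cv.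
case E : [seq c <- rf_charts h | mev e c.2 v != 0] => [//|d s] _ /=.
have : d \in [seq c <- rf_charts h | mev e c.2 v != 0] by rewrite E mem_head.
by rewrite mem_filter => /andP[dv dh]; exact: rf_glue Xv dh ch dv cv.
Qed.

Lemma rf_app_proj (L : fieldType) (e : {rmorphism k -> L}) (h : regfun X) u v :
  in_var e X u -> (u == v)%MS -> rf_app e h u = rf_app e h v.
Proof.
move=> Xu uv; have u0 := in_var_neq0 Xu.
have Xv : in_var e X v by rewrite -(in_var_proj _ _ u0 uv).
have [c ch cu] := rf_cover h Xu; have [a a0 Du] := projP u0 uv.
have [d [c1 c2]] := rf_homog ch.
have cv : mev e c.2 v != 0.
  by move: cu; rewrite Du (mev_scale _ _ _ c2) mulf_eq0 negb_or => /andP[].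
rewrite (rf_appP Xu ch cu) (rf_appP Xv ch cv) Du (mev_scale _ _ _ c1) (mev_scale _ _ _ c2).
by rewrite -mulf_div divff ?mul1r // expf_neq0.
Qed.

Section Product.
Context (g h : regfun X).
Let charts := [seq (c.1 * d.1, c.2 * d.2) | c <- rf_charts g, d <- rf_charts h].

Fact rf_mul_homog c : c \in charts ->
  exists d, c.1 \is ishomog1 d mdeg /\ c.2 \is ishomog1 d mdeg.
Proof.
move=> /allpairsP[[a b] [/= /rf_homog[da [a1 a2]] /rf_homog[db [b1 b2]] ->]].
by exists (da + db)%N; split; apply: dhomogM.
Qed.

Fact rf_mul_cover (L : fieldType) (e : {rmorphism k -> L}) v :
  in_var e X v -> exists2 c, c \in charts & mev e c.2 v != 0.
Proof.
move=> Xv; have [a ag av] := rf_cover g Xv; have [b bh bv] := rf_cover h Xv.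
exists (a.1 * b.1, a.2 * b.2); first by apply/allpairsP; exists (a, b).
by rewrite mevM mulf_neq0.
Qed.

Fact rf_mul_value (L : fieldType) (e : {rmorphism k -> L}) v c :
  in_var e X v -> c \in charts -> mev e c.2 v != 0 ->
  mev e c.1 v / mev e c.2 v = rf_app e g v * rf_app e h v.
Proof.
move=> Xv /allpairsP[[a b] [/= ag bh ->]] /=; rewrite !mevM mulf_eq0 negb_or => /andP[av bv].
by rewrite -mulf_div (rf_appP Xv ag av) (rf_appP Xv bh bv).
Qed.

Fact rf_mul_glue (L : fieldType) (e : {rmorphism k -> L}) v c d :
  in_var e X v -> c \in charts -> d \in charts ->
  mev e c.2 v != 0 -> mev e d.2 v != 0 ->
  mev e c.1 v / mev e c.2 v = mev e d.1 v / mev e d.2 v.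
Proof. by move=> Xv cc dc cv dv; rewrite !rf_mul_value. Qed.

Definition rf_mul : regfun X := RegFun rf_mul_homog rf_mul_cover rf_mul_glue.

Lemma rf_mulE (L : fieldType) (e : {rmorphism k -> L}) v : in_var e X v ->
  rf_app e rf_mul v = rf_app e g v * rf_app e h v.
Proof.
move=> Xv; have [c cc cv] := rf_mul_cover Xv.
by rewrite (rf_appP (h := rf_mul) Xv cc cv) rf_mul_value.
Qed.

End Product.

Fact rf_one_homog (c : mpoly n.+1 k * mpoly n.+1 k) : c \in [:: (1, 1)] ->
  exists d, c.1 \is ishomog1 d mdeg /\ c.2 \is ishomog1 d mdeg.
Proof. by rewrite inE => /eqP ->; exists 0%N; split; apply: dhomog1. Qed.

Fact rf_one_cover (L : fieldType) (e : {rmorphism k -> L}) v : in_var e X v ->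
  exists2 c : mpoly n.+1 k * mpoly n.+1 k, c \in [:: (1, 1)] & mev e c.2 v != 0.
Proof. by move=> _; exists (1, 1); rewrite ?mem_head //= mev1 oner_neq0. Qed.

Fact rf_one_glue (L : fieldType) (e : {rmorphism k -> L}) v
    (c d : mpoly n.+1 k * mpoly n.+1 k) :
  in_var e X v -> c \in [:: (1, 1)] -> d \in [:: (1, 1)] ->
  mev e c.2 v != 0 -> mev e d.2 v != 0 ->
  mev e c.1 v / mev e c.2 v = mev e d.1 v / mev e d.2 v.
Proof. by rewrite !inE => _ /eqP-> /eqP->. Qed.

Definition rf_one : regfun X := RegFun rf_one_homog rf_one_cover rf_one_glue.

Lemma rf_oneE (L : fieldType) (e : {rmorphism k -> L}) v : in_var e X v ->
  rf_app e rf_one v = 1.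
Proof.
move=> Xv; have [c cc cv] := rf_one_cover Xv.
rewrite (rf_appP (h := rf_one) Xv cc cv).
by move: cc; rewrite inE => /eqP -> /=; rewrite mev1 divr1.
Qed.

End Operations.

Section Coordinates.
Context (n N : nat) (U : qpvar k n) (Z : qpvar k N) (alpha : morphism U Z).
Context (chartZ : qp_neqs Z = [:: mpolyX k (mnm1 ord0)]).

Lemma affine_neq0 (L : fieldType) (e : {rmorphism k -> L}) v : in_var e Z v -> v 0 0 != 0.
Proof. by rewrite /in_var chartZ /= orbF mev_coord => /and3P[]. Qed.

Context (i : 'I_N.+1).
(** The affine coordinate ['X_i / 'X_0], pulled back to [U]. *)
Let charts := [seq (c 0 i, c 0 0) | c : 'rV[mpoly n.+1 k]_N.+1 <- mor_charts alpha].

Fact rf_coord_homog c : c \in charts ->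
  exists d, c.1 \is ishomog1 d mdeg /\ c.2 \is ishomog1 d mdeg.
Proof. by move=> /mapP[b /mor_homog[d hb] ->]; exists d; split; exact: hb. Qed.

Fact rf_coord_cover (L : fieldType) (e : {rmorphism k -> L}) v :
  in_var e U v -> exists2 c, c \in charts & mev e c.2 v != 0.
Proof.
move=> Uv; have [c cf cv] := mor_cover alpha Uv.
exists (c 0 i, c 0 0); first by apply/mapP; exists c.
by have := affine_neq0 (mor_into Uv cf cv); rewrite mxE.
Qed.

Fact rf_coord_value (L : fieldType) (e : {rmorphism k -> L}) v c :
  in_var e U v -> c \in charts -> mev e c.2 v != 0 ->
  mev e c.1 v / mev e c.2 v = mor_app e alpha v 0 i / mor_app e alpha v 0 0.
Proof.
move=> Uv /mapP[b bf ->] /= b0v; have [b' b'f [b'v ->]] := mor_appP alpha Uv.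
have bv : mxev e b v != 0 by apply/rV0Pn; exists 0; rewrite mxE.
have [a a0 E] := projP bv (mor_glue Uv bf b'f bv b'v).
have := congr1 (fun w : 'rV[L]_N.+1 => w 0 i) E; have := congr1 (fun w : 'rV[L]_N.+1 => w 0 0) E.
rewrite !mxE => -> ->; by rewrite -mulf_div divff ?mul1r.
Qed.

Fact rf_coord_glue (L : fieldType) (e : {rmorphism k -> L}) v c d :
  in_var e U v -> c \in charts -> d \in charts ->
  mev e c.2 v != 0 -> mev e d.2 v != 0 ->
  mev e c.1 v / mev e c.2 v = mev e d.1 v / mev e d.2 v.
Proof. by move=> Uv cc dc cv dv; rewrite !rf_coord_value. Qed.

Definition rf_coord : regfun U := RegFun rf_coord_homog rf_coord_cover rf_coord_glue.

Lemma rf_coordE (L : fieldType) (e : {rmorphism k -> L}) v : in_var e U v ->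
  rf_app e rf_coord v = mor_app e alpha v 0 i / mor_app e alpha v 0 0.
Proof.
move=> Uv; have [c cc cv] := rf_coord_cover Uv.
by rewrite (rf_appP (h := rf_coord) Uv cc cv) rf_coord_value.
Qed.

End Coordinates.
End RegularFunctions.

Section Integrality.
Context (k : fieldType) (n m : nat) (Y : qpvar k n) (X : qpvar k m) (f : morphism Y X).
Context (U : qpvar k n) (V : qpvar k m).

(** Multiplication by [h] on the module generated by the [g j] has a matrix [A]
    over the base.  At a point [u], the values of the [g j] form an eigenvector
    for the eigenvalue [h] of the matrix of values; it is nonzero because the
    function 1 is a combination of the [g j]. *)
Lemma finite_over_eigenvalue (h : regfun U) : finite_over f U V ->
  exists r (A : 'I_r -> 'I_r -> regfun V), forall (L : fieldType) (e : {rmorphism k -> L}) u x,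
    in_var e U u -> in_var e V (mor_app e f u) -> (mor_app e f u == x)%MS ->
    root (char_poly (\matrix_(i, j) rf_app e (A i j) x)) (rf_app e h u).
Proof.
move=> [gs gsP]; pose r := size gs; pose g (j : 'I_r) := nth (rf_one U) gs j.
have comb (h' : regfun U) : exists a : 'I_r -> regfun V,
    forall (L : fieldType) (e : {rmorphism k -> L}) u, in_var e U u ->
      rf_app e h' u = \sum_(j < r) rf_app e (a j) (mor_app e f u) * rf_app e (g j) u.
  have [az saz azP] := gsP h'; exists (fun j => nth (rf_one V) az j) => L e u Uu.
  rewrite (azP _ _ _ Uu) (big_nth (rf_one V, rf_one U)) size_zip saz minnn big_mkord.
  by apply: eq_bigr => j _; rewrite nth_zip.
have [b bP] := comb (rf_one U).
have /choice[a aP] := fun j : 'I_r => comb (rf_mul h (g j)).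
exists r, (fun i j => a j i) => L e u x Uu Vfu fux.
rewrite -eigenvalue_root_char; apply/eigenvalueP.
exists (\row_j rf_app e (g j) u).
  apply/rowP => j; rewrite !mxE -rf_mulE // aP //; apply: eq_bigr => i _.
  by rewrite !mxE mulrC; congr (_ * _); apply/esym; exact: rf_app_proj.
apply/negP => /eqP/rowP g0; have := bP _ _ _ Uu; rewrite rf_oneE // big1.
  by move/eqP; rewrite oner_eq0.
by move=> j _; have := g0 j; rewrite !mxE => ->; rewrite mulr0.
Qed.

End Integrality.

Section Continuity.
Context (C : numClosedFieldType).

(** The coefficients of the characteristic polynomial are polynomials in the
    entries of the matrix, those of the generic matrix [G]. *)
Lemma char_poly_continuous r (A : 'M[C]_r) (eps : C) : 0 < eps ->
  exists2 d : C, 0 < d & forall B : 'M[C]_r, (forall i j, `|A i j - B i j| < d) ->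
    forall l, `|(char_poly A)`_l - (char_poly B)`_l| < eps.
Proof.
move=> eps0; pose G : 'M[mpoly (r * r) C]_r := \matrix_(i, j) mpolyX C (mnm1 (mxvec_index i j)).
have GE (B : 'M[C]_r) : char_poly B = map_poly (meval (mxvec B 0)) (char_poly G).
  rewrite map_char_poly; congr char_poly; apply/matrixP => i j.
  by rewrite !mxE /= mevalXU mxvecE.
have : \forall w \near mxvec A, forall l : 'I_(size (char_poly G)),
    `|meval (mxvec A 0) (char_poly G)`_l - meval ((w : 'rV[C]_(r * r)) 0) (char_poly G)`_l| < eps.
  apply: (@filter_forall _ _ (fun (l : 'I_(size (char_poly G))) (w : 'rV[C]_(r * r)) =>
    `|meval (mxvec A 0) (char_poly G)`_l - meval (w 0) (char_poly G)`_l| < eps) (nbhs (mxvec A)) _) => l.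
  exact: (near_small (polyfun_continuous (polyfun_meval (char_poly G)`_l) (x := mxvec A)) eps0).
move=> /nbhs_rowP[d d0 dP]; exists d => // B AB l.
have [lG|Gl] := ltnP l (size (char_poly G)).
  rewrite !GE !coef_map; apply: (dP (mxvec B) _ (Ordinal lG)) => i.
  by case/mxvec_indexP: i => i j; rewrite !mxvecE.
by rewrite !GE !nth_default ?subrr ?normr0 // (leq_trans (size_poly _ _)).
Qed.

Context (k : fieldType) (e : {rmorphism k -> C}).

Lemma rf_app_continuous n (X : qpvar k n) (h : regfun X) x (eps : C) : in_var e X x -> 0 < eps ->
  \forall x' \near x, in_var e X x' -> `|rf_app e h x - rf_app e h x'| < eps.
Proof.
move=> Xx eps0; have [c ch cx] := rf_cover h Xx.
have pc (p : mpoly n.+1 k) : continuous (fun v : 'rV[C]_n.+1 => mev e p v).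
  by apply: polyfun_continuous; apply: polyfun_mev; exact: polymap_id.
have cdiv : continuous_at x (fun v => mev e c.1 v / mev e c.2 v).
  exact: (cvgM (pc _ x) (cvgV cx (pc _ x))).
have near0 : \forall x' \near x, mev e c.2 x' != 0.
  have c0 : 0 < `|mev e c.2 x| by rewrite normr_gt0.
  have := near_small (pc c.2 x) c0; apply: filterS => v.
  by apply: contraTneq => ->; rewrite subr0 ltxx.
apply: filterS (filterI near0 (near_small cdiv eps0)) => x' [cx' small] Xx'.
by rewrite (rf_appP Xx ch cx) (rf_appP Xx' ch cx').
Qed.

End Continuity.

Section FiniteMorphism.
Context (k : fieldType) (C : numClosedFieldType) (e : {rmorphism k -> C}).
Context (n m : nat) (Y : qpvar k n) (X : qpvar k m) (f : morphism Y X).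

Lemma mor_app_chart (l l' : nat) (Z : qpvar k l) (Z' : qpvar k l') (g : morphism Z Z') v c :
  in_var e Z v -> c \in mor_charts g -> mxev e c v != 0 -> (mor_app e g v == mxev e c v)%MS.
Proof.
move=> Zv cg cv; have [d dg [dv ->]] := mor_appP g Zv; exact: mor_glue Zv dg cg dv cv.
Qed.

Lemma near_open_subvar (V : qpvar k m) x : open_subvar V X -> in_var e V x ->
  \forall x' \near x, in_var e X x' -> in_var e V x'.
Proof.
move=> [hs _ VE]; rewrite VE => /andP[_ /hasP[h hhs hx]].
have h0 : 0 < `|mev e h x| by rewrite normr_gt0.
have ch := polyfun_continuous (polyfun_mev e h (@polymap_id C m.+1)) (x := x).
apply: filterS (near_small ch h0) => x' hx' Xx'; rewrite VE Xx' /=.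
apply/hasP; exists h => //; apply: contraTneq hx' => /= ->.
by rewrite subr0 ltxx.
Qed.

Lemma near_eigenvalues (V : qpvar k m) r (A : 'I_r -> 'I_r -> regfun V) x (eps : C) :
  in_var e V x -> 0 < eps ->
  \forall x' \near x, in_var e V x' ->
    forall t, root (char_poly (\matrix_(i, j) rf_app e (A i j) x')) t ->
    exists2 t0, root (char_poly (\matrix_(i, j) rf_app e (A i j) x)) t0 & `|t0 - t| < eps.
Proof.
move=> Vx eps0; set M := fun x' => \matrix_(i, j) rf_app e (A i j) x'.
have [dl dl0 Hdl] := monic_roots_continuous (char_poly_monic (M x)) eps0.
have [d d0 Hd] := char_poly_continuous (M x) dl0.
have : \forall x' \near x, forall ij : 'I_r * 'I_r, in_var e V x' ->
    `|rf_app e (A ij.1 ij.2) x - rf_app e (A ij.1 ij.2) x'| < d.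
  apply: (@filter_forall _ _ (fun (ij : 'I_r * 'I_r) (x' : 'rV[C]_m.+1) => in_var e V x' ->
    `|rf_app e (A ij.1 ij.2) x - rf_app e (A ij.1 ij.2) x'| < d) (nbhs x) _) => ij.
  exact: rf_app_continuous.
apply: filterS => x' Hx' Vx' t; apply: Hdl.
- exact: char_poly_monic.
- by rewrite !size_char_poly.
- by apply: Hd => i j; rewrite !mxE; exact: (Hx' (i, j)).
Qed.

(** On an affine neighbourhood, the coordinates [z u] of a point [u] are roots of
    characteristic polynomials that depend continuously on the image of [u].
    So above [x] they take finitely many values [E i], and above [x'] near [x]
    they are near these values.  The [E i] that come from the fibre of [x] are
    kept in [s]; the other ones are not even limits of coordinates of points
    above points that tend to [x], since the affine variety is closed and
    distinct points of the projective space can be separated. *)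
Theorem finite_morphism_points : finite_morphism f -> finite_over_points e f.
Proof.
move=> fin x Xx.
have [V [U [openV Vx UE [_ [N [Z [chartZ [alpha [beta [betaK alphaK]]]]]]] finUV]]] := fin C e x Xx.
pose z (u : 'rV[C]_n.+1) : 'rV[C]_N.+1 := \row_i rf_app e (rf_coord alpha chartZ i) u.
have z_alpha u : in_var e U u -> in_var e Z (z u) /\ (z u == mor_app e alpha u)%MS.
  move=> Uu; have Za := mor_app_in alpha Uu; have a0 := affine_neq0 chartZ Za.
  have Dz : z u = (mor_app e alpha u 0 0)^-1 *: mor_app e alpha u.
    by apply/rowP => i; rewrite !mxE rf_coordE // mulrC.
  have za : (z u == mor_app e alpha u)%MS.
    by rewrite Dz; apply: scale_proportional; rewrite invr_eq0.
  split=> //; rewrite -(in_var_proj _ _ (in_var_neq0 Za) (_ : _ == z u)%MS) //.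
  by rewrite proportional_sym.
have z1 u : in_var e U u -> z u 0 0 = 1.
  move=> Uu; have a0 := affine_neq0 chartZ (mor_app_in alpha Uu).
  by rewrite mxE rf_coordE // divff.
have betaz u : in_var e U u -> (mor_app e beta (z u) == u)%MS.
  move=> Uu; have [Zz za] := z_alpha u Uu.
  exact: proportional_trans (mor_app_proj beta Zz za) (betaK _ _ _ Uu).
have YU y : in_var e U y -> in_var e Y y by rewrite UE => /andP[].
have UP y x' : lies_over e f y x' -> in_var e V x' -> in_var e U y /\ in_var e V (mor_app e f y).
  move=> [Yy yx'] Vx'; have fy0 := in_var_neq0 (mor_app_in f Yy).
  by rewrite UE Yy (in_var_proj _ _ fy0 yx').
have /choice[p pP] : forall i : 'I_N.+1, exists p : 'rV[C]_m.+1 -> {poly C},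
    [/\ p x \is monic, forall u x', in_var e U u -> in_var e V (mor_app e f u) ->
        (mor_app e f u == x')%MS -> root (p x') (z u 0 i) &
        forall eps : C, 0 < eps -> \forall x' \near x, in_var e V x' ->
          forall t, root (p x') t -> exists2 t0, root (p x) t0 & `|t0 - t| < eps].
  move=> i; have [r [A AP]] := finite_over_eigenvalue (rf_coord alpha chartZ i) finUV.
  exists (fun x' => char_poly (\matrix_(i, j) rf_app e (A i j) x')); split.
  - exact: char_poly_monic.
  - by move=> u x' Uu Vu ux'; rewrite mxE; exact: AP.
  - by move=> eps eps0; exact: near_eigenvalues.
have /choice[rt rtP] : forall i, exists s : seq C, forall t, root (p i x) t -> t \in s.
  move=> i; have [p1 _ _] := pP i; have [s Ds _] := monic_prod_roots p1; exists s => t.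
  by rewrite Ds root_prod_XsubC.
have [I [E EP]] := finite_box rt.
pose good (v : 'rV[C]_N.+1) := [/\ v 0 0 = 1, in_var e Z v & lies_over e f (mor_app e beta v) x].
pose s := undup [seq v <- [seq E i | i <- enum I] | `[< good v >]].
have sP v : v \in s <-> good v /\ exists i, E i = v.
  rewrite mem_undup mem_filter; split=> [/andP[/asboolP gv /mapP[i _ Ei]]|[gv [i Ei]]].
    by split=> //; exists i.
  by apply/andP; split; [exact/asboolP | apply/mapP; exists i; rewrite ?mem_enum].
pose g (j : 'I_(size s)) := mor_app e beta (nth 0 s j).
have sg (j : 'I_(size s)) : good (nth 0 s j).
  by case: ((sP (nth 0 s j)).1 (mem_nth 0 (ltn_ord j))).
exists (size s), g; split.
- by move=> j; have [] := sg j.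
- move=> i j ij gij; have [i1 Zi _] := sg i; have [j1 Zj _] := sg j.
  have /(projP (in_var_neq0 Zi))[a a0 Da] : (nth 0 s i == nth 0 s j)%MS.
    have ai := alphaK _ _ _ Zi; have aj := alphaK _ _ _ Zj.
    rewrite proportional_sym in ai; apply: proportional_trans ai _.
    apply: proportional_trans aj; apply: mor_app_proj gij.
    exact: mor_app_in.
  have a1 : a = 1 by move: i1; rewrite Da !mxE j1 mulr1.
  move: Da; rewrite a1 scale1r => /eqP; rewrite nth_uniq ?undup_uniq // => /eqP/val_inj ij'.
  by rewrite ij' eqxx in ij.
- move=> y yx; have [Uy Vfy] := UP y x yx Vx.
  have [Zz za] := z_alpha y Uy; have by_ := betaz y Uy.
  have : z y \in s.
    apply/sP; split.
      split; [exact: z1 | by [] |]; split; first exact/YU/mor_app_in.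
      apply: proportional_trans (yx.2); apply: mor_app_proj by_.
      exact/YU/mor_app_in.
    by apply: EP => i; apply: rtP; case: (pP i) => _ + _; apply=> //; exact: yx.2.
  rewrite -index_mem => js; exists (Ordinal js).
  by rewrite /g nth_index // -index_mem.
move=> B nB.
(* D and P are neighbourhoods of E i and x for which the claim holds; D is
   disjoint from the coordinates of points over P if E i is not kept. *)
have local i : exists D P, [/\ nbhs (E i) D, nbhs x P & forall u x', in_var e U u ->
    (mor_app e f u == x')%MS -> P x' -> D (z u) ->
    exists j, exists2 y', (u == y')%MS & B j y'].
  set v0 := E i.
  have [v1 | v1] := eqVneq (v0 0 0) 1; last first.
    exists [set v | `|v0 0 0 - v 0 0| < `|v0 0 0 - 1|], setT; split.
    - apply: (near_small (polyfun_continuous (polyfun_coord C 0) (x := v0))).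
      by rewrite normr_gt0 subr_eq0.
    - exact: filterT.
    - by move=> u x' Uu _ _ /=; rewrite z1 // ltxx.
  have v00 : v0 != 0 by apply/rV0Pn; exists 0; rewrite v1 oner_neq0.
  have [Zv|nZv] := boolP (in_var e Z v0); last first.
    have [q qZ qv] : exists2 q, q \in qp_eqs Z & mev e q v0 != 0.
      move: nZv; rewrite /in_var v00 chartZ /= orbF mev_coord v1 oner_neq0 andbT.
      by move=> /allPn[q qZ qv]; exists q.
    have q0 : 0 < `|mev e q v0| by rewrite normr_gt0.
    have cq := polyfun_continuous (polyfun_mev e q (@polymap_id C N.+1)) (x := v0).
    exists [set v | `|mev e q v0 - mev e q v| < `|mev e q v0|], setT; split.
    - exact: near_small cq q0.
    - exact: filterT.
    move=> u x' Uu _ _ /=; have [/and3P[_ /allP/(_ _ qZ)/eqP -> _] _] := z_alpha u Uu.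
    by rewrite subr0 ltxx.
  have [b bb [bv bE]] := mor_appP beta Zv.
  have pb : polymap (fun v : 'rV[C]_N.+1 => mxev e b v) by apply: polymap_mxev; exact: polymap_id.
  have Yb : in_var e Y (mor_app e beta v0) by apply/YU/mor_app_in.
  have near_u u : in_var e U u -> mxev e b (z u) != 0 -> (u == mxev e b (z u))%MS.
    move=> Uu bz; have [Zz _] := z_alpha u Uu; rewrite proportional_sym.
    have bzz := mor_app_chart Zz bb bz; rewrite proportional_sym in bzz.
    exact: proportional_trans bzz (betaz u Uu).
  have [vx | nvx] := pselect (lies_over e f (mor_app e beta v0) x).
    have vs : v0 \in s by apply/sP; split; [split | exists i].
    have js : (index v0 s < size s)%N by rewrite index_mem.
    pose j := Ordinal js.
    exists [set v | B j (mxev e b v) /\ mxev e b v != 0], setT; split.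
    - have Bj : nbhs (mxev e b v0) (B j) by have := nB j; rewrite /g /= nth_index // bE.
      exact: filterI (nbhs_polymap pb Bj) (nbhs_polymap pb (near_neq0 bv)).
    - exact: filterT.
    move=> u x' Uu _ _ [Bz bz]; exists j, (mxev e b (z u)) => //; exact: near_u.
  have [c cf [cv cE]] := mor_appP f Yb; rewrite bE in cv cE.
  have pc : polymap (fun v : 'rV[C]_n.+1 => mxev e c v) by apply: polymap_mxev; exact: polymap_id.
  have nprop : ~ (mxev e c (mxev e b v0) == x)%MS.
    by move=> cx; apply: nvx; split=> //; rewrite bE cE.
  have [A nA [A' nA' AA']] := near_not_proportional cv (in_var_neq0 Xx) nprop.
  exists [set v | mxev e b v != 0 /\ (A (mxev e c (mxev e b v)) /\ mxev e c (mxev e b v) != 0)], A'.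
  split=> //.
    apply: filterI (nbhs_polymap pb (near_neq0 bv)) _.
    apply: (nbhs_polymap pb (A := [set w | A (mxev e c w) /\ mxev e c w != 0])).
    exact: filterI (nbhs_polymap pc nA) (nbhs_polymap pc (near_neq0 cv)).
  move=> u x' Uu ux' Ax' [bz [Abz cbz]]; exfalso.
  have ub := near_u u Uu bz; apply: (AA' _ _ Abz Ax').
  have Yu := YU u Uu.
  have Yw : in_var e Y (mxev e b (z u)) by rewrite -(in_var_proj _ _ (in_var_neq0 Yu) ub).
  have cw := mor_app_chart Yw cf cbz; rewrite proportional_sym in cw.
  apply: proportional_trans cw (proportional_trans _ ux').
  by rewrite proportional_sym; exact: mor_app_proj.
have /choice[DP DPP] : forall i, exists DP : set 'rV[C]_N.+1 * set 'rV[C]_m.+1,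
    [/\ nbhs (E i) DP.1, nbhs x DP.2 & forall u x', in_var e U u ->
      (mor_app e f u == x')%MS -> DP.2 x' -> DP.1 (z u) ->
      exists j, exists2 y', (u == y')%MS & B j y'].
  by move=> i; have [D [P H]] := local i; exists (D, P).
have /choice[r rP] : forall i, exists r : C, 0 < r /\
    forall v : 'rV[C]_N.+1, (forall l, `|E i 0 l - v 0 l| < r) -> (DP i).1 v.
  by move=> i; have [/nbhs_rowP[r r0 rD] _ _] := DPP i; exists r.
have [eps eps0 epsr] := finite_min_pos (fun i => (rP i).1).
have nearDP : \forall x' \near x, forall i, (DP i).2 x'.
  by apply: (@filter_forall _ _ (fun i x' => (DP i).2 x') (nbhs x) _) => i; case: (DPP i).
have nearp : \forall x' \near x, forall i, in_var e V x' ->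
    forall t, root (p i x') t -> exists2 t0, root (p i x) t0 & `|t0 - t| < eps.
  apply: (@filter_forall _ _ (fun i x' => in_var e V x' -> forall t, root (p i x') t ->
    exists2 t0, root (p i x) t0 & `|t0 - t| < eps) (nbhs x) _) => i.
  by case: (pP i) => _ _; apply.
apply: filterS (filterI (near_open_subvar openV Vx) (filterI nearDP nearp)).
move=> x' [XV [DPx' px']] y yx'.
have Xx' : in_var e X x'.
  by case: yx' => Yy yx'; rewrite -(in_var_proj _ _ (in_var_neq0 (mor_app_in f Yy)) yx') mor_app_in.
have Vx' := XV Xx'; have [Uy Vfy] := UP y x' yx' Vx'.
have /choice[t tP] : forall i, exists t0, root (p i x) t0 /\ `|t0 - z y 0 i| < eps.
  move=> i; have [_ pz _] := pP i; have [|t0] := px' i Vx' (z y 0 i).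
    exact: pz Uy Vfy yx'.2.
  by exists t0.
have [i Ei] : exists i, E i = \row_l t l.
  by apply: EP => l; rewrite mxE; apply: rtP; case: (tP l).
have [_ _ H] := DPP i; apply: (H y x') => //; first exact: yx'.2.
have [_ rD] := rP i; apply: rD => l; rewrite Ei mxE.
by have [_ tz] := tP l; exact: lt_le_trans tz (epsr i).
Qed.

End FiniteMorphism.

(** * Conjugation *)

(** The conjugate morphism, evaluated through [e], is the given morphism
    evaluated through [e \o s]. *)
Section ConjugateCriterion.
Context (k : fieldType) (C : numClosedFieldType) (e : {rmorphism k -> C}) (s : {rmorphism k -> k}).
Context (n m : nat) (Y : qpvar k n) (X : qpvar k m) (f : morphism Y X).

Lemma mor_app_conj v : mor_app e (conj_mor s f) v = mor_app (e \o s) f v.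
Proof.
rewrite /mor_app /=; elim: (mor_charts f) => [//|c cs IHs] /=.
by rewrite mxev_conj; case: ifP.
Qed.

Lemma lies_over_conj y x : lies_over e (conj_mor s f) y x <-> lies_over (e \o s) f y x.
Proof. by rewrite /lies_over in_var_conj mor_app_conj. Qed.

Lemma finite_over_points_conj :
  finite_over_points (e \o s) f -> finite_over_points e (conj_mor s f).
Proof.
move=> fin x; rewrite in_var_conj => /fin[d [g [gx gg gall gB]]].
exists d, g; split=> //.
- by move=> i; apply/lies_over_conj.
- by move=> y /lies_over_conj; exact: gall.
- by move=> B /gB; apply: filterS => x' H y /lies_over_conj; exact: H.
Qed.

Lemma cover_criterion_conj :
  cover_criterion e (conj_mor s f) <-> cover_criterion (e \o s) f.
Proof.
have fibreE d x : fibre_ge e (conj_mor s f) d x <-> fibre_ge (e \o s) f d x.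
  by split=> -[Z [Zx ZZ]]; exists Z; split=> // i; apply/lies_over_conj.
have collE : collisions e (conj_mor s f) = collisions (e \o s) f.
  by apply/seteqP; split=> u [Yl lr nlr]; split=> //;
    move: Yl lr; rewrite ?in_var_conj ?mor_app_conj //;
    move=> _ /lies_over_conj.
have smallE d : small_fibres e (conj_mor s f) d = small_fibres (e \o s) f d.
  by apply/seteqP; split=> x []; rewrite ?in_var_conj => Xx nd; split=> //;
    rewrite ?in_var_conj // => /fibreE.
split=> -[surj noncoll noncard]; split.
- move=> x Xx; have [|y /lies_over_conj yx] := surj x; first by rewrite in_var_conj.
  by exists y.
- by move=> y Yy; rewrite -collE; apply: noncoll; rewrite in_var_conj.
- move=> d x Xx /fibreE dx; rewrite -smallE; apply: noncard dx.
  by rewrite in_var_conj.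
- move=> x; rewrite in_var_conj => /surj[y yx]; exists y; exact/lies_over_conj.
- by move=> y; rewrite in_var_conj collE; exact: noncoll.
- by move=> d x; rewrite in_var_conj smallE => Xx /fibreE; exact: noncard.
Qed.

End ConjugateCriterion.

Theorem proposition3p5 (R : realType) (k : splittingFieldType rat)
    (n m : nat) (Y : qpvar k n) (X : qpvar k m) (f : morphism Y X)
    (f_finite : finite_morphism f) (f_dominant : dominant f)
    (eps : {rmorphism k -> R[i]})
    (iota : {rmorphism k -> algC})
    (sigma : {rmorphism algC -> algC}) (sigma_bij : bijective sigma) :
  topological_cover (points_map eps f) <->
  topological_cover (points_map eps (conj_mor (gal_restrict iota sigma) f)).
Proof.
set s := gal_restrict iota sigma.
have [sigma' sigmaK sigma'K] := sigma_bij.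
have sigma'B : zmod_morphism sigma'.
  by move=> a b; apply: (can_inj sigmaK); rewrite rmorphB !sigma'K.
have sigma'M : monoid_morphism sigma'.
  split; first by apply: (can_inj sigmaK); rewrite rmorph1 sigma'K.
  by move=> a b; apply: (can_inj sigmaK); rewrite rmorphM !sigma'K.
(* The inverse of sigma restricts to an inverse of s, which is thus onto. *)
pose sB := GRing.isZmodMorphism.Build algC algC sigma' sigma'B.
pose sM := GRing.isMonoidMorphism.Build algC algC sigma' sigma'M.
pose sigmaI : {rmorphism algC -> algC} := HB.pack sigma' sB sM.
pose s' := gal_restrict iota sigmaI.
have ss' a : s (s' a) = a.
  apply: (fmorph_inj iota); rewrite !gal_restrictE; exact: sigma'K.
have s's a : s' (s a) = a.
  apply: (fmorph_inj iota); rewrite !gal_restrictE; exact: sigmaK.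
have fin (e : {rmorphism k -> R[i]}) : finite_over_points e f by exact: finite_morphism_points.
rewrite (cover_criterionP (fin eps)).
rewrite (cover_criterionP (finite_over_points_conj (fin (eps \o s)))).
rewrite cover_criterion_conj.
have [tau tau_bij tauE] := extend_automorphism eps (s := s) (fun a => ex_intro _ (s' a) (ss' a)).
have [tau' tau'_bij tau'E] :=
  extend_automorphism (eps \o s) (s := s') (fun a => ex_intro _ (s a) (s's a)).
split.
  exact: (@cover_criterion_transport k R[i] eps (eps \o s) tau tau_bij (fun a => esym (tauE a))).
apply: (cover_criterion_transport tau'_bij) => a.
by rewrite tau'E /= ss'.
Qed.
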